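(* Let $\theta\in[0,2\pi)$, $u,v\in\mathbb H$, and let $\Omega,\Xi\subset\mathbb H$ be conformally equivalent domains with $T(\Xi)=\Omega$, where $T(z)=(az+b)(cz+d)^{-1}$ is a quaternionic Möbius transformation ($a,b,c,d\in\mathbb H$, with $ad\ne0$ if $c=0$ and $b-ac^{-1}d\neq0$ if $c\ne0$). Let $\delta_T=(B_T)^{-1}v(A_T\circ T^{-1})$ on $\Omega$ and $\gamma_T(z)=e^{-2\langle v-u,z\rangle_\theta}\rho_T(z)$ for $z\in\Xi$. Let $${}^\theta_{\delta_T}\mathcal A(\Omega)={}^\theta_{\delta_T}\mathfrak M(\Omega)\cap\mathcal L_2(\Omega,\mathbb H),\qquad {}^\theta_u\mathcal A_{\gamma_T}(\Xi)={}^\theta_u\mathfrak M(\Xi)\cap\mathcal L_{2,\gamma_T}(\Xi,\mathbb H),$$ equipped with the inner products $\langle f,g\rangle=\int_\Omega\bar f g\,d\mu$ and $\langle f,g\rangle=\int_\Xi\bar f g\,\gamma_T\,d\mu$, respectively. Let $\mathcal J_T$ be the operator $$\mathcal J_T[f](z)=e^{\langle v-u,z\rangle_\theta}\,C_T(z)\,f(T(z)),\qquad z\in\Xi .$$ Then $\mathcal J_T$ restricts to an isometric isomorphism ${}^\theta_{\delta_T}\mathcal A(\Omega)\to{}^\theta_u\mathcal A_{\gamma_T}(\Xi)$ of quaternionic right-Hilbert spaces. Moreover, $${}^\theta_u\mathcal B_{\Xi,\gamma_T}(z,w)=e^{\langle v-u,z+w\rangle_\theta}\,C_T(z)\;{}^\theta_{\delta_T}\mathcal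 B_\Omega(T(z),T(w))\;\overline{C_T(w)},\qquad z,w\in\Xi,$$ $${}^\theta_u\mathfrak B_{\Xi,\gamma_T}=\mathcal J_T\circ{}^\theta_{\delta_T}\mathfrak B_\Omega\circ\mathcal J_T^{-1},$$ where ${}^\theta_u\mathcal B_{\Xi,\gamma_T}$ and ${}^\theta_{\delta_T}\mathcal B_\Omega$ are the Bergman kernels, and ${}^\theta_u\mathfrak B_{\Xi,\gamma_T}$ and ${}^\theta_{\delta_T}\mathfrak B_\Omega$ the Bergman projections, of ${}^\theta_u\mathcal A_{\gamma_T}(\Xi)$ and ${}^\theta_{\delta_T}\mathcal A(\Omega)$ respectively.
   Context: $\mathbb H$ denotes the real quaternions with units $i,j,k$; $\overline{q}$ is quaternionic conjugation and $|q|$ the Euclidean norm; $d\mu$ is Lebesgue measure. Put $\psi_0=1,\ \psi_1=i,\ \psi_2=ie^{i\theta}j,\ \psi_3=e^{i\theta}j$, a real orthonormal basis of $\mathbb H$; every $z\in\mathbb H$ is written $z=\sum_{k=0}^3x_k\psi_k$, $x_k\in\mathbb R$. For $x=\sum x_k\psi_k$, $y=\sum y_k\psi_k$ set $\langle x,y\rangle_\theta=\sum_kx_ky_k$. ${}^\theta\mathcal D[f]=\sum_{k}\psi_k\frac{\partial f}{\partial x_k}$. ${}^\theta_{\delta_T}\mathfrak M(\Omega)$ is the right-linear space of $f\in C^1(\Omega,\mathbb H)$ with ${}^\theta\mathcal D[f]+\delta_Tf=0$ on $\Omega$, and ${}^\theta_u\mathfrak M(\Xi)$ that of $g\in C^1(\Xi,\mathbb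 H)$ with ${}^\theta\mathcal D[g]+ug=0$ on $\Xi$. $\mathcal L_{2,\gamma}(\Xi,\mathbb H)$ is the space of $\mathbb H$-valued functions square integrable with respect to $\gamma\,d\mu$, with $\mathbb H$-valued inner product $\int_\Xi\bar fg\,\gamma\,d\mu$. ($T$ is well defined on $\Xi$, i.e. $cz+d\neq0$ there.) Conformal weights ($z\in\Xi$, $\zeta\in\Omega$). If $c=0$: $$A_T(z)=\bar d,\quad B_T(\zeta)=\bar a,\quad C_T(z)=\frac{|a|^2}{|d|}d^{-1},\quad\rho_T(z)=1 .$$ If $c\ne0$, with $\beta=b-ac^{-1}d$ and $y=cz\beta^{-1}+d\beta^{-1}$: $$A_T(z)=\bar\beta\frac{\bar y}{|y|^4},\quad B_T(\zeta)=-\bar c\,\overline{(\zeta-ac^{-1})}\,|\zeta-ac^{-1}|^4,\quad C_T(z)=\frac{|c|^2}{|\beta|}\beta^{-1}\frac{\bar y}{|y|^4},\quad\rho_T(z)=\frac1{|y|^2}.$$ $(B_T)^{-1}$ is the pointwise multiplicative inverse and $T^{-1}$ the inverse mapping. Bergman kernel and projection: for such a space $\mathcal A\subset\mathcal L_{2,\gamma}(U,\mathbb H)$ (with $\gamma=1$ for $U=\Omega$, $\gamma=\gamma_T$ for $U=\Xi$), the Bergman kernel is the reproducing kernel $\mathcal B:U\times U\to\mathbb H$ with $\overline{\mathcal B(z,\cdot)}\in\mathcal A$ and $f(z)=\int_U\mathcal B(z,w)f(w)\gamma(w)\,d\mu_w$ for all $f\in\mathcal A$, $z\in U$; the Bergman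 projection is $\mathfrak B[f](z)=\int_U\mathcal B(z,w)f(w)\gamma(w)\,d\mu_w$ for $f\in\mathcal L_{2,\gamma}(U,\mathbb H)$. In the identity for projections, $\mathcal J_T$ acts from $\mathcal L_2(\Omega,\mathbb H)$ onto $\mathcal L_{2,\gamma_T}(\Xi,\mathbb H)$. *)

(* Defs.v *)
From HB Require Import structures.
From mathcomp Require Import all_boot all_order all_algebra.
From mathcomp Require Import all_classical all_reals all_analysis.
From mathcomp Require Import ring lra.

Set Implicit Arguments.
Unset Strict Implicit.
Unset Printing Implicit Defensive.

Import Order.TTheory GRing.Theory Num.Theory.
Import numFieldNormedType.Exports.

Local Open Scope classical_set_scope.
Local Open Scope ring_scope.

Record quat (R : realType) := Quat { qre : R; qi : R; qj : R; qk : R }.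

Section quat_algebra.
Context {R : realType}.
Implicit Types (p q r : quat R) (s t : R).

Definition quat_of_prod (x : R * R * R * R) : quat R :=
  Quat x.1.1.1 x.1.1.2 x.1.2 x.2.

Definition prod_of_quat q : R * R * R * R := (qre q, qi q, qj q, qk q).

Lemma prod_of_quatK : cancel prod_of_quat quat_of_prod.
Proof. by case. Qed.

Lemma quat_of_prodK : cancel quat_of_prod prod_of_quat.
Proof. by case=> [[[]]]. Qed.

HB.instance Definition _ := Choice.copy (quat R) (can_type prod_of_quatK).

Definition qadd p q :=
  Quat (qre p + qre q) (qi p + qi q) (qj p + qj q) (qk p + qk q).
Definition qopp p := Quat (- qre p) (- qi p) (- qj p) (- qk p).
Definition qzero : quat R := Quat 0 0 0 0.

Fact qaddA : associative qadd.
Proof. by move=> [? ? ? ?] [? ? ? ?] [? ? ? ?]; rewrite /qadd /= !addrA. Qed.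
Fact qaddC : commutative qadd.
Proof. by move=> [a b c d] [e f g h]; congr Quat => /=; rewrite addrC. Qed.
Fact qadd0 : left_id qzero qadd.
Proof. by move=> [? ? ? ?]; rewrite /qadd /= !add0r. Qed.
Fact qaddN : left_inverse qzero qopp qadd.
Proof. by move=> [? ? ? ?]; rewrite /qadd /= !addNr. Qed.

HB.instance Definition _ :=
  GRing.isZmodule.Build (quat R) qaddA qaddC qadd0 qaddN.

Definition qscale s q := Quat (s * qre q) (s * qi q) (s * qj q) (s * qk q).

Fact qscaleA s t q : qscale s (qscale t q) = qscale (s * t) q.
Proof. by rewrite /qscale /= !mulrA. Qed.
Fact qscale1 : left_id 1 qscale.
Proof. by move=> [? ? ? ?]; rewrite /qscale /= !mul1r. Qed.
Fact qscaleDr : right_distributive qscale +%R.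
Proof. by move=> s p q; congr Quat; rewrite /= mulrDr. Qed.
Fact qscaleDl q : {morph qscale^~ q : s t / s + t}.
Proof. by move=> s t; congr Quat; rewrite /= mulrDl. Qed.

HB.instance Definition _ := GRing.Zmodule_isLmodule.Build R (quat R)
  qscaleA qscale1 qscaleDr qscaleDl.

Definition qone : quat R := Quat 1 0 0 0.
Definition qmul p q := Quat
  (qre p * qre q - qi p * qi q - qj p * qj q - qk p * qk q)
  (qre p * qi q + qi p * qre q + qj p * qk q - qk p * qj q)
  (qre p * qj q - qi p * qk q + qj p * qre q + qk p * qi q)
  (qre p * qk q + qi p * qj q - qj p * qi q + qk p * qre q).

Fact qmulA : associative qmul.
Proof. by move=> p q r; congr Quat => /=; ring. Qed.
Fact qmul1l : left_id qone qmul.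
Proof. by move=> [? ? ? ?]; congr Quat => /=; ring. Qed.
Fact qmul1r : right_id qone qmul.
Proof. by move=> [? ? ? ?]; congr Quat => /=; ring. Qed.
Fact qmulDl : left_distributive qmul +%R.
Proof. by move=> p q r; congr Quat => /=; ring. Qed.
Fact qmulDr : right_distributive qmul +%R.
Proof. by move=> p q r; congr Quat => /=; ring. Qed.
Fact qone_neq0 : qone != 0 :> quat R.
Proof. by apply/eqP => -[] /eqP; rewrite oner_eq0. Qed.

HB.instance Definition _ := GRing.Zmodule_isNzRing.Build (quat R)
  qmulA qmul1l qmul1r qmulDl qmulDr qone_neq0.

Fact qscaleAl s p q : s *: (p * q) = (s *: p) * q.
Proof. by congr Quat => /=; ring. Qed.
HB.instance Definition _ := GRing.Lmodule_isLalgebra.Build R (quat R) qscaleAl.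

Fact qscaleAr s p q : s *: (p * q) = p * (s *: q).
Proof. by congr Quat => /=; ring. Qed.
HB.instance Definition _ := GRing.Lalgebra_isAlgebra.Build R (quat R) qscaleAr.

Definition qconj q := Quat (qre q) (- qi q) (- qj q) (- qk q).
Definition qnormsq q := qre q ^+ 2 + qi q ^+ 2 + qj q ^+ 2 + qk q ^+ 2.
Definition qinv q := (qnormsq q)^-1 *: qconj q.

Lemma qnormsq_ge0 q : 0 <= qnormsq q.
Proof. by rewrite !addr_ge0 ?sqr_ge0. Qed.

Lemma qnormsq_eq0 q : (qnormsq q == 0) = (q == 0).
Proof.
apply/eqP/eqP => [|->]; last by rewrite /qnormsq /= !expr0n /= !addr0.
case: q => a b c d; rewrite /qnormsq /= => h.
have zero (x : R) : x ^+ 2 <= 0 -> x = 0.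
  by move=> x0; apply/eqP; rewrite -sqrf_eq0 eq_le x0 sqr_ge0.
have := sqr_ge0 a; have := sqr_ge0 b; have := sqr_ge0 c; have := sqr_ge0 d.
by move=> *; congr Quat; apply: zero; lra.
Qed.

Lemma qconjMl q : qconj q * q = (qnormsq q)%:A.
Proof. by congr Quat => /=; rewrite /qnormsq; ring. Qed.

Lemma qconjMr q : q * qconj q = (qnormsq q)%:A.
Proof. by congr Quat => /=; rewrite /qnormsq; ring. Qed.

Fact qmulVl : {in [pred q : quat R | q != 0], left_inverse 1 qinv *%R}.
Proof.
move=> q /= q0; rewrite /qinv -scalerAl qconjMl scalerA mulVf ?scale1r//.
by rewrite qnormsq_eq0.
Qed.
Fact qmulVr : {in [pred q : quat R | q != 0], right_inverse 1 qinv *%R}.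
Proof.
move=> q /= q0; rewrite /qinv -scalerAr qconjMr scalerA mulVf ?scale1r//.
by rewrite qnormsq_eq0.
Qed.
Fact qunitP p q : q * p = 1 /\ p * q = 1 -> p \in [pred q : quat R | q != 0].
Proof.
move=> [qp1 _]; apply/eqP => p0; move: qp1; rewrite p0 mulr0 => /esym/eqP.
by rewrite oner_eq0.
Qed.
Fact qinv0id : {in [predC [pred q : quat R | q != 0]], qinv =1 id}.
Proof.
move=> q; rewrite !inE negbK => /eqP ->; rewrite /qinv.
by congr Quat; rewrite /= ?oppr0 mulr0.
Qed.

HB.instance Definition _ := GRing.NzRing_hasMulInverse.Build (quat R)
  qmulVl qmulVr qunitP qinv0id.

(* [`|q|] and the topology of [quat R] are the Euclidean ones. *)
Definition qnorm q : R := Num.sqrt (qnormsq q).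

Fact ler_qnormD p q : qnorm (p + q) <= qnorm p + qnorm q.
Proof.
have sq r : qnorm r ^+ 2 = qnormsq r by rewrite sqr_sqrtr ?qnormsq_ge0.
have n0 r : 0 <= qnorm r by exact: sqrtr_ge0.
rewrite -(@ler_pXn2r _ 2) ?nnegrE ?addr_ge0// sqrrD !sq.
pose t := qre p * qre q + qi p * qi q + qj p * qj q + qk p * qk q.
have -> : qnormsq (p + q) = qnormsq p + t *+ 2 + qnormsq q.
  by rewrite /qnormsq /t /=; ring.
rewrite lerD2r lerD2l lerMn2r /=; apply: (le_trans (ler_norm _)).
rewrite -(@ler_pXn2r _ 2) ?nnegrE ?mulr_ge0// exprMn !sq real_normK ?num_real//.
rewrite -subr_ge0 /t /qnormsq.
set D := (X in 0 <= X).
have -> : D = (qre p * qi q - qi p * qre q) ^+ 2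
  + (qre p * qj q - qj p * qre q) ^+ 2 + (qre p * qk q - qk p * qre q) ^+ 2
  + (qi p * qj q - qj p * qi q) ^+ 2 + (qi p * qk q - qk p * qi q) ^+ 2
  + (qj p * qk q - qk p * qj q) ^+ 2 by rewrite /D; ring.
by rewrite !addr_ge0 ?sqr_ge0.
Qed.

Fact qnormZ s q : qnorm (s *: q) = `|s| * qnorm q.
Proof.
rewrite /qnorm -sqrtr_sqr -sqrtrM ?sqr_ge0//; congr Num.sqrt.
by rewrite /qnormsq /=; ring.
Qed.

Fact qnorm0_eq0 q : qnorm q = 0 -> q = 0.
Proof.
move=> /eqP; rewrite sqrtr_eq0 => q0; apply/eqP.
by rewrite -qnormsq_eq0 eq_le q0 qnormsq_ge0.
Qed.

HB.instance Definition _ :=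
  Lmodule_isNormed.Build R (quat R) ler_qnormD qnormZ qnorm0_eq0.

Lemma quat_normE q : `|q| = Num.sqrt (qnormsq q).
Proof. by []. Qed.

(* The Borel sets: transported from the product sigma-algebra of [R ^ 4]. *)
Definition quat_measurable : set (set (quat R)) :=
  [set A | measurable (quat_of_prod @^-1` A)].

Fact quat_measurable0 : quat_measurable set0.
Proof. by rewrite /quat_measurable /= preimage_set0; exact: measurable0. Qed.
Fact quat_measurableC A : quat_measurable A -> quat_measurable (~` A).
Proof. by rewrite /quat_measurable /= preimage_setC; exact: measurableC. Qed.
Fact quat_measurable_bigcup (F : (set (quat R))^nat) :
  (forall i, quat_measurable (F i)) -> quat_measurable (\bigcup_i F i).
Proof.
rewrite /quat_measurable /= preimage_bigcup => mF.
by apply: bigcupT_measurable => i; exact: mF.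
Qed.

HB.instance Definition _ := @isMeasurable.Build default_measure_display (quat R)
  quat_measurable quat_measurable0 quat_measurableC quat_measurable_bigcup.

Fact measurable_quat_of_prod : measurable_fun setT quat_of_prod.
Proof. by move=> _ A mA; rewrite setTI. Qed.

Definition qvol : set (quat R) -> \bar R :=
  pushforward (lebesgue_measure \x lebesgue_measure \x lebesgue_measure
               \x lebesgue_measure)%E quat_of_prod.

Fact qvol0 : qvol set0 = 0%E.
Proof. by rewrite /qvol /pushforward preimage_set0 measure0. Qed.
Fact qvol_ge0 A : (0 <= qvol A)%E.
Proof. by rewrite /qvol /pushforward measure_ge0. Qed.
Fact qvol_sigma_additive : semi_sigma_additive qvol.
Proof.
move=> F mF tF mUF; rewrite /qvol /pushforward preimage_bigcup.
apply: measure_semi_sigma_additive => //.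
apply/trivIsetP => /= i j _ _ ij; rewrite -preimage_setI.
by move/trivIsetP : tF => /(_ _ _ _ _ ij) ->//; rewrite preimage_set0.
Qed.

HB.instance Definition _ := isMeasure.Build _ (quat R) R qvol
  qvol0 qvol_ge0 qvol_sigma_additive.

End quat_algebra.

Section theta_basis.
Context {R : realType}.
Implicit Types (theta : R) (z p q : quat R).

Definition unit_i : quat R := Quat 0 1 0 0.
Definition unit_j : quat R := Quat 0 0 1 0.

(* [e ^ (i theta)] *)
Definition qexpi theta : quat R := Quat (cos theta) (sin theta) 0 0.

Definition psi theta (k : 'I_4) : quat R :=
  [:: 1; unit_i; unit_i * qexpi theta * unit_j; qexpi theta * unit_j]`_k.

(* The coordinate [x_k] of [z] in the basis [psi]; see [psi_expansion] and
   [coord_psi_sum]. *)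
Definition coord theta (k : 'I_4) z : R := qre (qconj (psi theta k) * z).

Lemma psi_expansion theta z : z = \sum_(k < 4) coord theta k z *: psi theta k.
Proof.
rewrite !big_ord_recr big_ord0 /= add0r /coord /psi /=.
have h x : x = (cos theta ^+ 2 + sin theta ^+ 2) * x.
  by rewrite cos2Dsin2 mul1r.
case: z => x0 x1 x2 x3; congr Quat => /=; first by ring.
- by ring.
- by rewrite {1}(h x2); ring.
- by rewrite {1}(h x3); ring.
Qed.

Lemma coord_psi theta (k l : 'I_4) : coord theta k (psi theta l) = (k == l)%:R.
Proof.
have cs := cos2Dsin2 theta.
case: k => -[|[|[|[|//]]]] ?; case: l => -[|[|[|[|//]]]] ?;
  rewrite /coord /psi /=; first [by ring
    | by transitivity (cos theta ^+ 2 + sin theta ^+ 2); [ring|exact: cs]].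
Qed.

Lemma coord_psi_sum theta (x : 'I_4 -> R) k :
  coord theta k (\sum_(l < 4) x l *: psi theta l) = x k.
Proof.
have coordD p q : coord theta k (p + q) = coord theta k p + coord theta k q.
  by rewrite /coord mulrDr.
have coordZ c p : coord theta k (c *: p) = c * coord theta k p.
  by rewrite /coord -scalerAr.
rewrite (big_morph _ coordD (id1 := 0)); last by rewrite /coord mulr0.
rewrite (bigD1 k) //= coordZ coord_psi eqxx mulr1 big1 ?addr0// => l lk.
by rewrite coordZ coord_psi eq_sym (negbTE lk) mulr0.
Qed.

Definition dotq theta p q : R := \sum_(k < 4) coord theta k p * coord theta k q.

(* The derivative along [psi theta k] is the partial derivative in [x_k]. *)
Definition Dtheta theta (f : quat R -> quat R) z : quat R :=
  \sum_(k < 4) psi theta k * 'D_(psi theta k) f z.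

End theta_basis.

Section function_spaces.
Context {R : realType}.
Implicit Types (U : set (quat R)) (f g : quat R -> quat R).

Definition domain U := [/\ open U, connected U & U !=set0].

(* Meant for open [U]. *)
Definition C1 U f : Prop :=
  (forall z, U z -> differentiable f z) /\
  (forall v z, U z -> {for z, continuous (fun w => 'D_v f w)}).

Definition hyperhol (theta : R) (delta : quat R -> quat R) U :
    set (quat R -> quat R) :=
  [set f : quat R -> quat R | C1 U f /\ forall z, U z -> Dtheta theta f z + delta z * f z = 0].

Definition sq_integrable (gamma : quat R -> R) U : set (quat R -> quat R) :=
  [set f : quat R -> quat R | measurable_fun U f /\
     (\int[qvol]_(z in U) (gamma z * `|f z| ^+ 2)%:E < +oo)%E].

Definition qintegral U (F : quat R -> quat R) : quat R := Quat
  (\int[qvol]_(z in U) qre (F z)) (\int[qvol]_(z in U) qi (F z))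
  (\int[qvol]_(z in U) qj (F z)) (\int[qvol]_(z in U) qk (F z)).

(* A space of functions on [fs_dom] with weight [fs_wt]; functions are total,
   and two members are identified when related by [fs_eq]. *)
Record fspace := FSpace {
  fs_dom : set (quat R);
  fs_wt : quat R -> R;
  fs_eq : (quat R -> quat R) -> (quat R -> quat R) -> Prop;
  fs_mem : set (quat R -> quat R) }.

Definition L2space gamma U := FSpace U gamma
  (fun f g => {ae qvol, forall z, U z -> f z = g z}) (sq_integrable gamma U).

Definition bergman_space theta delta gamma U := FSpace U gamma
  (fun f g => forall z, U z -> f z = g z)
  (hyperhol theta delta U `&` sq_integrable gamma U).

Definition inner (X : fspace) f g : quat R :=
  qintegral (fs_dom X) (fun z => fs_wt X z *: (qconj (f z) * g z)).

Definition inner_norm X f : R := Num.sqrt (qre (inner X f f)).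

Record right_hilbert (X : fspace) : Prop := RightHilbert {
  rh_mem0 : fs_mem X (fun=> 0);
  rh_memD : forall f g, fs_mem X f -> fs_mem X g ->
    fs_mem X (fun z => f z + g z);
  rh_memM : forall f q, fs_mem X f -> fs_mem X (fun z => f z * q);
  rh_innerC : forall f g, fs_mem X f -> fs_mem X g ->
    inner X g f = qconj (inner X f g);
  rh_innerD : forall f g h, fs_mem X f -> fs_mem X g -> fs_mem X h ->
    inner X f (fun z => g z + h z) = inner X f g + inner X f h;
  rh_innerM : forall f g q, fs_mem X f -> fs_mem X g ->
    inner X f (fun z => g z * q) = inner X f g * q;
  rh_inner_ge0 : forall f, fs_mem X f -> 0 <= qre (inner X f f);
  rh_inner_eq0 : forall f, fs_mem X f -> inner X f f = 0 ->
    fs_eq X f (fun=> 0);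
  rh_complete : forall F : nat -> quat R -> quat R,
    (forall n, fs_mem X (F n)) ->
    (forall e : R, 0 < e -> exists N : nat, forall m n : nat,
      (N <= m)%N -> (N <= n)%N -> inner_norm X (fun z => F m z - F n z) < e) ->
    exists2 f, fs_mem X f &
      inner_norm X (fun z => F n z - f z) @[n --> \oo] --> (0 : R) }.

Record isometric_iso (X Y : fspace)
    (J : (quat R -> quat R) -> quat R -> quat R) : Prop := IsometricIso {
  iso_mem : forall f, fs_mem X f -> fs_mem Y (J f);
  iso_eq : forall f g, fs_mem X f -> fs_mem X g ->
    (fs_eq X f g <-> fs_eq Y (J f) (J g));
  isoD : forall f g, fs_mem X f -> fs_mem X g ->
    fs_eq Y (J (fun z => f z + g z)) (fun z => J f z + J g z);
  isoM : forall f q, fs_mem X f ->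
    fs_eq Y (J (fun z => f z * q)) (fun z => J f z * q);
  iso_inner : forall f g, fs_mem X f -> fs_mem X g ->
    inner Y (J f) (J g) = inner X f g;
  iso_surj : forall g, fs_mem Y g -> exists2 f, fs_mem X f & fs_eq Y (J f) g }.

Definition inverse_operator (X Y : fspace)
    (J Jinv : (quat R -> quat R) -> quat R -> quat R) : Prop :=
  (forall f, fs_mem X f -> fs_eq X (Jinv (J f)) f) /\
  (forall g, fs_mem Y g -> fs_mem X (Jinv g) /\ fs_eq Y (J (Jinv g)) g).

(* The Bergman kernel is determined by this on [fs_dom X `*` fs_dom X]. *)
Definition bergman_kernel (X : fspace) (K : quat R -> quat R -> quat R) : Prop :=
  (forall z, fs_dom X z -> fs_mem X (fun w => qconj (K z w))) /\
  (forall f z, fs_mem X f -> fs_dom X z ->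
     f z = qintegral (fs_dom X) (fun w => fs_wt X w *: (K z w * f w))).

(* Applied to [f] in the whole space [L2space (fs_wt X) (fs_dom X)]. *)
Definition bergman_proj (X : fspace) (K : quat R -> quat R -> quat R) f z :
    quat R :=
  qintegral (fs_dom X) (fun w => fs_wt X w *: (K z w * f w)).

End function_spaces.

Section moebius.
Context {R : realType}.
Implicit Types (a b c d z zeta u v : quat R).

Definition moebius a b c d z := (a * z + b) * (c * z + d)^-1.

Definition beta a b c d := b - a * c^-1 * d.

Definition ycoef a b c d z :=
  c * z * (beta a b c d)^-1 + d * (beta a b c d)^-1.

Definition A_T a b c d z : quat R :=
  if c == 0 then qconj d
  else qconj (beta a b c d) *
       (`|ycoef a b c d z| ^- 4 *: qconj (ycoef a b c d z)).

Definition B_T a b c d zeta : quat R :=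
  if c == 0 then qconj a
  else - (`|zeta - a * c^-1| ^+ 4 *: (qconj c * qconj (zeta - a * c^-1))).

Definition C_T a b c d z : quat R :=
  if c == 0 then (`|a| ^+ 2 / `|d|) *: d^-1
  else (`|c| ^+ 2 / `|beta a b c d|) *:
       ((beta a b c d)^-1 *
        (`|ycoef a b c d z| ^- 4 *: qconj (ycoef a b c d z))).

Definition rho_T a b c d z : R :=
  if c == 0 then 1 else `|ycoef a b c d z| ^- 2.

Definition gamma_T theta a b c d u v z : R :=
  expR (- 2 * dotq theta (v - u) z) * rho_T a b c d z.

(* [pinv Xi T] is the inverse of [T] from the image [T @` Xi] back to [Xi]. *)
Definition delta_T a b c d (Xi : set (quat R)) v zeta : quat R :=
  (B_T a b c d zeta)^-1 * v * A_T a b c d (pinv Xi (moebius a b c d) zeta).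

Definition J_T theta a b c d u v (f : quat R -> quat R) z : quat R :=
  expR (dotq theta (v - u) z) *: (C_T a b c d z * f (moebius a b c d z)).

End moebius.

(* Main.v *)
Require Import Defs.
From HB Require Import structures.
From mathcomp Require Import all_boot all_order all_algebra.
From mathcomp Require Import all_classical all_reals all_analysis.
From mathcomp Require Import measurable_realfun ring lra.

Set Implicit Arguments.
Unset Strict Implicit.
Unset Printing Implicit Defensive.

Import Order.TTheory GRing.Theory Num.Theory.
Import numFieldNormedType.Exports.

Local Open Scope classical_set_scope.
Local Open Scope ring_scope.

(** The basis [psi] is orthonormal, so [Dtheta] is the Fueter operator in any
    orthonormal frame ([Dtheta_fueter]) and [theta] disappears from the problem.

    Two identities make [J_T] work. The Fueter operator is conformally covariant:
    multiplying [f \o T] by [C_T] multiplies the operator by [B_T] on the left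
    ([moebius_fueter]), which turns the potential [delta_T] on [Omega] into the
    constant [v] on [Xi] ([moebius_covariance]); the factor [e^<v - u, z>] then
    changes [v] into [u] ([fueter_qexpdot]). And [rho_T |C_T|^2] is the Jacobian
    determinant of [T] ([integral_moebius_signed]), while the exponentials cancel
    against those in [gamma_T], so that [J_T] is isometric for all square
    integrable functions ([J_isometry]). An explicit inverse of [T] gives the
    inverse of [J_T]. Both identities are checked on affine maps and on the
    inversion. For the change of variables, an additive bijection multiplies
    volumes by a constant, which is found on a set whose image is known
    ([haar_twist]), and the inversion preserves the Haar measure of the
    multiplicative group ([haar_inv]).

    The spaces are Hilbert spaces with reproducing kernels because evaluation at
    a point is bounded and locally uniform limits of solutions are solutions. On
    [Xi] the potential is constant, and an exponential factor reduces to
    monogenic functions, the kernel of the Fueter operator [D]. For those, both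
    facts follow from a mean value property with a radial weight, the [bump]. The
    radial derivative of the weighted average of [g] is the trace of the matrix of
    integrals [\int x_k bump (d_l g)]; integration by parts shows that this matrix
    is symmetric, and then [D g = 0] forces its trace to vanish
    ([symmetric_fueter_trace]). The resulting formula bounds the value at a point
    by an [L2] norm ([local_estimate]), and, read as a convolution with a [C1]
    kernel, it passes to uniform limits together with its derivatives
    ([monogenic_limit]). On [Omega] the potential is not constant, and
    completeness and bounded evaluation are transported by [J_T].

    The kernel at [z] comes from the function of minimal norm with value [1] at
    [z] ([reproducing_element]). Kernels are unique, so it suffices that the
    right-hand side of the kernel formula reproduces the functions on [Xi]; this
    is the isometry applied to the kernel of [Omega], and so is the formula for
    the projections ([pullback_kernel_integral]). *)

(** * Norm, conjugation and real components *)

Section quat_norm.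
Context {R : realType}.
Implicit Types (p q : quat R).

Lemma qnorm_sqr q : `|q| ^+ 2 = qnormsq q.
Proof. by rewrite quat_normE sqr_sqrtr// qnormsq_ge0. Qed.

Lemma qnormM p q : `|p * q| = `|p| * `|q|.
Proof.
rewrite !quat_normE -sqrtrM ?qnormsq_ge0//; congr Num.sqrt.
by rewrite /qnormsq /=; ring.
Qed.

Lemma qnorm_conj q : `|qconj q| = `|q|.
Proof. by rewrite !quat_normE; congr Num.sqrt; rewrite /qnormsq /=; ring. Qed.

Lemma qnorm1 : `|1 : quat R| = 1.
Proof. by rewrite quat_normE /qnormsq /= expr1n !expr0n /= !addr0 sqrtr1. Qed.

Lemma quat_unitE q : (q \is a GRing.unit) = (q != 0).
Proof. by []. Qed.

Lemma quat_mulVf q : q != 0 -> q^-1 * q = 1.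
Proof. by move=> q0; rewrite mulVr. Qed.

Lemma quat_mulfV q : q != 0 -> q * q^-1 = 1.
Proof. by move=> q0; rewrite divrr. Qed.

Lemma quat_inv0 : (0 : quat R)^-1 = 0.
Proof. by rewrite invr_out// quat_unitE eqxx. Qed.

Lemma qnormV q : `|q^-1| = `|q|^-1.
Proof.
have [->|q0] := eqVneq q 0; first by rewrite quat_inv0 normr0 invr0.
apply: (mulIf (x := `|q|)); first by rewrite normr_eq0.
by rewrite mulVf ?normr_eq0// -qnormM quat_mulVf// qnorm1.
Qed.

Lemma quat_invE q : q^-1 = (qnormsq q)^-1 *: qconj q.
Proof. by []. Qed.

Lemma quat_mul_eq0 p q : (p * q == 0) = (p == 0) || (q == 0).
Proof. by rewrite -(normr_eq0 (p * q)) qnormM mulf_eq0 !normr_eq0. Qed.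

Lemma quat_inv_eq0 q : (q^-1 == 0) = (q == 0).
Proof. by rewrite -(normr_eq0 q^-1) qnormV invr_eq0 normr_eq0. Qed.

Lemma quat_invrM p q : p != 0 -> q != 0 -> (p * q)^-1 = q^-1 * p^-1.
Proof. by move=> p0 q0; rewrite invrM ?quat_unitE. Qed.

Lemma qconjM p q : qconj (p * q) = qconj q * qconj p.
Proof. by congr Quat => /=; ring. Qed.

Lemma qconjK q : qconj (qconj q) = q.
Proof. by case: q => *; rewrite /qconj /= !opprK. Qed.

Lemma qconjZ (s : R) q : qconj (s *: q) = s *: qconj q.
Proof. by congr Quat => /=; ring. Qed.

Lemma ler_norm_qre q : `|qre q| <= `|q|.
Proof.
rewrite -(@ler_pXn2r _ 2) ?nnegrE// qnorm_sqr real_normK ?num_real// /qnormsq.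
by rewrite -!addrA lerDl !addr_ge0 ?sqr_ge0.
Qed.

Lemma ler_norm_qi q : `|qi q| <= `|q|.
Proof.
rewrite -(@ler_pXn2r _ 2) ?nnegrE// qnorm_sqr real_normK ?num_real// /qnormsq.
by rewrite -!addrA addrCA lerDl !addr_ge0 ?sqr_ge0.
Qed.

Lemma ler_norm_qj q : `|qj q| <= `|q|.
Proof.
rewrite -(@ler_pXn2r _ 2) ?nnegrE// qnorm_sqr real_normK ?num_real// /qnormsq.
rewrite addrAC lerDr !addr_ge0 ?sqr_ge0//.
Qed.

Lemma ler_norm_qk q : `|qk q| <= `|q|.
Proof.
rewrite -(@ler_pXn2r _ 2) ?nnegrE// qnorm_sqr real_normK ?num_real// /qnormsq.
by rewrite lerDr !addr_ge0 ?sqr_ge0.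
Qed.

Lemma qnorm_le_sum q : `|q| <= `|qre q| + `|qi q| + `|qj q| + `|qk q|.
Proof.
rewrite -(@ler_pXn2r _ 2) ?nnegrE ?addr_ge0// qnorm_sqr /qnormsq.
rewrite -(real_normK (num_real (qre q))) -(real_normK (num_real (qi q))).
rewrite -(real_normK (num_real (qj q))) -(real_normK (num_real (qk q))).
have := normr_ge0 (qre q); have := normr_ge0 (qi q).
have := normr_ge0 (qj q); have := normr_ge0 (qk q).
move: `|qre q| `|qi q| `|qj q| `|qk q| => a b c d a0 b0 c0 d0.
by rewrite -subr_ge0; have : 0 <= 2*(a*b+a*c+a*d+b*c+b*d+c*d); [rewrite !(mulr_ge0, addr_ge0)//|lra].
Qed.

Lemma qre_is_linear : linear (@qre R). Proof. by []. Qed.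
Lemma qi_is_linear : linear (@qi R). Proof. by []. Qed.
Lemma qj_is_linear : linear (@qj R). Proof. by []. Qed.
Lemma qk_is_linear : linear (@qk R). Proof. by []. Qed.
HB.instance Definition _ := GRing.isLinear.Build R (quat R) R _ (@qre R) qre_is_linear.
HB.instance Definition _ := GRing.isLinear.Build R (quat R) R _ (@qi R) qi_is_linear.
HB.instance Definition _ := GRing.isLinear.Build R (quat R) R _ (@qj R) qj_is_linear.
HB.instance Definition _ := GRing.isLinear.Build R (quat R) R _ (@qk R) qk_is_linear.

Lemma qconj_is_linear : linear (@qconj R).
Proof. by move=> s p q; congr Quat => /=; ring. Qed.
HB.instance Definition _ := GRing.isLinear.Build R (quat R) (quat R) _ (@qconj R) qconj_is_linear.

End quat_norm.

(** * Continuously differentiable functions *)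

Lemma lipschitz_continuous {R : realType} (V W : normedModType R) (f : V -> W) :
  (forall p q, `|f p - f q| <= `|p - q|) -> continuous f.
Proof.
move=> h z; apply/cvgrPdist_lt => e e0; near=> w.
by apply: (le_lt_trans (h _ _)); near: w; exact: cvgr_dist_lt.
Unshelve. all: by end_near. Qed.

(** The differential of [f] also approximates [g], and linear approximations are
    unique. *)
Lemma near_eq_differentiable {R : realType} (V W : normedModType R)
    (f g : V -> W) z :
  (\near z, f z = g z) -> differentiable f z -> differentiable g z.
Proof.
move=> fg df; have [cdf /eqaddoP E] := (diff_locallyP _ _).1 df.
have fgz : f z = g z by exact: nbhs_singleton fg.
suff E' : g \o shift z = cst (g z) + 'd f z +o_ 0 id.
  by apply/diff_locallyP; rewrite (diff_unique cdf E').
apply/eqaddoP => e e0; have := E e e0.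
have : \forall h \near 0, f (h + z) = g (h + z).
  by move: fg; rewrite (near_shift 0 z) /= subr0.
apply: filterS2 => h; rewrite /= fgz => Eh.
by rewrite !fctE /= Eh.
Qed.

Lemma continuous_comp_at {R : realType} (V W X : normedModType R)
    (f : V -> W) (g : W -> X) z :
  {for z, continuous f} -> {for f z, continuous g} ->
  {for z, continuous (fun w => g (f w))}.
Proof. exact: continuous_comp. Qed.

Lemma continuousD_at {R : realType} (V W : normedModType R) (f g : V -> W) z :
  {for z, continuous f} -> {for z, continuous g} ->
  {for z, continuous (fun w => f w + g w)}.
Proof. exact: continuousD. Qed.

Lemma continuousZ_at {R : realType} (V W : normedModType R) (f : V -> R)
    (g : V -> W) z :
  {for z, continuous f} -> {for z, continuous g} ->
  {for z, continuous (fun w => f w *: g w)}.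
Proof. by move=> cf cg; apply: cvgZ. Qed.

Section C1_normed.
Context {R : realType} {V W : normedModType R}.
Implicit Types (f g : V -> W) (U A : set V).

(** [C1] for functions between arbitrary normed spaces. The real components of
    a quaternionic function are of this kind, and closure under the algebraic
    operations is proved on them. *)
Definition C1on U f : Prop :=
  (forall z, U z -> differentiable f z) /\
  (forall v z, U z -> {for z, continuous (fun w => 'D_v f w)}).

Lemma continuous_eq_on U f g z : open U -> U z ->
  (forall w, U w -> f w = g w) -> {for z, continuous f} -> {for z, continuous g}.
Proof.
move=> oU Uz fg cf; change (g w @[w --> z] --> g z); rewrite -(fg z)//.
apply: cvg_trans cf; apply: near_eq_cvg.
by apply: filterS (open_nbhs_nbhs (conj oU Uz)) => w Uw; rewrite fg.
Qed.

Lemma derive_eq_on U f g v z : open U -> U z ->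
  (forall w, U w -> f w = g w) -> 'D_v f z = 'D_v g z.
Proof.
move=> oU Uz fg; apply: near_eq_derive.
by apply: filterS (open_nbhs_nbhs (conj oU Uz)) => w Uw; exact: fg.
Qed.

Lemma differentiable_eq_on U f g z : open U -> U z ->
  (forall w, U w -> f w = g w) -> differentiable f z -> differentiable g z.
Proof.
move=> oU Uz fg; apply: near_eq_differentiable.
by apply: filterS (open_nbhs_nbhs (conj oU Uz)) => w Uw; exact: fg.
Qed.

Lemma C1on_cst U (a : W) : C1on U (cst a).
Proof.
split=> [z _|v z _]; first exact: differentiable_cst.
rewrite (_ : (fun _ => _) = cst 0); first exact: cst_continuous.
by apply/funext => w; rewrite derive_cst.
Qed.

Lemma C1onD U f g : open U -> C1on U f -> C1on U g -> C1on U (fun z => f z + g z).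
Proof.
move=> oU [df cf] [dg cg]; split=> [z Uz|v z Uz].
  by apply: (@differentiableD _ _ _ f g); [exact: df|exact: dg].
apply: (@continuous_eq_on U (fun w => 'D_v f w + 'D_v g w)) => //.
  by move=> w Uw; rewrite (@deriveD _ _ _ f g)//; apply: diff_derivable; [exact: df|exact: dg].
by apply: cvgD; [exact: cf|exact: cg].
Qed.

Lemma C1on_sub U A f : A `<=` U -> C1on U f -> C1on A f.
Proof. by move=> AU [df cf]; split=> [z /AU|v z /AU]; [exact: df|exact: cf]. Qed.

Lemma C1on_continuous U f z : C1on U f -> U z -> {for z, continuous f}.
Proof. by move=> [df _] Uz; apply: differentiable_continuous; exact: df. Qed.

Lemma C1on_eq U f g : open U -> (forall z, U z -> f z = g z) ->
  C1on U f -> C1on U g.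
Proof.
move=> oU fg [df cf].
split=> [z Uz|v z Uz].
  exact: (differentiable_eq_on oU Uz fg (df z Uz)).
apply: (@continuous_eq_on U (fun w => 'D_v f w)) => //; last exact: cf.
by move=> w Uw; exact: derive_eq_on fg.
Qed.

End C1_normed.

Section C1_real.
Context {R : realType} {V : normedModType R}.
Implicit Types (U : set V).

Lemma derive_linear (W1 W2 : normedModType R) (l : {linear W1 -> W2}) (f : V -> W1) v z :
  continuous l -> differentiable f z -> 'D_v (l \o f) z = l ('D_v f z).
Proof.
move=> cl df; have dl x : differentiable l x by exact: linear_differentiable.
rewrite !deriveE//; last exact: differentiable_comp.
by rewrite (diff_comp df (dl _)) /= (diff_lin _ cl).
Qed.

Lemma derive_expR_comp (f : V -> R) v z : differentiable f z ->
  'D_v (fun w => expR (f w)) z = expR (f z) * 'D_v f z.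
Proof.
move=> df.
have de x : differentiable (@expR R) x by apply/derivable1_diffP; exact: derivable_expR.
rewrite deriveE; last exact: (@differentiable_comp _ _ _ _ f expR).
rewrite (@diff_comp _ _ _ _ f expR)//= deriveE//.
rewrite (deriv1E (@derivable_expR R (f z))) derive1E mulrC.
by congr (_ * _); rewrite derive_val.
Qed.

Lemma C1on_lin (W1 W2 : normedModType R) U (l : {linear W1 -> W2}) (f : V -> W1) :
  open U -> continuous l -> C1on U f -> C1on U (l \o f).
Proof.
move=> oU cl [df cf]; split=> [z Uz|v z Uz].
  by apply: differentiable_comp; [exact: df|exact: linear_differentiable].
apply: (@continuous_eq_on _ _ _ U (fun w => l ('D_v f w))) => //.
  by move=> w Uw; rewrite (derive_linear v cl (df w Uw)).
by apply: (@continuous_comp _ _ _ (fun w => 'D_v f w) l); [exact: cf|exact: cl].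
Qed.

Lemma C1onZl (W : normedModType R) U (f : V -> R) (a : W) : open U ->
  C1on U f -> C1on U (fun z => f z *: a).
Proof.
move=> oU [df cf]; split=> [z Uz|v z Uz]; first exact/differentiableZl/df.
apply: (@continuous_eq_on _ _ _ U (fun w => 'D_v f w *: a)) => //.
  move=> w Uw; rewrite deriveE; last exact: df.
  by rewrite deriveE ?diffZl//; [exact: df|exact/differentiableZl/df].
by apply: cvgZr_tmp; exact: cf.
Qed.

Lemma C1onM U (f g : V -> R) : open U ->
  C1on U f -> C1on U g -> C1on U (fun z => f z * g z).
Proof.
move=> oU [df cf] [dg cg]; split=> [z Uz|v z Uz].
  by apply: (@differentiableM _ _ f g); [exact: df|exact: dg].
apply: (@continuous_eq_on _ _ _ U (fun w => f w * 'D_v g w + g w * 'D_v f w)) => //.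
  move=> w Uw; rewrite (@deriveM _ _ f g)//; apply: diff_derivable; [exact: df|exact: dg].
have cfz : {for z, continuous f} by apply: differentiable_continuous; exact: df.
have cgz : {for z, continuous g} by apply: differentiable_continuous; exact: dg.
by apply: cvgD; apply: cvgM => //; [exact: cg|exact: cf].
Qed.

Lemma C1onV U (f : V -> R) : open U -> (forall z, U z -> f z != 0) ->
  C1on U f -> C1on U (fun z => (f z)^-1).
Proof.
move=> oU f0 [df cf]; split=> [z Uz|v z Uz].
  by apply: (@differentiableV _ _ f); [exact: df|exact: f0].
apply: (@continuous_eq_on _ _ _ U (fun w => - (f w ^- 2) * 'D_v f w)) => //.
  move=> w Uw; rewrite (@deriveV _ _ f)//; [exact: f0|apply: diff_derivable; exact: df].
have cfz : {for z, continuous f} by apply: differentiable_continuous; exact: df.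
apply: cvgM; last exact: cf.
apply: cvgN; apply: cvgV; first by rewrite expf_eq0 /= f0.
rewrite (_ : (fun _ => _) = (fun w => f w * f w)); first by apply: cvgM.
by apply/funext => w; rewrite expr2.
Qed.

Lemma C1on_expR U (f : V -> R) : open U ->
  C1on U f -> C1on U (fun z => expR (f z)).
Proof.
move=> oU [df cf].
have de x : differentiable (@expR R) x by apply/derivable1_diffP; exact: derivable_expR.
split=> [z Uz|v z Uz].
  by apply: (@differentiable_comp _ _ _ _ f expR) => //; exact: df.
apply: (@continuous_eq_on _ _ _ U (fun w => expR (f w) * 'D_v f w)) => //.
  by move=> w Uw; rewrite derive_expR_comp//; exact: df.
have cfz : {for z, continuous f} by apply: differentiable_continuous; exact: df.
apply: cvgM; last exact: cf.
by apply: (@continuous_comp _ _ _ f expR) => //; exact: continuous_expR.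
Qed.

Lemma C1onN U (f : V -> R) : open U -> C1on U f -> C1on U (fun z => - f z).
Proof.
move=> oU cf; rewrite (_ : (fun _ => _) = (fun z => -1 * f z)).
  exact: (C1onM oU (@C1on_cst R V R U (-1)) cf).
by apply/funext => z; rewrite mulN1r.
Qed.

End C1_real.

Section quat_calculus.
Context {R : realType}.
Implicit Types (p q : quat R) (U V : set (quat R)).

Definition unit_k : quat R := Quat 0 0 0 1.

Lemma quat_decomp q : q = qre q *: 1 + qi q *: unit_i + qj q *: unit_j + qk q *: unit_k.
Proof. by case: q => a b c d; congr Quat => /=; ring. Qed.

Lemma qre_continuous : continuous (@qre R).
Proof. by apply: lipschitz_continuous => p q; exact: (ler_norm_qre (p - q)). Qed.
Lemma qi_continuous : continuous (@qi R).
Proof. by apply: lipschitz_continuous => p q; exact: (ler_norm_qi (p - q)). Qed.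
Lemma qj_continuous : continuous (@qj R).
Proof. by apply: lipschitz_continuous => p q; exact: (ler_norm_qj (p - q)). Qed.
Lemma qk_continuous : continuous (@qk R).
Proof. by apply: lipschitz_continuous => p q; exact: (ler_norm_qk (p - q)). Qed.

Lemma cvg_quat (T : Type) (F : set_system T) {FF : Filter F} (f : T -> quat R) l :
  qre (f x) @[x --> F] --> qre l -> qi (f x) @[x --> F] --> qi l ->
  qj (f x) @[x --> F] --> qj l -> qk (f x) @[x --> F] --> qk l ->
  f x @[x --> F] --> l.
Proof.
move=> h0 h1 h2 h3; rewrite [X in _ --> X]quat_decomp.
under eq_fun do rewrite [f _]quat_decomp.
by apply: cvgD; [apply: cvgD; [apply: cvgD|]|]; exact: cvgZr_tmp.
Qed.

Lemma C1on_quat U (f : quat R -> quat R) : open U ->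
  C1on U (fun z => qre (f z)) -> C1on U (fun z => qi (f z)) ->
  C1on U (fun z => qj (f z)) -> C1on U (fun z => qk (f z)) -> C1on U f.
Proof.
move=> oU h0 h1 h2 h3.
rewrite (_ : f = fun z => qre (f z) *: 1 + qi (f z) *: unit_i +
  qj (f z) *: unit_j + qk (f z) *: unit_k); last first.
  by apply/funext => z /=; rewrite -quat_decomp.
have D := fun f g => @C1onD R (quat R) (quat R) U f g oU.
have Z := fun g a cg => @C1onZl R (quat R) (quat R) U g a oU cg.
exact: (D _ _ (D _ _ (D _ _ (Z _ 1 h0) (Z _ unit_i h1)) (Z _ unit_j h2)) (Z _ unit_k h3)).
Qed.

Lemma C1on_comp_quat U (f : quat R -> quat R) : open U -> C1on U f ->
  [/\ C1on U (fun z => qre (f z)), C1on U (fun z => qi (f z)),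
    C1on U (fun z => qj (f z)) & C1on U (fun z => qk (f z))].
Proof.
move=> oU cf; split.
- exact: (@C1on_lin _ _ _ _ U (@qre R) f oU qre_continuous).
- exact: (@C1on_lin _ _ _ _ U (@qi R) f oU qi_continuous).
- exact: (@C1on_lin _ _ _ _ U (@qj R) f oU qj_continuous).
- exact: (@C1on_lin _ _ _ _ U (@qk R) f oU qk_continuous).
Qed.

Lemma C1on_id U : C1on U (id : quat R -> quat R).
Proof.
split=> [z _|v z _]; first exact: ex_diff.
rewrite (_ : (fun _ => _) = cst v); first exact: cst_continuous.
by apply/funext => w; rewrite derive_id.
Qed.

Lemma derive_qcomp (W : normedModType R) (f : quat R -> W) (g : quat R -> quat R) v w :
  differentiable g w -> differentiable f (g w) ->
  'D_v (f \o g) w = 'D_('D_v g w) f (g w).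
Proof.
move=> dg df.
rewrite deriveE; last exact: differentiable_comp.
by rewrite diff_comp//= [RHS]deriveE// [X in _ = 'd _ _ X]deriveE.
Qed.

Lemma derive_expand (W : normedModType R) (f : quat R -> W) v w :
  differentiable f w -> 'D_v f w = qre v *: 'D_1 f w + qi v *: 'D_unit_i f w
    + qj v *: 'D_unit_j f w + qk v *: 'D_unit_k f w.
Proof.
by move=> df; rewrite !deriveE// {1}(quat_decomp v) !linearD !linearZ.
Qed.

(** The chain rule makes the derivative of [f \o g] along [v] a derivative of
    [f] along the moving direction ['D_v g w]; expanding that direction in the
    basis leaves derivatives of [f] along fixed directions, which are
    continuous. *)
Lemma C1on_comp (W : normedModType R) U V (f : quat R -> W) (g : quat R -> quat R) :
  open U -> open V -> (forall z, V z -> U (g z)) ->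
  C1on U f -> C1on V g -> C1on V (f \o g).
Proof.
move=> oU oV gVU [df cf] [dg cg]; split=> [z Vz|v z Vz].
  by apply: differentiable_comp; [exact: dg|exact/df/gVU].
pose h v0 (q : quat R -> R) w := q ('D_v g w) *: 'D_v0 f (g w).
apply: (@continuous_eq_on _ _ _ V (h 1 (@qre R) \+ h unit_i (@qi R) \+ h unit_j (@qj R) \+ h unit_k (@qk R))) => //.
  move=> w Vw; have dgw := dg _ Vw; have dfw := df _ (gVU _ Vw).
  by rewrite derive_qcomp// derive_expand.
have cgz : {for z, continuous g} by apply: differentiable_continuous; exact: dg.
have ch v0 (q : quat R -> R) : continuous q -> {for z, continuous (h v0 q)}.
  move=> cq; apply: continuousZ_at.
    by apply: (@continuous_comp_at R (quat R) (quat R) R (fun w => 'D_v g w) q); [exact: cg|exact: cq].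
  apply: (@continuous_comp_at R (quat R) (quat R) W g (fun w => 'D_v0 f w)) => //.
  exact/cf/gVU.
apply: continuousD_at; [apply: continuousD_at; [apply: continuousD_at|]|]; apply: ch.
- exact: qre_continuous.
- exact: qi_continuous.
- exact: qj_continuous.
- exact: qk_continuous.
Qed.

Lemma C1on_qmul U (f g : quat R -> quat R) : open U ->
  C1on U f -> C1on U g -> C1on U (fun z => f z * g z).
Proof.
move=> oU /(C1on_comp_quat oU)[f0 f1 f2 f3] /(C1on_comp_quat oU)[g0 g1 g2 g3].
have M := C1onM oU; have D := (fun f g => @C1onD R (quat R) R U f g oU); have N := C1onN oU.
apply: (C1on_quat oU).
- exact: (D _ _ (D _ _ (D _ _ (M _ _ f0 g0) (N _ (M _ _ f1 g1))) (N _ (M _ _ f2 g2))) (N _ (M _ _ f3 g3))).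
- exact: (D _ _ (D _ _ (D _ _ (M _ _ f0 g1) (M _ _ f1 g0)) (M _ _ f2 g3)) (N _ (M _ _ f3 g2))).
- exact: (D _ _ (D _ _ (D _ _ (M _ _ f0 g2) (N _ (M _ _ f1 g3))) (M _ _ f2 g0)) (M _ _ f3 g1)).
- exact: (D _ _ (D _ _ (D _ _ (M _ _ f0 g3) (M _ _ f1 g2)) (N _ (M _ _ f2 g1))) (M _ _ f3 g0)).
Qed.

Lemma C1on_qscale U (f : quat R -> R) (g : quat R -> quat R) : open U ->
  C1on U f -> C1on U g -> C1on U (fun z => f z *: g z).
Proof.
move=> oU cf /(C1on_comp_quat oU)[g0 g1 g2 g3].
by apply: (C1on_quat oU); [exact: (C1onM oU cf g0)|exact: (C1onM oU cf g1)|
  exact: (C1onM oU cf g2)|exact: (C1onM oU cf g3)].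
Qed.

Lemma C1on_qconj U (f : quat R -> quat R) : open U ->
  C1on U f -> C1on U (fun z => qconj (f z)).
Proof.
move=> oU /(C1on_comp_quat oU)[f0 f1 f2 f3].
by apply: (C1on_quat oU); [exact: f0|exact: (C1onN oU f1)|
  exact: (C1onN oU f2)|exact: (C1onN oU f3)].
Qed.

Lemma C1on_qnormsq U (f : quat R -> quat R) : open U ->
  C1on U f -> C1on U (fun z => qnormsq (f z)).
Proof.
move=> oU /(C1on_comp_quat oU)[f0 f1 f2 f3].
rewrite /qnormsq; under eq_fun do rewrite !expr2.
have M := C1onM oU; have D := (fun f g => @C1onD R (quat R) R U f g oU).
exact: (D _ _ (D _ _ (D _ _ (M _ _ f0 f0) (M _ _ f1 f1)) (M _ _ f2 f2)) (M _ _ f3 f3)).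
Qed.

Lemma C1on_qinv U (f : quat R -> quat R) : open U -> (forall z, U z -> f z != 0) ->
  C1on U f -> C1on U (fun z => (f z)^-1).
Proof.
move=> oU f0 cf; under eq_fun do rewrite quat_invE.
apply: (C1on_qscale oU); last exact: (C1on_qconj oU cf).
apply: (C1onV oU); last exact: (C1on_qnormsq oU cf).
by move=> z /f0; rewrite qnormsq_eq0.
Qed.

End quat_calculus.
(** * The Fueter operator *)

Section fueter_operator.
Context {R : realType}.
Implicit Types (p q v w z : quat R) (U V : set (quat R)).

(** The operator [Dtheta] in the standard basis [1, i, j, k]. *)
Definition fueter (f : quat R -> quat R) z : quat R :=
  'D_1 f z + unit_i * 'D_unit_i f z + unit_j * 'D_unit_j f z
  + unit_k * 'D_unit_k f z.

Definition qdot p q : R :=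
  qre p * qre q + qi p * qi q + qj p * qj q + qk p * qk q.

(** The basis [psi] is orthonormal, so neither its dot product nor, below, its
    first-order operator depends on [theta]. *)
Lemma dotqE theta p q : dotq theta p q = qdot p q.
Proof.
rewrite /dotq !big_ord_recr big_ord0 /= add0r /Defs.coord /psi /= /qdot.
have h x : x = (cos theta ^+ 2 + sin theta ^+ 2) * x by rewrite cos2Dsin2 mul1r.
by rewrite (h (qj p * qj q)) (h (qk p * qk q)); ring.
Qed.

(** [\sum_k e_k * L e_k] is the same in all orthonormal bases: [psi 2] and
    [psi 3] arise from [j] and [k] by an orthogonal map of their plane. *)
Lemma psi_orthonormal_sum theta (L : {linear quat R -> quat R}) :
  \sum_(k < 4) psi theta k * L (psi theta k) =
  L 1 + unit_i * L unit_i + unit_j * L unit_j + unit_k * L unit_k.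
Proof.
rewrite !big_ord_recr big_ord0 /= /psi /= add0r mul1r.
have -> : unit_i * qexpi theta * unit_j = (- sin theta) *: unit_j + cos theta *: unit_k :> quat R.
  by congr Quat => /=; ring.
have -> : qexpi theta * unit_j = cos theta *: unit_j + sin theta *: unit_k :> quat R.
  by congr Quat => /=; ring.
rewrite !linearD !linearZ /=; move: (L unit_j) (L unit_k) => p q.
rewrite -!addrA; congr (_ + (_ + _)).
have h x : x = (cos theta ^+ 2 + sin theta ^+ 2) * x by rewrite cos2Dsin2 mul1r.
by congr Quat => /=; rewrite [RHS]h; ring.
Qed.

Lemma Dtheta_fueter theta (f : quat R -> quat R) z :
  differentiable f z -> Dtheta theta f z = fueter f z.
Proof.
move=> df; rewrite /Dtheta /fueter !deriveE//.
rewrite -(psi_orthonormal_sum theta); apply: eq_bigr => k _.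
by rewrite deriveE.
Qed.

Lemma derive_lin (l : {linear quat R -> R}) (f : quat R -> quat R) v z :
  continuous l -> differentiable f z -> 'D_v (fun w => l (f w)) z = l ('D_v f z).
Proof.
exact: derive_linear.
Qed.

Lemma differentiable_quatP (f : quat R -> quat R) z : differentiable f z ->
  [/\ differentiable (fun w => qre (f w)) z, differentiable (fun w => qi (f w)) z,
    differentiable (fun w => qj (f w)) z & differentiable (fun w => qk (f w)) z].
Proof.
move=> df; have dl (l : {linear quat R -> R}) : continuous l -> differentiable (l \o f) z.
  by move=> cl; apply: differentiable_comp => //; exact: linear_differentiable.
split; [exact: (dl _ qre_continuous)|exact: (dl _ qi_continuous)|
  exact: (dl _ qj_continuous)|exact: (dl _ qk_continuous)].
Qed.

Lemma quat_differentiable (f : quat R -> quat R) z :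
  differentiable (fun w => qre (f w)) z -> differentiable (fun w => qi (f w)) z ->
  differentiable (fun w => qj (f w)) z -> differentiable (fun w => qk (f w)) z ->
  differentiable f z.
Proof.
move=> h0 h1 h2 h3.
rewrite (_ : f = fun z => qre (f z) *: 1 + qi (f z) *: unit_i +
  qj (f z) *: unit_j + qk (f z) *: unit_k); last first.
  by apply/funext => w /=; rewrite -quat_decomp.
have D := fun f g => @differentiableD R (quat R) (quat R) f g z.
have Z := fun g a => @differentiableZl R (quat R) (quat R) g a z.
exact: (D _ _ (D _ _ (D _ _ (Z _ 1 h0) (Z _ unit_i h1)) (Z _ unit_j h2)) (Z _ unit_k h3)).
Qed.

Lemma differentiable_qmul (f g : quat R -> quat R) z :
  differentiable f z -> differentiable g z -> differentiable (fun w => f w * g w) z.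
Proof.
move=> /differentiable_quatP[f0 f1 f2 f3] /differentiable_quatP[g0 g1 g2 g3].
have M := fun f g => @differentiableM R (quat R) f g z.
have D := fun f g => @differentiableD R (quat R) R f g z.
have B := fun f g => @differentiableB R (quat R) R f g z.
apply: quat_differentiable.
- exact: (B _ _ (B _ _ (B _ _ (M _ _ f0 g0) (M _ _ f1 g1)) (M _ _ f2 g2)) (M _ _ f3 g3)).
- exact: (B _ _ (D _ _ (D _ _ (M _ _ f0 g1) (M _ _ f1 g0)) (M _ _ f2 g3)) (M _ _ f3 g2)).
- exact: (D _ _ (D _ _ (B _ _ (M _ _ f0 g2) (M _ _ f1 g3)) (M _ _ f2 g0)) (M _ _ f3 g1)).
- exact: (D _ _ (B _ _ (D _ _ (M _ _ f0 g3) (M _ _ f1 g2)) (M _ _ f2 g1)) (M _ _ f3 g0)).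
Qed.

Lemma derive_qmul (f g : quat R -> quat R) v z :
  differentiable f z -> differentiable g z ->
  'D_v (fun w => f w * g w) z = 'D_v f z * g z + f z * 'D_v g z.
Proof.
move=> df dg; have dfg := differentiable_qmul df dg.
have [f0 f1 f2 f3] := differentiable_quatP df.
have [g0 g1 g2 g3] := differentiable_quatP dg.
have MD (a b : quat R -> R) : differentiable a z -> differentiable b z ->
    is_derive z v (a * b) (a z * 'D_v b z + b z * 'D_v a z).
  move=> da db; apply: is_deriveM; apply: derivableP; exact: diff_derivable.
have E0 := derive_lin v qre_continuous; have E1 := derive_lin v qi_continuous.
have E2 := derive_lin v qj_continuous; have E3 := derive_lin v qk_continuous.
have H (l : {linear quat R -> R}) (h : quat R -> R) D : continuous l ->
    (forall w, l (f w * g w) = h w) -> is_derive z v h D ->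
    l ('D_v (fun w => f w * g w) z) = D.
  move=> cl lh [_ <-]; rewrite -derive_lin//; congr ('D_v _ z).
  exact/funext.
apply/eqP; rewrite -[X in X == _]prod_of_quatK -[X in _ == X]prod_of_quatK; apply/eqP.
congr quat_of_prod; rewrite /prod_of_quat; congr (_, _, _, _).
- rewrite (H _ _ _ qre_continuous (fun w => erefl _) (is_deriveB (is_deriveB (is_deriveB (MD _ _ f0 g0) (MD _ _ f1 g1)) (MD _ _ f2 g2)) (MD _ _ f3 g3))).
  by rewrite !E0 ?E1 ?E2 ?E3//=; ring.
- rewrite (H _ _ _ qi_continuous (fun w => erefl _) (is_deriveB (is_deriveD (is_deriveD (MD _ _ f0 g1) (MD _ _ f1 g0)) (MD _ _ f2 g3)) (MD _ _ f3 g2))).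
  by rewrite !E0 ?E1 ?E2 ?E3//=; ring.
- rewrite (H _ _ _ qj_continuous (fun w => erefl _) (is_deriveD (is_deriveD (is_deriveB (MD _ _ f0 g2) (MD _ _ f1 g3)) (MD _ _ f2 g0)) (MD _ _ f3 g1))).
  by rewrite !E0 ?E1 ?E2 ?E3//=; ring.
- rewrite (H _ _ _ qk_continuous (fun w => erefl _) (is_deriveD (is_deriveB (is_deriveD (MD _ _ f0 g3) (MD _ _ f1 g2)) (MD _ _ f2 g1)) (MD _ _ f3 g0))).
  by rewrite !E0 ?E1 ?E2 ?E3//=; ring.
Qed.

End fueter_operator.
(** * Conformal covariance of the Fueter operator *)

Lemma addr_sum4 (V : nmodType) (a b c d a' b' c' d' : V) :
  a + a' + (b + b') + (c + c') + (d + d') = a + b + c + d + (a' + b' + c' + d').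
Proof. by rewrite (addrACA a) (addrACA (a + b)) (addrACA (a + b + c)). Qed.

Section fueter_covariance.
Context {R : realType}.
Implicit Types (p q r v w x y z : quat R) (U V : set (quat R)).

Lemma open_quat_neq (p : quat R) : open [set z : quat R | z != p].
Proof.
rewrite (_ : [set z | z != p] = ~` [set p]).
  by apply: closed_openC; apply: accessible_closed_set1; exact: hausdorff_accessible (@norm_hausdorff _ _).
by apply/seteqP; split => z /= /eqP.
Qed.

Lemma C1on_inv : C1on [set z : quat R | z != 0] (fun w => w^-1).
Proof. by apply: C1on_qinv => //; [exact: open_quat_neq|exact: C1on_id]. Qed.

(** Differentiate [w * w^-1 = 1]. *)
Lemma derive_qinv v z : z != 0 -> 'D_v (fun w => w^-1) z = - (z^-1 * v * z^-1).
Proof.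
move=> z0; have [dinv _] := C1on_inv.
have : 'D_v (fun w : quat R => w * w^-1) z = 'D_v (cst (1 : quat R) : quat R -> quat R) z.
  apply: (derive_eq_on v (@open_quat_neq 0) z0) => w w0.
  by rewrite quat_mulfV.
rewrite derive_cst derive_qmul//; last exact: dinv.
rewrite derive_id => /eqP; rewrite addrC addr_eq0 => /eqP E.
by rewrite -[LHS](mulKr (x := z)) ?quat_unitE// [X in _ * X]E mulrN mulrA.
Qed.

Lemma fueter_rule (f : quat R -> quat R) (L : quat R -> quat R) z :
  (forall v, 'D_v f z = L v) ->
  fueter f z = L 1 + unit_i * L unit_i + unit_j * L unit_j + unit_k * L unit_k.
Proof. by move=> fL; rewrite /fueter !fL. Qed.

(** Quaternionic multiplication is conformal: the frames [e_k q] and [p e_k] are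
    orthogonal with the norms of [q] and [p], which turns the twisted sums into
    multiples of the plain one. *)
Lemma frame_right (L : {linear quat R -> quat R}) q :
  q * L q + unit_i * (q * L (unit_i * q)) + unit_j * (q * L (unit_j * q))
    + unit_k * (q * L (unit_k * q)) =
  qnormsq q *: (L 1 + unit_i * L unit_i + unit_j * L unit_j + unit_k * L unit_k).
Proof.
rewrite [in L _](quat_decomp q) [in L (unit_i * q)](quat_decomp (unit_i * q)).
rewrite [in L (unit_j * q)](quat_decomp (unit_j * q)).
rewrite [in L (unit_k * q)](quat_decomp (unit_k * q)).
rewrite !linearD !linearZ /=.
move: (L 1) (L unit_i) (L unit_j) (L unit_k) => l0 l1 l2 l3.
by congr Quat; rewrite /qnormsq /=; ring.
Qed.

Lemma frame_left (L : {linear quat R -> quat R}) p :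
  L p + unit_i * L (p * unit_i) + unit_j * L (p * unit_j) + unit_k * L (p * unit_k) =
  qconj p * (L 1 + unit_i * L unit_i + unit_j * L unit_j + unit_k * L unit_k).
Proof.
rewrite [in L _](quat_decomp p) [in L (p * unit_i)](quat_decomp (p * unit_i)).
rewrite [in L (p * unit_j)](quat_decomp (p * unit_j)).
rewrite [in L (p * unit_k)](quat_decomp (p * unit_k)).
rewrite !linearD !linearZ /=.
move: (L 1) (L unit_i) (L unit_j) (L unit_k) => l0 l1 l2 l3.
by congr Quat => /=; ring.
Qed.

Lemma frame_conformal (L : {linear quat R -> quat R}) p q :
  q * L (p * q) + unit_i * (q * L (p * unit_i * q)) + unit_j * (q * L (p * unit_j * q))
    + unit_k * (q * L (p * unit_k * q)) =
  qnormsq q *: (qconj p * (L 1 + unit_i * L unit_i + unit_j * L unit_j + unit_k * L unit_k)).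
Proof.
have lL : linear (fun x => L (p * x)).
  by move=> s x y; rewrite mulrDr -scalerAr linearD linearZ.
pose L'M := GRing.isLinear.Build _ _ _ _ _ lL.
pose L' : {linear quat R -> quat R} := HB.pack (fun x => L (p * x)) L'M.
have := frame_right L' q; rewrite /= !mulrA mulr1 => ->.
by rewrite frame_left.
Qed.

Lemma differentiable_qcst p z : differentiable (fun _ : quat R => p) z.
Proof. exact: differentiable_cst. Qed.

Lemma differentiable_qid z : differentiable (fun w : quat R => w) z.
Proof. exact: (proj1 (C1on_id setT) z I). Qed.

Lemma derive_qmull p (f : quat R -> quat R) v z : differentiable f z ->
  'D_v (fun w => p * f w) z = p * 'D_v f z.
Proof.
move=> df; rewrite (derive_qmul v (differentiable_qcst p z) df).
by rewrite (derive_cst p) mul0r add0r.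
Qed.

Lemma derive_qmulr p (f : quat R -> quat R) v z : differentiable f z ->
  'D_v (fun w => f w * p) z = 'D_v f z * p.
Proof.
move=> df; rewrite (derive_qmul v df (differentiable_qcst p z)).
by rewrite (derive_cst p) mulr0 addr0.
Qed.

Lemma differentiable_qaffine p q r z : differentiable (fun w : quat R => p * w * q + r) z.
Proof.
have d1 := differentiable_qmul (differentiable_qcst p z) (differentiable_qid z).
have d2 := differentiable_qmul d1 (differentiable_qcst q z).
exact: (@differentiableD R (quat R) (quat R) _ _ z d2 (differentiable_qcst r z)).
Qed.

Lemma derive_qaffine p q r v z : 'D_v (fun w : quat R => p * w * q + r) z = p * v * q.
Proof.
have d1 := differentiable_qmul (differentiable_qcst p z) (differentiable_qid z).
have d2 := differentiable_qmul d1 (differentiable_qcst q z).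
rewrite (@deriveD R (quat R) (quat R) (fun w => p * w * q) (fun=> r)).
- rewrite (derive_cst r) addr0 derive_qmulr// derive_qmull ?derive_id//.
- exact: diff_derivable d2.
- exact: (@diff_derivable R (quat R) (quat R) _ _ _ (differentiable_qcst r z)).
Qed.

(** Covariance under [w |-> p w q + r], with conformal weight [q] on the left. *)
Lemma fueter_affine (f : quat R -> quat R) p q r z : differentiable f (p * z * q + r) ->
  fueter (fun w => q * f (p * w * q + r)) z =
  qnormsq q *: (qconj p * fueter f (p * z * q + r)).
Proof.
move=> df; have da := differentiable_qaffine p q r z.
have dfa : differentiable (fun w => f (p * w * q + r)) z.
  exact: (@differentiable_comp R (quat R) (quat R) (quat R) _ f z da df).
rewrite (@fueter_rule _ (fun v => q * 'd f (p * z * q + r) (p * v * q))).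
  rewrite mulr1 (frame_conformal ('d f (p * z * q + r)) p q).
  by rewrite -(fueter_rule (fun v => deriveE v df)).
move=> v; rewrite derive_qmull//.
rewrite (@derive_qcomp R (quat R) f (fun w => p * w * q + r) v z da df).
by rewrite derive_qaffine deriveE.
Qed.

Lemma differentiable_qinv z : z != 0 -> differentiable (fun w : quat R => w^-1) z.
Proof. by move=> z0; exact: (proj1 C1on_inv z z0). Qed.

Lemma qconj_continuous : continuous (@qconj R).
Proof.
apply: lipschitz_continuous => p q.
by rewrite (_ : qconj p - qconj q = qconj (p - q)) ?qnorm_conj// linearB.
Qed.

Lemma derive_qconj (f : quat R -> quat R) v z : differentiable f z ->
  'D_v (fun w => qconj (f w)) z = qconj ('D_v f z).
Proof.
exact: (@derive_linear R (quat R) (quat R) (quat R) (@qconj R) f v z qconj_continuous).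
Qed.

Lemma differentiable_qconj (f : quat R -> quat R) z : differentiable f z ->
  differentiable (fun w => qconj (f w)) z.
Proof.
move=> df; apply: (@differentiable_comp _ _ _ _ f (@qconj R)) => //.
exact: (linear_differentiable _ qconj_continuous).
Qed.

(** The Cauchy kernel of the Fueter operator, [conj y / |y|^4], written as a
    product so that the Leibniz rule applies to it. *)
Definition cauchy_kernel y : quat R := y^-1 * (y^-1 * qconj y^-1).

Lemma cauchy_kernelE y : cauchy_kernel y = qnormsq y^-1 *: y^-1.
Proof. by rewrite /cauchy_kernel qconjMr -scalerAr mulr1. Qed.

Lemma differentiable_cauchy_kernel y : y != 0 -> differentiable cauchy_kernel y.
Proof.
move=> y0; have dw := differentiable_qinv y0.
exact: differentiable_qmul dw (differentiable_qmul dw (differentiable_qconj dw)).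
Qed.

Lemma derive_cauchy_kernel v y (w := y^-1) : y != 0 ->
  'D_v cauchy_kernel y = - qnormsq w *:
    (w * v * w + w * w * v + w * qconj v * qconj w).
Proof.
move=> y0; have dw := differentiable_qinv y0.
have dcw := differentiable_qconj dw.
rewrite (derive_qmul v dw (differentiable_qmul dw dcw)) (derive_qmul v dw dcw).
rewrite (derive_qconj v dw) derive_qinv// -/w.
have T1 : - (w * v * w) * (w * qconj w) = - (qnormsq w *: (w * v * w)).
  by rewrite qconjMr -scalerAr mulr1 scalerN.
have T2 : w * (- (w * v * w) * qconj w) = - (qnormsq w *: (w * w * v)).
  by rewrite mulNr -(mulrA (w * v)) qconjMr -scalerAr mulr1 mulrN -scalerAr mulrA.
have T3 : w * (w * qconj (- (w * v * w))) = - (qnormsq w *: (w * qconj v * qconj w)).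
  rewrite linearN /= !qconjM.
  by rewrite mulrN mulrN !mulrA -(mulrA w w) qconjMr -scalerAr mulr1 -!scalerAl.
by rewrite mulrDr T1 T2 T3 scaleNr !scalerDr !opprD addrA.
Qed.

Lemma fueter_cauchy_kernel y : y != 0 -> fueter cauchy_kernel y = 0.
Proof.
move=> y0; rewrite (fueter_rule (fun v => derive_cauchy_kernel v y0)).
by move: y^-1 => w; congr Quat => /=; ring.
Qed.

(** Covariance under inversion: since the weight [cauchy_kernel] is itself in
    the kernel of the operator, only the derivatives falling on [f] survive,
    and the differential [v |-> - y^-1 v y^-1] of the inversion is of the form
    treated in [frame_conformal]. *)
Lemma fueter_kelvin (f : quat R -> quat R) r y : y != 0 -> differentiable f (r + y^-1) ->
  fueter (fun x => cauchy_kernel x * f (r + x^-1)) y =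
  - (qnormsq y^-1 ^+ 2) *: (qconj y^-1 * fueter f (r + y^-1)).
Proof.
move=> y0 df; have dw := differentiable_qinv y0.
have da : differentiable (fun x => r + x^-1) y.
  exact: (@differentiableD R (quat R) (quat R) _ _ y (differentiable_qcst r y) dw).
have dfa : differentiable (fun x => f (r + x^-1)) y.
  exact: (@differentiable_comp R (quat R) (quat R) (quat R) _ f y da df).
have dk := differentiable_cauchy_kernel y0.
set w := y^-1; pose L := 'd f (r + w).
have E v : 'D_v (fun x => cauchy_kernel x * f (r + x^-1)) y =
    'D_v cauchy_kernel y * f (r + w) + qnormsq w *: (w * L (- w * v * w)).
  rewrite derive_qmul// cauchy_kernelE -scalerAl; congr (_ + _ *: (_ * _)).
  rewrite (@derive_qcomp R (quat R) f (fun x => r + x^-1) v y da df).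
  rewrite (@deriveD R (quat R) (quat R) (fun=> r)); last 2 first.
  - exact: (@diff_derivable R (quat R) (quat R) _ _ _ (differentiable_qcst r y)).
  - exact: diff_derivable dw.
  by rewrite (derive_cst r) add0r derive_qinv// deriveE// !mulNr.
rewrite (fueter_rule E).
have K0 := fueter_cauchy_kernel y0; rewrite /fueter in K0.
transitivity (('D_1 cauchy_kernel y + unit_i * 'D_unit_i cauchy_kernel y
  + unit_j * 'D_unit_j cauchy_kernel y + unit_k * 'D_unit_k cauchy_kernel y) * f (r + w)
  + qnormsq w *: (w * L (- w * w) + unit_i * (w * L (- w * unit_i * w))
  + unit_j * (w * L (- w * unit_j * w)) + unit_k * (w * L (- w * unit_k * w)))).
  rewrite mulr1 !mulrDr !scalerDr !mulrDl -!scalerAr !mulrA.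
  exact: addr_sum4.
rewrite K0 mul0r add0r (frame_conformal L (- w) w) -(fueter_rule (fun v => deriveE v df)).
by rewrite linearN /= mulNr scalerN scalerN scalerA -expr2 scaleNr.
Qed.

End fueter_covariance.

Section moebius_covariance.
Context {R : realType}.
Variables (a b c d : quat R).
Hypothesis Hc0 : c = 0 -> a * d <> 0.
Hypothesis Hc1 : c <> 0 -> b - a * c^-1 * d <> 0.
Implicit Types (z w : quat R).
Local Notation T := (moebius a b c d).
Local Notation beta := (beta a b c d).
Local Notation y := (ycoef a b c d).

Lemma qconj_eq0 (q : quat R) : (qconj q == 0) = (q == 0).
Proof. by rewrite -[LHS]normr_eq0 qnorm_conj normr_eq0. Qed.

Lemma ad_neq0 : c = 0 -> (a != 0) * (d != 0).
Proof.
move=> /Hc0/eqP; rewrite quat_mul_eq0 negb_or => /andP[a0 d0]; by split.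
Qed.

Lemma beta_neq0 : c != 0 -> beta != 0.
Proof. by move=> /eqP/Hc1/eqP. Qed.

Lemma ycoefE z : y z = (c * z + d) * beta^-1.
Proof. by rewrite /ycoef mulrDl. Qed.

Lemma ycoef_eq0 z : c != 0 -> (y z == 0) = (c * z + d == 0).
Proof.
move=> c0; rewrite ycoefE quat_mul_eq0 quat_inv_eq0.
by rewrite (negbTE (beta_neq0 c0)) orbF.
Qed.

(** Every Moebius map is affine, or an affine map followed by an inversion and
    a translation; covariance and the Jacobian are read off from these two
    forms. *)
Lemma moebius_affine z : c = 0 -> T z = a * z * d^-1 + b * d^-1.
Proof. by move=> c0; rewrite /moebius c0 mul0r add0r mulrDl. Qed.

Lemma moebius_inversion z : c != 0 -> c * z + d != 0 -> T z = a * c^-1 + (y z)^-1.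
Proof.
move=> c0 cd0; have b0 := beta_neq0 c0.
rewrite ycoefE quat_invrM ?quat_inv_eq0// invrK.
rewrite /moebius -[X in _ = X + _](mulrK (x := c * z + d)) ?quat_unitE//.
rewrite -mulrDl mulrDr mulrA mulrVK ?quat_unitE// /Defs.beta -addrA.
by congr ((_ + _) * _); rewrite addrC subrK.
Qed.

(** [C_T] and [A_T] differ by a positive constant, by which the differential
    equation can be divided. *)
Definition weight_ratio : R :=
  if c == 0 then `|a| ^+ 2 / `|d| ^+ 3 else `|c| ^+ 2 / `|beta| ^+ 3.

Lemma weight_ratio_gt0 : 0 < weight_ratio.
Proof.
rewrite /weight_ratio; case: (eqVneq c 0) => [/ad_neq0[a0 d0]|c0].
  by rewrite divr_gt0// exprn_gt0// normr_gt0.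
by rewrite divr_gt0// exprn_gt0// normr_gt0// beta_neq0.
Qed.

Lemma cauchy_kernel_conj (q : quat R) : cauchy_kernel q = `|q| ^- 4 *: qconj q.
Proof.
rewrite cauchy_kernelE -qnorm_sqr qnormV quat_invE scalerA -qnorm_sqr.
by congr (_ *: _); rewrite exprVn -invfM -exprD.
Qed.

(** Up to the constant [beta^-1], the weight is the Cauchy kernel at [ycoef]. *)
Lemma C_T_inversion z : c != 0 ->
  C_T a b c d z = (`|c| ^+ 2 / `|beta|) *: (beta^-1 * cauchy_kernel (y z)).
Proof. by move=> c0; rewrite /C_T (negbTE c0) cauchy_kernel_conj. Qed.

Lemma qconj_invE (q : quat R) : q != 0 -> qconj q = `|q| ^+ 2 *: q^-1.
Proof.
move=> q0; rewrite quat_invE scalerA qnorm_sqr divff ?scale1r//.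
by rewrite qnormsq_eq0.
Qed.

Lemma C_T_A_T z : C_T a b c d z = weight_ratio *: A_T a b c d z.
Proof.
rewrite /C_T /A_T /weight_ratio; case: (eqVneq c 0) => [/ad_neq0[a0 d0]|c0].
  rewrite [X in _ = _ *: X](qconj_invE d0) [RHS]scalerA; congr (_ *: _).
  have := d0; rewrite -normr_eq0; move: `|a| `|d| => s t t0.
  by field.
rewrite [X in _ = _ *: (X * _)](qconj_invE (beta_neq0 c0)) -[X in _ = _ *: X]scalerAl [RHS]scalerA; congr (_ *: _).
have := beta_neq0 c0; rewrite -normr_eq0; move: `|c| `|beta| => s t t0.
by field.
Qed.

Lemma C_T_neq0 z : c * z + d != 0 -> C_T a b c d z != 0.
Proof.
rewrite /C_T; case: (eqVneq c 0) => [/ad_neq0[a0 d0] _|c0 cd0].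
  rewrite scaler_eq0 quat_inv_eq0 (negbTE d0) orbF mulf_neq0 ?invr_eq0 ?normr_eq0//.
  by rewrite expf_neq0// normr_eq0.
have y0 : y z != 0 by rewrite ycoef_eq0.
rewrite scaler_eq0 quat_mul_eq0 quat_inv_eq0 scaler_eq0 !negb_or.
rewrite beta_neq0//= mulf_neq0 ?invr_eq0 ?expf_neq0 ?normr_eq0 ?beta_neq0//=.
by rewrite scaler_eq0 qconj_eq0 negb_or y0 invr_eq0 expf_neq0 ?normr_eq0.
Qed.

Lemma B_T_neq0 z : c * z + d != 0 -> B_T a b c d (T z) != 0.
Proof.
rewrite /B_T; case: (eqVneq c 0) => [/ad_neq0[a0 d0] _|c0 cd0].
  by rewrite qconj_eq0.
have y0 : y z != 0 by rewrite ycoef_eq0.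
rewrite moebius_inversion// addrC addKr oppr_eq0 scaler_eq0 quat_mul_eq0.
rewrite !qconj_eq0 !negb_or c0 quat_inv_eq0 y0.
by rewrite expf_neq0 ?normr_eq0 ?quat_inv_eq0.
Qed.

Definition regular_points : set (quat R) := [set z | c * z + d != 0].

Lemma C1on_qaffine U p q r : open U -> C1on U (fun z => p * z * q + r).
Proof.
move=> oU; have C r' : C1on U (fun _ : quat R => r' : quat R) by exact: C1on_cst.
exact: (@C1onD R (quat R) (quat R) U _ _ oU
  (C1on_qmul oU (C1on_qmul oU (C p) (C1on_id U)) (C q)) (C r)).
Qed.

Lemma C1on_qaffinel U p r : open U -> C1on U (fun z => p * z + r).
Proof.
move=> oU; have := @C1on_qaffine U p 1 r oU.
by under eq_fun do rewrite mulr1.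
Qed.

Lemma open_regular_points : open regular_points.
Proof.
rewrite (_ : regular_points = (fun z => c * z + d) @^-1` [set w | w != 0])//.
apply: (@open_comp (quat R) (quat R)); last exact: open_quat_neq.
move=> z _; exact: (C1on_continuous (@C1on_qaffinel setT c d openT) I).
Qed.

Lemma C1on_moebius : C1on regular_points T.
Proof.
have oU := open_regular_points.
apply: (C1on_qmul oU); first exact: C1on_qaffinel.
by apply: (C1on_qinv oU) => //; exact: C1on_qaffinel.
Qed.

Lemma C1on_ycoef U : open U -> C1on U y.
Proof. by move=> oU; exact: C1on_qaffine. Qed.

Lemma C1on_cauchy_kernel U (f : quat R -> quat R) : open U ->
  (forall z, U z -> f z != 0) -> C1on U f -> C1on U (fun z => cauchy_kernel (f z)).
Proof.
move=> oU f0 cf; have ci := C1on_qinv oU f0 cf.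
exact: (C1on_qmul oU ci (C1on_qmul oU ci (C1on_qconj oU ci))).
Qed.

Lemma C1on_C_T : C1on regular_points (C_T a b c d).
Proof.
have oU := open_regular_points.
have [c0|c0] := eqVneq c 0.
  rewrite (_ : C_T a b c d = cst ((`|a| ^+ 2 / `|d|) *: d^-1)); first exact: C1on_cst.
  by apply/funext => z; rewrite /C_T c0 eqxx.
rewrite (_ : C_T a b c d = fun z =>
  (`|c| ^+ 2 / `|beta|) *: (beta^-1 * cauchy_kernel (y z))); last first.
  by apply/funext => z; exact: C_T_inversion.
apply: (@C1on_qscale R _ (fun=> `|c| ^+ 2 / `|beta|)) => //.
  exact: (@C1on_cst R (quat R) R).
apply: (@C1on_qmul R _ (fun=> beta^-1)) => //.
  exact: (@C1on_cst R (quat R) (quat R)).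
apply: (C1on_cauchy_kernel oU); last exact: C1on_ycoef.
by move=> z cd0; rewrite ycoef_eq0.
Qed.

Lemma fueter_eq_on U f g z : open U -> U z ->
  (forall w, U w -> f w = g w) -> fueter f z = fueter g z.
Proof.
move=> oU Uz fg; rewrite /fueter.
have E v : 'D_v f z = 'D_v g z := derive_eq_on v oU Uz fg.
by rewrite !E.
Qed.

Lemma fueter_scale s (f : quat R -> quat R) z : differentiable f z ->
  fueter (fun w => s *: f w) z = s *: fueter f z.
Proof.
move=> df.
have E v : 'D_v (fun w => s *: f w) z = s *: 'D_v f z.
  rewrite (_ : (fun w => s *: f w) = fun w => s%:A * f w).
    by rewrite derive_qmull// -scalerAl mul1r.
  by apply/funext => w; rewrite -scalerAl mul1r.
by rewrite /fueter !E !scalerDr -!scalerAr.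
Qed.

(** The affine case is [fueter_affine]; otherwise [fueter_kelvin] is used at
    [ycoef], followed by [fueter_affine] for the map [ycoef] itself. *)
Lemma moebius_fueter (f : quat R -> quat R) z :
  regular_points z -> differentiable f (T z) ->
  fueter (fun w => C_T a b c d w * f (T w)) z =
  weight_ratio *: (B_T a b c d (T z) * fueter f (T z)).
Proof.
move=> cd0 df; have [c0|c0] := eqVneq c 0.
  have [a0 d0] := ad_neq0 c0.
  have Tz := moebius_affine z c0; rewrite Tz in df *.
  rewrite (_ : (fun _ => _) = (fun w => (`|a| ^+ 2 / `|d|) *:
      (d^-1 * f (a * w * d^-1 + b * d^-1)))); last first.
    by apply/funext => w; rewrite moebius_affine// /C_T c0 eqxx -scalerAl.
  have dfa : differentiable (fun w => f (a * w * d^-1 + b * d^-1)) z.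
    exact: (@differentiable_comp R (quat R) (quat R) (quat R) _ f z
      (differentiable_qaffine _ _ _ z) df).
  rewrite fueter_scale; last exact: differentiable_qmul (differentiable_qcst _ _) dfa.
  rewrite fueter_affine// scalerA /weight_ratio /B_T c0 eqxx; congr (_ *: _).
  rewrite -qnorm_sqr qnormV; have := d0; rewrite -normr_eq0.
  by move: `|a| `|d| => s t t0; field.
have b0 := beta_neq0 c0; have y0 : y z != 0 by rewrite ycoef_eq0.
have Tz := moebius_inversion c0 cd0; rewrite Tz in df *.
pose h (x : quat R) : quat R := cauchy_kernel x * f (a * c^-1 + x^-1).
rewrite (@fueter_eq_on _ _ (fun w => (`|c| ^+ 2 / `|beta|) *:
    (beta^-1 * h (c * w * beta^-1 + d * beta^-1))) z open_regular_points cd0); last first.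
  move=> w cdw; rewrite C_T_inversion// moebius_inversion// -[LHS]scalerAl.
  by congr (_ *: _); rewrite -[LHS]mulrA.
have dh : differentiable h (y z).
  apply: differentiable_qmul; first exact: differentiable_cauchy_kernel.
  have dw := differentiable_qinv y0.
  have da : differentiable (fun x : quat R => a * c^-1 + x^-1) (y z).
    exact: (@differentiableD R (quat R) (quat R) _ _ _ (differentiable_qcst _ _) dw).
  exact: (@differentiable_comp R (quat R) (quat R) (quat R) _ f _ da df).
have dfa : differentiable (fun w => h (c * w * beta^-1 + d * beta^-1)) z.
  exact: (@differentiable_comp R (quat R) (quat R) (quat R) _ h z
      (differentiable_qaffine _ _ _ z) dh).
rewrite fueter_scale; last exact: differentiable_qmul (differentiable_qcst _ _) dfa.
rewrite fueter_affine// -/(y z) fueter_kelvin//.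
rewrite /weight_ratio /B_T (negbTE c0) (addrC (a * c^-1)) addrK.
have scalars (s1 s2 s3 r t : R) (X W D : quat R) : s1 * s2 * s3 = - (r * t) ->
    s1 *: (s2 *: (X * (s3 *: (W * D)))) = r *: (- (t *: (X * W)) * D).
  move=> E; rewrite -scalerAr !scalerA E mulNr -scalerAl scalerN scalerA scaleNr.
  by rewrite mulrA.
apply: scalars; rewrite -!qnorm_sqr !qnormV -exprM; have := b0; rewrite -normr_eq0.
by move: `|c| `|beta| (`|y z|^-1 ^+ _) => s t r t0; field.
Qed.

(** The inverse transformation, in the left-handed form obtained by solving
    [(a - zeta c) z = zeta d - b] for [z]; it covers both cases of [c]. *)
Definition moebius_inv zeta : quat R := (a - zeta * c)^-1 * (zeta * d - b).

Lemma moebius_inv_eq z : regular_points z -> (a - T z * c) * z = T z * d - b.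
Proof.
move=> rz; have E : T z * (c * z + d) = a * z + b.
  by rewrite /moebius -mulrA quat_mulVf// mulr1.
rewrite mulrBl -mulrA -[a * z](addrK b) -E mulrDr addrAC.
by rewrite (addrC (T z * (c * z))) addrK.
Qed.

Lemma moebius_inv_den z : regular_points z -> a - T z * c != 0.
Proof.
move=> rz; apply/eqP => den0; have := moebius_inv_eq rz; rewrite den0 mul0r => /esym/eqP.
rewrite subr_eq0 => /eqP Tdb; move/eqP: den0; rewrite subr_eq0 => /eqP Eac.
have [c0|c0] := eqVneq c 0.
  by have [/eqP a0 _] := ad_neq0 c0; apply: a0; rewrite Eac c0 mulr0.
have Tac : a * c^-1 = T z by rewrite {1}Eac -mulrA quat_mulfV// mulr1.
by move/eqP: (c0) => /Hc1; apply; rewrite Tac Tdb subrr.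
Qed.

Lemma moebius_inv_left z : regular_points z -> moebius_inv (T z) = z.
Proof.
move=> rz; rewrite /moebius_inv -(moebius_inv_eq rz) mulrA quat_mulVf ?mul1r//.
exact: moebius_inv_den.
Qed.

Lemma moebius_inj z w : regular_points z -> regular_points w -> T z = T w -> z = w.
Proof. by move=> rz rw E; rewrite -(moebius_inv_left rz) E moebius_inv_left. Qed.

End moebius_covariance.
(** * Borel measurability *)

Section quat_measurability.
Context {R : realType}.
Implicit Types (U A : set (quat R)).

Lemma measurable_prod_of_quat : measurable_fun setT (@prod_of_quat R).
Proof.
move=> _ Y mY; rewrite setTI; rewrite /measurable /= /quat_measurable /=.
by rewrite -comp_preimage (_ : _ \o _ = id)//; apply/funext => x; exact: quat_of_prodK.
Qed.

Lemma measurable_qre : measurable_fun setT (@qre R).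
Proof.
rewrite (_ : @qre R = (fst \o fst \o fst) \o @prod_of_quat R)//.
apply: measurableT_comp measurable_prod_of_quat.
by do 2 apply: (measurableT_comp measurable_fst); exact: measurable_fst.
Qed.

Lemma measurable_qi : measurable_fun setT (@qi R).
Proof.
rewrite (_ : @qi R = (snd \o fst \o fst) \o @prod_of_quat R)//.
apply: measurableT_comp measurable_prod_of_quat.
by do 2 apply: measurableT_comp => //.
Qed.

Lemma measurable_qj : measurable_fun setT (@qj R).
Proof.
rewrite (_ : @qj R = (snd \o fst) \o @prod_of_quat R)//.
apply: measurableT_comp measurable_prod_of_quat.
by apply: measurableT_comp => //.
Qed.

Lemma measurable_qk : measurable_fun setT (@qk R).
Proof.
rewrite (_ : @qk R = snd \o @prod_of_quat R)//.
exact: measurableT_comp measurable_prod_of_quat.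
Qed.

Lemma measurable_fun_quat d (X : measurableType d) (D : set X) (f : X -> quat R) :
  measurable D ->
  measurable_fun D (fun x => qre (f x)) -> measurable_fun D (fun x => qi (f x)) ->
  measurable_fun D (fun x => qj (f x)) -> measurable_fun D (fun x => qk (f x)) ->
  measurable_fun D f.
Proof.
move=> mD h0 h1 h2 h3.
(* The components are extended by zero outside [D]; the function they form agrees
   with [f] on [D]. *)
pose g x := Quat (((fun x => qre (f x)) \_ D) x) (((fun x => qi (f x)) \_ D) x)
  (((fun x => qj (f x)) \_ D) x) (((fun x => qk (f x)) \_ D) x).
have mg : measurable_fun setT g.
  rewrite (_ : g = @quat_of_prod R \o (fun x => ((((fun x => qre (f x)) \_ D) x),
    (((fun x => qi (f x)) \_ D) x), (((fun x => qj (f x)) \_ D) x),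
    (((fun x => qk (f x)) \_ D) x))))//.
  apply: measurableT_comp; first exact: measurable_quat_of_prod.
  have mr h : measurable_fun D h -> measurable_fun setT (h \_ D : X -> R).
    by move=> mh; apply: (measurable_restrictT _ mD).1.
  exact: measurable_fun_pair (measurable_fun_pair (measurable_fun_pair (mr _ h0) (mr _ h1)) (mr _ h2)) (mr _ h3).
apply: (@eq_measurable_fun _ _ _ _ D g).
  by move=> x xD; rewrite /g !patchE xD; case: (f x).
exact: measurable_funS mg.
Qed.

Lemma measurable_fun_quatP d (X : measurableType d) (D : set X) (f : X -> quat R) :
  measurable_fun D f ->
  [/\ measurable_fun D (fun x => qre (f x)), measurable_fun D (fun x => qi (f x)),
    measurable_fun D (fun x => qj (f x)) & measurable_fun D (fun x => qk (f x))].
Proof.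
move=> mf; split.
- exact: (measurableT_comp measurable_qre mf).
- exact: (measurableT_comp measurable_qi mf).
- exact: (measurableT_comp measurable_qj mf).
- exact: (measurableT_comp measurable_qk mf).
Qed.

Lemma measurable_qball (p : quat R) (r : R) : measurable (ball p r).
Proof.
rewrite (_ : ball p r = setT `&` (fun z : quat R => `|p - z|) @^-1` [set` `]-oo, r[ ]); last first.
  by apply/seteqP; split=> z; rewrite -ball_normE /= in_itv/=; [move=> ?; split|case].
suff: measurable_fun setT (fun z : quat R => `|p - z|) by apply => //; exact: measurable_itv.
under eq_fun do rewrite quat_normE.
apply: measurableT_comp; first by apply: continuous_measurable_fun; exact: sqrt_continuous.
have mB (l : quat R -> R) (s : R) : measurable_fun setT l -> measurable_fun setT (fun z => (s - l z) ^+ 2).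
  by move=> ml; apply: measurable_funX; apply: measurable_funB.
have m0 := mB _ (qre p) measurable_qre; have m1 := mB _ (qi p) measurable_qi.
have m2 := mB _ (qj p) measurable_qj; have m3 := mB _ (qk p) measurable_qk.
exact: measurable_funD (measurable_funD (measurable_funD m0 m1) m2) m3.
Qed.

(** The measurable sets are those of the product of four lines, the open sets
    those of the norm; an open set is the union of the countably many balls with
    rational center and radius [1 / n] that it contains. *)
Lemma measurable_open_quat U : open U -> measurable U.
Proof.
move=> oU.
pose q (t : rat * rat * rat * rat) : quat R :=
  Quat (ratr t.1.1.1) (ratr t.1.1.2) (ratr t.1.2) (ratr t.2).
pose D := [set tn : rat * rat * rat * rat * nat | ball (q tn.1) tn.2.+1%:R^-1 `<=` U].
have -> : U = \bigcup_(tn in D) ball (q tn.1) tn.2.+1%:R^-1.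
  apply/seteqP; split=> [z Uz|z [tn Dtn]]; last exact: Dtn.
  have /nbhs_ballP[e /= e0 eU] : nbhs z U by exact: open_nbhs_nbhs.
  have [n ne] : exists n : nat, n.+1%:R^-1 < e / 2.
    have e2 : 0 < e / 2 by rewrite divr_gt0.
    have [n _ /(_ n (leqnn _))] := near_infty_natSinv_lt (PosNum e2).
    by exists n.
  have appr (x : R) : exists t : rat, `|ratr t - x| < n.+1%:R^-1 / 4.
    have d0 : 0 < n.+1%:R^-1 / 4 :> R by rewrite divr_gt0// invr_gt0.
    have [t] : exists t, ratr t \in `]x - n.+1%:R^-1 / 4, x + n.+1%:R^-1 / 4[.
      by apply: rat_in_itvoo; rewrite ltrBlDr -addrA ltrDl addr_gt0.
    by rewrite in_itv /= -ltr_distl => ?; exists t.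
  have [t0 h0] := appr (qre z); have [t1 h1] := appr (qi z).
  have [t2 h2] := appr (qj z); have [t3 h3] := appr (qk z).
  have zq : `|q (t0, t1, t2, t3) - z| < n.+1%:R^-1.
    apply: (le_lt_trans (qnorm_le_sum _)) => /=.
    by move: h0 h1 h2 h3; move: (n.+1%:R^-1) => s; lra.
  exists ((t0, t1, t2, t3), n); last by rewrite -ball_normE.
  rewrite /D /= => w; rewrite -ball_normE /= => qw; apply: eU.
  rewrite -ball_normE /= (_ : z - w = (q (t0, t1, t2, t3) - w) - (q (t0, t1, t2, t3) - z)).
    apply: (le_lt_trans (ler_normB _ _)); move: ne zq qw.
    by move: (n.+1%:R^-1) => s; lra.
  by rewrite opprB [RHS]addrC addrA subrK.
rewrite bigcup_mkcond; apply: countable_bigcupT_measurable; first exact: countableP.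
by move=> tn; case: ifP => // _; exact: measurable_qball.
Qed.

Lemma continuous_measurable_quat_real U (f : quat R -> R) : open U ->
  (forall z, U z -> {for z, continuous f}) -> measurable_fun U f.
Proof.
move=> oU cf; apply: (measurability _ (RGenOpens.measurableE R)).
move=> _ [_ [a [b ->] <-]]; apply: measurable_open_quat.
rewrite openE => z [Uz fz].
apply: filterI; first exact: open_nbhs_nbhs.
apply: (cf z Uz `]a, b[%classic); apply: open_nbhs_nbhs; split=> //.
Qed.

Lemma continuous_measurable_quat U (f : quat R -> quat R) : open U ->
  (forall z, U z -> {for z, continuous f}) -> measurable_fun U f.
Proof.
move=> oU cf; have mU := measurable_open_quat oU.
have C (l : quat R -> R) z : continuous l -> U z -> {for z, continuous (l \o f)}.
  move=> cl Uz; exact: (@continuous_comp_at R (quat R) (quat R) R f l z (cf z Uz) (cl _)).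
have M (l : quat R -> R) : continuous l -> measurable_fun U (l \o f).
  by move=> cl; apply: continuous_measurable_quat_real => // z; exact: C.
apply: (measurable_fun_quat mU).
- exact: M qre_continuous.
- exact: M qi_continuous.
- exact: M qj_continuous.
- exact: M qk_continuous.
Qed.

End quat_measurability.
(** * Translation invariance and boxes *)

Section measure_preservation.
Local Open Scope ereal_scope.
Context {R : realType}.

Definition preserves d (X : measurableType d) (m : set X -> \bar R) (f : X -> X) :=
  measurable_fun setT f /\ forall A, measurable A -> m (f @^-1` A) = m A.

Lemma preserves_integral d (X : measurableType d) (m : {measure set X -> \bar R})
    phi (f : X -> \bar R) : preserves m phi -> measurable_fun setT f ->
  (forall x, 0 <= f x) -> \int[m]_x f (phi x) = \int[m]_x f x.
Proof.
move=> [mphi h] mf f0.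
pose mp : {measure set X -> \bar R} :=
  measure_function_pushforward__canonical__measure_function_Measure m mphi.
transitivity (\int[mp]_x f x).
  by rewrite /mp /= (ge0_integral_pushforward mphi).
by apply: eq_measure_integral => A mA _; exact: h.
Qed.

Lemma preserves_prod d1 d2 (X1 : measurableType d1) (X2 : measurableType d2)
    (m1 : {measure set X1 -> \bar R})
    (m2 : {sigma_finite_measure set X2 -> \bar R}) f1 f2 :
  preserves m1 f1 -> preserves m2 f2 ->
  preserves (m1 \x m2) (fun x => (f1 x.1, f2 x.2)).
Proof.
move=> p1 [mf2 h2]; have mf1 := p1.1.
have mf : measurable_fun setT (fun x : X1 * X2 => (f1 x.1, f2 x.2)).
  by apply: measurable_fun_pair; apply: measurableT_comp => //.
split=> // A mA; rewrite /product_measure1.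
rewrite -[RHS](preserves_integral p1); last 2 first.
- exact: measurable_fun_xsection.
- by move=> x /=; exact: measure_ge0.
apply: eq_integral => x _ /=.
transitivity (m2 (f2 @^-1` xsection A (f1 x))); first by rewrite !xsectionE.
by apply: h2; exact: measurable_xsection.
Qed.

(** Lebesgue measure is determined by its values on intervals. *)
Lemma preserves_addr (t : R) : preserves (@lebesgue_measure R) (fun x => x + t)%R.
Proof.
have mf0 : measurable_fun setT (fun x : R => x + t)%R by apply: measurable_funD.
have mf : measurable_fun setT (fun x : measurableTypeR R => (x + t)%R : measurableTypeR R) by exact: mf0.
split=> // A mA; apply/esym.
pose mp : {measure set (measurableTypeR R) -> \bar R} :=
  measure_function_pushforward__canonical__measure_function_Measure (@lebesgue_measure R) mf.
apply: (@lebesgue_measure_unique _ mp) => // _ [[x y] _ <-]/=.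
rewrite /mp /= /pushforward (_ : _ @^-1` _ = `](x - t)%R, (y - t)%R]%classic).
  rewrite !lebesgue_measure_itv /= !lte_fin ltrD2r.
  by case: ifP => // _; rewrite -!EFinB; congr EFin; rewrite opprB addrA subrK.
by apply/seteqP; split => z /=; rewrite !in_itv/= ltrBlDr lerBrDr.
Qed.

Lemma preserves_qvol_addr (p : quat R) : preserves (@qvol R) (fun x => x + p)%R.
Proof.
have mf : measurable_fun setT (fun x : quat R => x + p)%R.
  have := @C1on_qaffinel R setT 1 p openT; under eq_fun do rewrite mul1r.
  by move=> cp; apply: continuous_measurable_quat openT _ => z; exact: C1on_continuous cp.
split=> // A mA.
have [mg mE] := preserves_prod (preserves_prod (preserves_prod (preserves_addr (qre p))
  (preserves_addr (qi p))) (preserves_addr (qj p))) (preserves_addr (qk p)).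
rewrite /qvol /pushforward -[RHS]mE.
  by congr (_ _); apply/seteqP; split.
by rewrite -(setTI (_ @^-1` _)); exact: measurable_quat_of_prod.
Qed.

End measure_preservation.

Section qvol_boxes.
Context {R : realType}.

Definition qbox (a b : R) : set (quat R) :=
  [set q | [/\ a < qre q < b, a < qi q < b, a < qj q < b & a < qk q < b]].

Lemma qboxE (a b : R) : @quat_of_prod R @^-1` qbox a b =
  `]a, b[ `*` `]a, b[ `*` `]a, b[ `*` `]a, b[.
Proof.
apply/seteqP; split => -[[[x y] z] t]; rewrite /qbox /= !in_itv/=.
  by case.
by case=> -[[]].
Qed.

Lemma measurable_qbox (a b : R) : measurable (qbox a b).
Proof.
rewrite /measurable /= /quat_measurable /= qboxE.
by apply: measurableX => //; apply: measurableX => //; apply: measurableX.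
Qed.

Lemma qvol_qbox (a b : R) : a < b -> qvol (qbox a b) = ((b - a) ^+ 4)%:E.
Proof.
move=> ab; rewrite /qvol /pushforward qboxE.
have mI : measurable (`]a, b[%classic : set (measurableTypeR R)) by exact: measurable_itv.
have m2 := measurableX mI mI; have m3 := measurableX m2 mI.
have LE : (@lebesgue_measure R) `]a, b[%classic = (b - a)%:E.
  by rewrite lebesgue_measure_itv /= lte_fin ab -EFinB.
transitivity ((b - a)%:E * (b - a)%:E * (b - a)%:E * (b - a)%:E)%E; last first.
  by rewrite -!EFinM; congr EFin; ring.
rewrite product_measure1E//; congr (_ * _)%E; last exact: LE.
transitivity ((@lebesgue_measure R \x @lebesgue_measure R \x @lebesgue_measure R)%E (`]a, b[ `*` `]a, b[ `*` `]a, b[)) => //.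
rewrite product_measure1E//; congr (_ * _)%E; last exact: LE.
transitivity ((@lebesgue_measure R \x @lebesgue_measure R)%E (`]a, b[ `*` `]a, b[)) => //.
by rewrite product_measure1E//; congr (_ * _)%E; exact: LE.
Qed.

Lemma qvol_sigma_finite : sigma_finite setT (@qvol R).
Proof.
exists (fun n => qbox (- n.+1%:R) n.+1%:R).
  apply/seteqP; split=> // q _.
  have h := archi_boundP (normr_ge0 q); set n := Num.bound _ in h.
  have qn : `|q| < n.+1%:R by apply: (lt_le_trans h); rewrite ler_nat.
  exists n => //; rewrite /qbox /= -!ltr_norml; split; apply: le_lt_trans qn.
  - exact: ler_norm_qre.
  - exact: ler_norm_qi.
  - exact: ler_norm_qj.
  - exact: ler_norm_qk.
move=> n; split; first exact: measurable_qbox.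
by rewrite qvol_qbox ?ltry// gtrN.
Qed.

HB.instance Definition _ := Measure_isSigmaFinite.Build _ _ _ (@qvol R) qvol_sigma_finite.

Lemma qball_sub_qbox (r : R) : ball (0 : quat R) r `<=` qbox (- r) r.
Proof.
move=> q; rewrite -ball_normE /= sub0r normrN => qr.
rewrite /qbox /= -!ltr_norml; split; apply: le_lt_trans qr.
- exact: ler_norm_qre.
- exact: ler_norm_qi.
- exact: ler_norm_qj.
- exact: ler_norm_qk.
Qed.

Lemma qvol_qball_lty (r : R) : 0 < r -> (qvol (ball (0%R : quat R) r) < +oo)%E.
Proof.
move=> r0; apply: (@le_lt_trans _ _ (qvol (qbox (- r) r))); last first.
  by rewrite qvol_qbox ?ltry// gtrN.
apply: le_measure; rewrite ?inE; [exact: measurable_qball|exact: measurable_qbox|exact: qball_sub_qbox].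
Qed.

Lemma qvol_qball_gt0 (r : R) : 0 < r -> (0 < qvol (ball (0%R : quat R) r))%E.
Proof.
move=> r0; apply: (@lt_le_trans _ _ (qvol (qbox (- (r / 4)) (r / 4)))); last first.
  apply: le_measure; rewrite ?inE; [exact: measurable_qbox|exact: measurable_qball|].
  move=> q; rewrite /qbox /= -!ltr_norml -ball_normE /= sub0r normrN => -[h0 h1 h2 h3].
  by apply: (le_lt_trans (qnorm_le_sum _)); lra.
have r4 : 0 < r / 4 by rewrite divr_gt0.
by rewrite qvol_qbox ?gtrN// lte_fin exprn_gt0// subr_gt0 gtrN.
Qed.

Lemma qvol_set0 : qvol [set (0 : quat R)] = 0%E.
Proof.
apply/eqP; rewrite eq_le measure_ge0 andbT; apply/lee_addgt0Pr => e e0.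
have [r r0 re] : exists2 r : R, 0 < r & (2 * r) ^+ 4 <= e.
  exists (Num.min (1/2) (e / 2)); first by rewrite lt_min; apply/andP; split; lra.
  set m := Num.min _ _.
  have m1 : m <= 1/2 by rewrite ge_min lexx.
  have m2 : m <= e/2 by rewrite ge_min lexx orbT.
  have m0 : 0 < m by rewrite lt_min; apply/andP; split; lra.
  have s1 : 2 * m <= 1 by lra.
  apply: (@le_trans _ _ (2 * m)); last by lra.
  rewrite exprS ler_piMr//; first by lra.
  by rewrite exprn_ile1//; lra.
rewrite add0e; apply: (@le_trans _ _ (qvol (qbox (- r) r))).
  apply: le_measure; rewrite ?inE; [|exact: measurable_qbox|].
    rewrite (_ : [set 0] = ~` [set z : quat R | z != 0]).
      by apply: measurableC; apply: measurable_open_quat; exact: open_quat_neq.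
    by apply/seteqP; split => z /=; [move=> ->; rewrite eqxx|move/negP; rewrite negbK => /eqP].
  by move=> _ ->; rewrite /qbox /= !oppr_lt0 r0.
by rewrite qvol_qbox ?gtrN// lee_fin opprK -mulr2n -mulr_natl.
Qed.

End qvol_boxes.

Section haar.
Local Open Scope ereal_scope.
Context {R : realType}.
Implicit Types (f g : quat R -> \bar R).

Lemma measurable_quat_add d (X : measurableType d) (A : set X) (a b : X -> quat R) :
  measurable A -> measurable_fun A a -> measurable_fun A b ->
  measurable_fun A (fun x => a x + b x)%R.
Proof.
move=> mA /measurable_fun_quatP[a0 a1 a2 a3] /measurable_fun_quatP[b0 b1 b2 b3].
by apply: measurable_fun_quat => //; exact: measurable_funD.
Qed.

Lemma measurable_quat_opp d (X : measurableType d) (a : X -> quat R) :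
  measurable_fun setT a -> measurable_fun setT (fun x => - a x)%R.
Proof.
move=> /measurable_fun_quatP[a0 a1 a2 a3].
by apply: measurable_fun_quat => //; exact: measurable_funN.
Qed.

Lemma measurable_quat_mul d (X : measurableType d) (A : set X) (a b : X -> quat R) :
  measurable A -> measurable_fun A a -> measurable_fun A b ->
  measurable_fun A (fun x => a x * b x)%R.
Proof.
move=> mA /measurable_fun_quatP[a0 a1 a2 a3] /measurable_fun_quatP[b0 b1 b2 b3].
by apply: measurable_fun_quat => //=;
  do ?[apply: measurable_funB|apply: measurable_funD]; exact: measurable_funM.
Qed.

Lemma integral_qvol_addr (p : quat R) f : measurable_fun setT f -> (forall x, 0 <= f x) ->
  \int[qvol]_x f (x + p)%R = \int[qvol]_x f x.
Proof. by move=> mf f0; exact: (preserves_integral (preserves_qvol_addr p)). Qed.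

(** The uniqueness argument for Haar measure, in elementary form: in
    [\int\int f (phi x) g (y + phi x) dx dy] substitute [x - phi' y] for [x], then
    [y + phi x] for [y]; both are translations. *)
Lemma haar_twist (phi phi' : quat R -> quat R) f g :
  {morph phi : x y / (x + y)%R} -> cancel phi' phi ->
  measurable_fun setT phi ->
  measurable_fun setT f -> measurable_fun setT g ->
  (forall x, 0 <= f x) -> (forall x, 0 <= g x) ->
  (\int[qvol]_x f (phi x)) * (\int[qvol]_x g x) =
  (\int[qvol]_x g (phi x)) * (\int[qvol]_x f (- x)%R).
Proof.
move=> phiD phiK mphi mf mg f0 g0.
have mfphi : measurable_fun setT (f \o phi) by exact: measurableT_comp.
have mgphi : measurable_fun setT (g \o phi) by exact: measurableT_comp.
have phiN x : phi (- x)%R = (- phi x)%R.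
  apply/eqP; rewrite -subr_eq0 opprK -phiD addNr; apply/eqP.
  by apply: (addrI (phi 0%R)); rewrite -phiD !addr0.
have mfst : measurable_fun setT (fun z : quat R * quat R => phi z.1) by exact: measurableT_comp.
have m1 : measurable_fun setT (fun z : quat R * quat R => f (phi z.1) * g (z.2 + phi z.1)%R).
  apply: emeasurable_funM; first exact: measurableT_comp.
  by apply: measurableT_comp => //; exact: measurable_quat_add.
have m2 : measurable_fun setT (fun z : quat R * quat R => f (phi z.1 - z.2)%R * g (phi z.1)).
  apply: emeasurable_funM; last exact: measurableT_comp.
  by apply: measurableT_comp => //; apply: measurable_quat_add => //; exact: measurable_quat_opp.
transitivity (\int[qvol]_x \int[qvol]_y (f (phi x) * g (y + phi x)%R)).
  rewrite muleC -ge0_integralZl//; last by apply: integral_ge0.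
  apply: eq_integral => x _; rewrite ge0_integralZl//; last first.
    by apply: measurableT_comp => //; apply: measurable_quat_add.
  by rewrite muleC integral_qvol_addr.
rewrite (fubini_tonelli (fun z : quat R * quat R => f (phi z.1) * g (z.2 + phi z.1)%R))//=; last first.
  by move=> z; exact: mule_ge0.
transitivity (\int[qvol]_y \int[qvol]_x (f (phi x - y)%R * g (phi x))).
  apply: eq_integral => y _.
  rewrite -(@integral_qvol_addr (- phi' y)%R (fun x => f (phi x) * g (y + phi x)%R)).
  - by apply: eq_integral => x _; rewrite phiD phiN phiK (addrC y) subrK.
  - apply: emeasurable_funM => //.
    by apply: measurableT_comp => //; apply: measurable_quat_add.
  - by move=> x; exact: mule_ge0.
rewrite -(fubini_tonelli (fun z : quat R * quat R => f (phi z.1 - z.2)%R * g (phi z.1)))//=; last first.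
  by move=> z; exact: mule_ge0.
rewrite muleC -ge0_integralZl//; last by apply: integral_ge0.
apply: eq_integral => x _; rewrite ge0_integralZr//; last first.
  apply: measurableT_comp => //; apply: measurable_quat_add => //; exact: measurable_quat_opp.
congr (_ * _); rewrite -(@integral_qvol_addr (phi x) (fun y => f (phi x - y)%R)).
- by apply: eq_integral => y _; rewrite opprD addrCA subrr addr0.
- by apply: measurableT_comp => //; apply: measurable_quat_add => //; exact: measurable_quat_opp.
- by [].
Qed.

End haar.

(** * Linear change of variables *)

Section linear_change_of_variables.
Local Open Scope ereal_scope.
Context {R : realType}.
Implicit Types (f g : quat R -> \bar R) (p q r : quat R).

(** A function of finite positive integral, to cancel in identities between
    products of integrals. *)
Definition eball (x : quat R) : \bar R := (\1_(ball (0 : quat R) 1) x)%:E.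

Lemma eball_ge0 x : 0 <= eball x.
Proof. by rewrite lee_fin indicE ler0n. Qed.

Lemma measurable_eball : measurable_fun setT eball.
Proof. by apply/measurable_EFinP; exact: measurable_indic (measurable_qball _ _). Qed.

Lemma integral_eball : \int[qvol]_x eball x = qvol (ball (0%R : quat R) 1%R).
Proof. by rewrite /eball integral_indic ?setIT//; exact: measurable_qball. Qed.

Lemma eqe_mulr_ball (x y : \bar R) : x * \int[qvol]_x eball x = y * \int[qvol]_x eball x -> x = y.
Proof.
rewrite integral_eball; have := @qvol_qball_gt0 R 1 ltr01.
have := @qvol_qball_lty R 1 ltr01; case: (qvol _) => // c _; rewrite lte_fin => c0.
have cV : c%:E * (c^-1)%:E = 1 by rewrite -EFinM divff ?gt_eqF.
by move=> /(congr1 (fun t => t * (c^-1)%:E)); rewrite -!muleA cV !mule1.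
Qed.

Lemma integral_qvol_opp f : measurable_fun setT f -> (forall x, 0 <= f x) ->
  \int[qvol]_x f (- x)%R = \int[qvol]_x f x.
Proof.
move=> mf f0; apply: eqe_mulr_ball; rewrite [RHS](@haar_twist R id id _ _ _ _ _ mf measurable_eball f0 eball_ge0)//.
by rewrite muleC.
Qed.

Lemma haar_swap (phi phi' : quat R -> quat R) f g :
  {morph phi : x y / (x + y)%R} -> cancel phi' phi ->
  measurable_fun setT phi ->
  measurable_fun setT f -> measurable_fun setT g ->
  (forall x, 0 <= f x) -> (forall x, 0 <= g x) ->
  (\int[qvol]_x f (phi x)) * (\int[qvol]_x g x) =
  (\int[qvol]_x g (phi x)) * (\int[qvol]_x f x).
Proof.
move=> phiD phiK mphi mf mg f0 g0.
by rewrite (haar_twist phiD phiK)// integral_qvol_opp.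
Qed.

(** The unit ball is invariant under an additive isometry, so the factor by
    which the isometry multiplies volumes is [1]. *)
Lemma integral_qvol_isometry (phi phi' : quat R -> quat R) f :
  {morph phi : x y / (x + y)%R} -> cancel phi' phi ->
  measurable_fun setT phi -> (forall x, `|phi x| = `|x|)%R ->
  measurable_fun setT f -> (forall x, 0 <= f x) ->
  \int[qvol]_x f (phi x) = \int[qvol]_x f x.
Proof.
move=> phiD phiK mphi nphi mf f0; apply: eqe_mulr_ball.
rewrite (haar_swap phiD phiK mphi mf measurable_eball f0 eball_ge0) muleC; congr (_ * _).
apply: eq_integral => x _; rewrite /eball; congr EFin; rewrite !indicE.
by congr (nat_of_bool _)%:R; apply/idP/idP; rewrite !inE -!ball_normE /= !sub0r !normrN nphi.
Qed.

Lemma measurable_qscale s : measurable_fun setT (fun x : quat R => (s *: x)%R).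
Proof.
have M (l : quat R -> R) : measurable_fun setT l -> measurable_fun setT (fun x => s * l x)%R.
  by move=> ml; exact: measurable_funM.
apply: measurable_fun_quat => //=.
- exact: M measurable_qre.
- exact: M measurable_qi.
- exact: M measurable_qj.
- exact: M measurable_qk.
Qed.

(** The factor is found on a cube. *)
Lemma integral_qvol_scale (s : R) f : (0 < s)%R ->
  measurable_fun setT f -> (forall x, 0 <= f x) ->
  \int[qvol]_x f (s *: x)%R = (s ^- 4)%:E * \int[qvol]_x f x.
Proof.
move=> s0 mf f0; pose g (x : quat R) : \bar R := (\1_(@qbox R 0 1) x)%:E.
have mg : measurable_fun setT g.
  by apply/measurable_EFinP; exact: measurable_indic (measurable_qbox _ _).
have := @haar_swap (fun x => s *: x)%R (fun x => s^-1 *: x)%R f g.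
have -> : \int[qvol]_x g x = 1.
  rewrite /g integral_indic; [|by []|exact: measurable_qbox].
  by rewrite setIT; apply: (etrans (qvol_qbox ltr01)); rewrite subr0 expr1n.
have -> : \int[qvol]_x g (s *: x)%R = (s ^- 4)%:E.
  transitivity (\int[qvol]_x (\1_(@qbox R 0 s^-1) x)%:E).
    apply: eq_integral => x _; congr EFin; rewrite !indicE; congr (nat_of_bool _)%:R.
    have E (t : R) : (0 < s * t < 1)%R = (0 < t < s^-1)%R.
      by rewrite pmulr_rgt0// -(ltr_pdivlMl _ _ s0) mulr1.
    by apply/idP/idP; rewrite !inE /qbox /= !E.
  rewrite integral_indic; [|by []|exact: measurable_qbox].
  have sV0 : (0 < s^-1)%R by rewrite invr_gt0.
  by rewrite setIT; apply: (etrans (qvol_qbox sV0)); rewrite subr0 exprVn.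
rewrite mule1; apply => //.
- by move=> x y; rewrite scalerDr.
- by move=> x; rewrite scalerA divff ?gt_eqF// scale1r.
- exact: measurable_qscale.
- by move=> x; rewrite lee_fin indicE ler0n.
Qed.

(** An additive similarity is a dilation composed with an isometry. *)
Lemma integral_qvol_conformal (phi phi' : quat R -> quat R) (s : R) f : (0 < s)%R ->
  {morph phi : x y / (x + y)%R} -> cancel phi' phi -> measurable_fun setT phi ->
  (forall x, `|phi x| = s * `|x|)%R ->
  measurable_fun setT f -> (forall x, 0 <= f x) ->
  \int[qvol]_x f (phi x) = (s ^- 4)%:E * \int[qvol]_x f x.
Proof.
move=> s0 phiD phiK mphi nphi mf f0; rewrite -integral_qvol_scale//.
have ss (x : quat R) : (s^-1 *: (s *: x) = x)%R by rewrite scalerA mulVf ?gt_eqF// scale1r.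
have ss' (x : quat R) : (s *: (s^-1 *: x) = x)%R by rewrite scalerA divff ?gt_eqF// scale1r.
rewrite -(@integral_qvol_isometry (fun x => s^-1 *: phi x)%R (fun x => phi' (s *: x))%R
   (fun x => f (s *: x)%R)).
- by apply: eq_integral => x _; rewrite ss'.
- by move=> x y; rewrite phiD scalerDr.
- by move=> x; rewrite phiK ss.
- exact: measurableT_comp (measurable_qscale _) mphi.
- by move=> x; rewrite normrZ nphi gtr0_norm ?invr_gt0// mulKf// gt_eqF.
- by apply: measurableT_comp => //; exact: measurable_qscale.
- by [].
Qed.

Lemma integral_qvol_mull q f : q != 0%R -> measurable_fun setT f -> (forall x, 0 <= f x) ->
  \int[qvol]_x f (q * x)%R = (`|q| ^- 4)%:E * \int[qvol]_x f x.
Proof.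
move=> q0; apply: (@integral_qvol_conformal _ (fun x => q^-1 * x)%R).
- by rewrite normr_gt0.
- by move=> x y; rewrite mulrDr.
- by move=> x; rewrite mulrA quat_mulfV// mul1r.
- exact: measurable_quat_mul.
- by move=> x; rewrite qnormM.
Qed.

Lemma integral_qvol_mulr q f : q != 0%R -> measurable_fun setT f ->
  (forall x, 0 <= f x) ->
  \int[qvol]_x f (x * q)%R = (`|q| ^- 4)%:E * \int[qvol]_x f x.
Proof.
move=> q0; apply: (@integral_qvol_conformal _ (fun x => x * q^-1)%R).
- by rewrite normr_gt0.
- by move=> x y; rewrite mulrDl.
- by move=> x; rewrite -mulrA quat_mulVf// mulr1.
- exact: measurable_quat_mul.
- by move=> x; rewrite qnormM mulrC.
Qed.

Lemma integral_qvol_affine p q r f : p != 0%R -> q != 0%R -> measurable_fun setT f ->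
  (forall x, 0 <= f x) ->
  \int[qvol]_x f (p * x * q + r)%R = (`|p| ^- 4 * `|q| ^- 4)%:E * \int[qvol]_x f x.
Proof.
move=> p0 q0 mf f0.
rewrite -(integral_qvol_addr r mf f0) EFinM -muleA.
have mfr : measurable_fun setT (fun x : quat R => f (x + r)%R).
  by apply: measurableT_comp => //; exact: measurable_quat_add.
rewrite -(integral_qvol_mulr q0 mfr)//.
rewrite -(@integral_qvol_mull p (fun x : quat R => f (x * q + r)%R))//.
by apply: measurableT_comp => //; apply: measurable_quat_add => //; exact: measurable_quat_mul.
Qed.

End linear_change_of_variables.

(** * Inversion and Moebius transformations *)

Section inversion.
Local Open Scope ereal_scope.
Context {R : realType}.
Implicit Types (f g : quat R -> \bar R) (p q : quat R).

Lemma measurable_qset1 p : measurable [set p].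
Proof.
rewrite (_ : [set p] = ~` [set z : quat R | z != p]).
  by apply: measurableC; apply: measurable_open_quat; exact: open_quat_neq.
by apply/seteqP; split => z /=; [move=> ->; rewrite eqxx|move/negP; rewrite negbK => /eqP].
Qed.

Lemma measurable_punctured d (Y : measurableType d) (h : quat R -> Y) :
  measurable_fun [set x : quat R | x != 0%R] h -> measurable_fun setT h.
Proof.
move=> mh; rewrite (_ : setT = [set x : quat R | x != 0%R] `|` [set 0%R]); last first.
  apply/seteqP; split=> // x _ /=; have [->|x0] := eqVneq x 0%R; [by right|by left].
apply/measurable_funU; [apply: measurable_open_quat; exact: open_quat_neq|exact: measurable_qset1|].
by split=> //; exact: measurable_fun_set1.
Qed.

Lemma measurable_qinv : measurable_fun setT (fun x : quat R => x^-1)%R.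
Proof.
apply: measurable_punctured; apply: continuous_measurable_quat; first exact: open_quat_neq.
by move=> z; exact: C1on_continuous C1on_inv.
Qed.

Lemma eq_integral_punctured f g : measurable_fun setT f -> measurable_fun setT g ->
  (forall x, 0 <= f x) -> (forall x, 0 <= g x) ->
  (forall x, x != 0%R -> f x = g x) -> \int[qvol]_x f x = \int[qvol]_x g x.
Proof.
move=> mf mg f0 g0 fg.
have m0 := measurable_qset1 0%R; have v0 := @qvol_set0 R.
rewrite (@ge0_negligible_integral _ _ _ qvol setT [set 0%R] f)//.
rewrite [RHS](@ge0_negligible_integral _ _ _ qvol setT [set 0%R] g)//.
by apply: eq_integral => x; rewrite inE /= => -[_ /eqP x0]; exact: fg.
Qed.

(** The density of the Haar measure of the multiplicative group; this group is
    unimodular. *)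
Definition haar_density (x : quat R) : \bar R := (`|x| ^- 4)%:E.

Lemma haar_density_ge0 x : 0 <= haar_density x.
Proof. by rewrite lee_fin invr_ge0 exprn_ge0. Qed.

Lemma measurable_haar_density : measurable_fun setT haar_density.
Proof.
apply: measurable_punctured; apply/measurable_EFinP.
rewrite (_ : (fun x => _) = fun x : quat R => ((qnormsq x)^-1 * (qnormsq x)^-1)%R); last first.
  by apply/funext => x; rewrite -qnorm_sqr -invfM -exprD.
have oU := @open_quat_neq R 0%R.
have cV : C1on [set x : quat R | x != 0%R] (fun x => (qnormsq x)^-1)%R.
  apply: (C1onV oU); last exact: (C1on_qnormsq oU (C1on_id _)).
  by move=> z; rewrite /= qnormsq_eq0.
apply: (continuous_measurable_quat_real oU) => z z0.
exact: (C1on_continuous (C1onM oU cV cV) z0).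
Qed.

Lemma haar_densityM p q : haar_density (p * q)%R = haar_density p * haar_density q.
Proof. by rewrite /haar_density qnormM exprMn invfM EFinM. Qed.

Lemma haar_density_unit q : q != 0%R -> (`|q| ^+ 4)%:E * haar_density q = 1.
Proof. by move=> q0; rewrite -EFinM divff// expf_neq0 ?normr_eq0. Qed.

Lemma haar_mull q f : q != 0%R -> measurable_fun setT f -> (forall x, 0 <= f x) ->
  \int[qvol]_x (f (q * x)%R * haar_density x) = \int[qvol]_x (f x * haar_density x).
Proof.
move=> q0 mf f0.
have mF : measurable_fun setT (fun x => f x * haar_density x).
  by apply: emeasurable_funM => //; exact: measurable_haar_density.
have F0 x : 0 <= f x * haar_density x by rewrite mule_ge0// haar_density_ge0.
rewrite -[RHS]mul1e -(haar_density_unit q0) -muleA -integral_qvol_mull// -ge0_integralZl//.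
- apply: eq_integral => x _; rewrite haar_densityM muleCA [X in _ = _ * X]muleA.
  by rewrite haar_density_unit// mul1e.
- by apply: (measurableT_comp mF); exact: measurable_quat_mul.
Qed.

Lemma haar_mulr q f : q != 0%R -> measurable_fun setT f -> (forall x, 0 <= f x) ->
  \int[qvol]_x (f (x * q)%R * haar_density x) = \int[qvol]_x (f x * haar_density x).
Proof.
move=> q0 mf f0.
have mF : measurable_fun setT (fun x => f x * haar_density x).
  by apply: emeasurable_funM => //; exact: measurable_haar_density.
have F0 x : 0 <= f x * haar_density x by rewrite mule_ge0// haar_density_ge0.
rewrite -[RHS]mul1e -(haar_density_unit q0) -muleA -integral_qvol_mulr// -ge0_integralZl//.
- apply: eq_integral => x _; rewrite haar_densityM muleCA (muleC (haar_density x)).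
  by rewrite [X in _ = _ * X]muleA haar_density_unit// mul1e.
- by apply: (measurableT_comp mF); exact: measurable_quat_mul.
Qed.

(** Inversion preserves Haar measure on a unimodular group: by Tonelli,
    [\int f (x^-1) dx * \int phi] equals
    [\int\int f (x^-1) phi (y x) dx dy = \int\int f (x^-1 y) phi x dx dy], which
    is [\int f * \int phi]. The function [phi] below has Haar integral the volume
    of the unit ball. *)
Lemma haar_inv f : measurable_fun setT f -> (forall x, 0 <= f x) ->
  \int[qvol]_x (f (x^-1)%R * haar_density x) = \int[qvol]_x (f x * haar_density x).
Proof.
move=> mf f0; have mw := measurable_haar_density; have w0 := haar_density_ge0.
pose phi (x : quat R) : \bar R := (`|x| ^+ 4)%:E * eball x.
have phi0 x : 0 <= phi x by rewrite mule_ge0 ?eball_ge0// lee_fin exprn_ge0.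
have mphi : measurable_fun setT phi.
  apply: emeasurable_funM; last exact: measurable_eball.
  apply/measurable_EFinP; under eq_fun do rewrite (exprM _ 2 2) qnorm_sqr.
  apply: measurable_funX; apply: (continuous_measurable_quat_real openT) => z _.
  exact: (C1on_continuous (C1on_qnormsq openT (C1on_id _))).
have Hphi : \int[qvol]_x (phi x * haar_density x) = \int[qvol]_x eball x.
  apply: eq_integral_punctured => //.
  - exact: emeasurable_funM.
  - exact: measurable_eball.
  - by move=> x; rewrite mule_ge0.
  - exact: eball_ge0.
  - by move=> x x0; rewrite /phi muleAC haar_density_unit// mul1e.
have minv := measurable_qinv.
have mfi : measurable_fun setT (fun x : quat R => f x^-1%R) by exact: measurableT_comp.
apply: eqe_mulr_ball; rewrite -Hphi.
(* The two double integrals above; the first and last ones are recovered by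
   translation invariance in the inner variable, for [x != 0] only. *)
set F := fun z : quat R * quat R => f (z.1^-1)%R * phi (z.2 * z.1)%R * (haar_density z.1 * haar_density z.2).
pose G := fun z : quat R * quat R => f (z.1^-1 * z.2)%R * phi z.1 * (haar_density z.1 * haar_density z.2).
have mw2 : measurable_fun setT (fun z : quat R * quat R => haar_density z.1 * haar_density z.2).
  by apply: emeasurable_funM; exact: measurableT_comp.
have mi1 : measurable_fun setT (fun z : quat R * quat R => z.1^-1)%R by exact: measurableT_comp.
have mF : measurable_fun setT F.
  apply: emeasurable_funM => //; apply: emeasurable_funM; first exact: measurableT_comp.
  by apply: measurableT_comp => //; exact: measurable_quat_mul.
have mG : measurable_fun setT G.
  apply: emeasurable_funM => //; apply: emeasurable_funM; last exact: measurableT_comp.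
  by apply: measurableT_comp => //; exact: measurable_quat_mul.
have w20 (z : quat R * quat R) : 0 <= haar_density z.1 * haar_density z.2 by rewrite mule_ge0.
have F0 z : 0 <= F z by apply: mule_ge0 => //; exact: mule_ge0.
have G0 z : 0 <= G z by apply: mule_ge0 => //; exact: mule_ge0.
have mwi : measurable_fun setT (fun x : quat R => f x^-1%R * haar_density x) by exact: emeasurable_funM.
have mpw : measurable_fun setT (fun x => phi x * haar_density x) by exact: emeasurable_funM.
have mfw : measurable_fun setT (fun x => f x * haar_density x) by exact: emeasurable_funM.
transitivity (\int[qvol]_x \int[qvol]_y F (x, y)).
  rewrite muleC -ge0_integralZl//; last 2 first.
  - by move=> x _; exact: mule_ge0.
  - by apply: integral_ge0 => x _; exact: mule_ge0.
  apply: eq_integral_punctured.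
  - exact: measurable_funeM.
  - exact: measurable_fun_fubini_tonelli_F.
  - move=> x; apply: mule_ge0; last exact: mule_ge0.
    by apply: integral_ge0 => y _; exact: mule_ge0.
  - by move=> x; apply: integral_ge0.
  move=> x x0.
  have mk : measurable_fun setT (fun y : quat R => phi (y * x)%R * haar_density y).
    by apply: emeasurable_funM => //; apply: measurableT_comp => //; exact: measurable_quat_mul.
  have k0 y : 0 <= phi (y * x)%R * haar_density y by exact: mule_ge0.
  have c0 : 0 <= f x^-1%R * haar_density x by exact: mule_ge0.
  transitivity ((\int[qvol]_y (phi (y * x)%R * haar_density y)) * (f x^-1%R * haar_density x)).
    by congr (_ * _); exact/esym/haar_mulr.
  transitivity (\int[qvol]_y ((phi (y * x)%R * haar_density y) * (f x^-1%R * haar_density x))).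
    by apply/esym; exact: ge0_integralZr.
  apply: eq_integral => y _; rewrite /F /=.
  by rewrite muleACA (muleC (phi _)) (muleC (haar_density y)).
rewrite (fubini_tonelli F)//.
transitivity (\int[qvol]_y \int[qvol]_x G (x, y)).
  apply: eq_integral_punctured.
  - exact: measurable_fun_fubini_tonelli_G.
  - exact: measurable_fun_fubini_tonelli_G.
  - by move=> x; apply: integral_ge0.
  - by move=> x; apply: integral_ge0.
  move=> y y0; have yV0 : (y^-1 != 0)%R by rewrite quat_inv_eq0.
  pose h x := f (x^-1)%R * phi (y * x)%R * haar_density y.
  have mh : measurable_fun setT h.
    apply: emeasurable_funM => //; apply: emeasurable_funM => //.
    by apply: measurableT_comp => //; exact: measurable_quat_mul.
  have h0 x : 0 <= h x by apply: mule_ge0 => //; exact: mule_ge0.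
  transitivity (\int[qvol]_x (h x * haar_density x)).
    by apply: eq_integral => x _; rewrite /F /h /= -[RHS]muleA (muleC (haar_density y)).
  transitivity (\int[qvol]_x (h (y^-1 * x)%R * haar_density x)).
    by apply/esym; exact: haar_mull.
  apply: eq_integral_punctured.
  - apply: emeasurable_funM => //; apply: measurableT_comp => //; exact: measurable_quat_mul.
  - by apply: (measurable_fun_pair1 _ mG).
  - by move=> x; exact: mule_ge0.
  - by [].
  move=> x x0; rewrite /h /G /= quat_invrM// invrK mulrA quat_mulfV// mul1r.
  by rewrite -[LHS]muleA (muleC (haar_density y)).
rewrite -(fubini_tonelli G)//.
set I := \int[qvol]_x (f x * haar_density x).
have I0 : 0 <= I by apply: integral_ge0 => x _; exact: mule_ge0.
transitivity (\int[qvol]_x (I * (phi x * haar_density x))); last first.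
  by apply: ge0_integralZl => // x _; exact: mule_ge0.
apply: eq_integral_punctured.
- exact: measurable_fun_fubini_tonelli_F.
- exact: measurable_funeM.
- by move=> x; apply: integral_ge0.
- by move=> x; apply: mule_ge0 => //; exact: mule_ge0.
move=> x x0; have xV0 : (x^-1 != 0)%R by rewrite quat_inv_eq0.
have mk : measurable_fun setT (fun y : quat R => f (x^-1 * y)%R * haar_density y).
  by apply: emeasurable_funM => //; apply: measurableT_comp => //; exact: measurable_quat_mul.
have k0 y : 0 <= f (x^-1 * y)%R * haar_density y by exact: mule_ge0.
have c0 : 0 <= phi x * haar_density x by exact: mule_ge0.
rewrite /I -(haar_mull xV0 mf f0).
transitivity (\int[qvol]_y ((f (x^-1 * y)%R * haar_density y) * (phi x * haar_density x))).
  by apply: eq_integral => y _; rewrite /G /= (muleC (haar_density x)) muleACA.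
exact: ge0_integralZr.
Qed.

Lemma integral_qvol_inv f : measurable_fun setT f -> (forall x, 0 <= f x) ->
  \int[qvol]_x f x = \int[qvol]_x (f (x^-1)%R * (`|x| ^- 8)%:E).
Proof.
move=> mf f0; have mw := measurable_haar_density; have w0 := haar_density_ge0.
have mn : measurable_fun setT (fun x : quat R => (`|x| ^+ 4)%:E).
  apply/measurable_EFinP; under eq_fun do rewrite (exprM _ 2 2) qnorm_sqr.
  apply: measurable_funX; apply: (continuous_measurable_quat_real openT) => z _.
  exact: (C1on_continuous (C1on_qnormsq openT (C1on_id _))).
have n0 (x : quat R) : 0 <= (`|x| ^+ 4)%:E by rewrite lee_fin exprn_ge0.
pose g (x : quat R) := f x * (`|x| ^+ 4)%:E.
have mg : measurable_fun setT g by exact: emeasurable_funM.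
have g0 x : 0 <= g x by exact: mule_ge0.
transitivity (\int[qvol]_x (g x * haar_density x)).
  apply: eq_integral_punctured => //; first exact: emeasurable_funM.
    by move=> x; exact: mule_ge0.
  by move=> x x0; rewrite /g -muleA haar_density_unit// mule1.
rewrite -(haar_inv mg g0); apply: eq_integral => x _.
rewrite /g /haar_density -muleA qnormV -EFinM; congr (_ * _%:E).
by rewrite exprVn -invfM -exprD.
Qed.

End inversion.

Section moebius_change_of_variables.
Context {R : realType}.
Variables (a b c d : quat R).
Hypothesis Hc0 : c = 0 -> a * d <> 0.
Hypothesis Hc1 : c <> 0 -> b - a * c^-1 * d <> 0.
Implicit Types (z w : quat R).
Local Notation T := (moebius a b c d).
Local Notation beta := (beta a b c d).
Local Notation y := (ycoef a b c d).
Local Notation regular_points := (regular_points c d).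

(** The Jacobian determinant of the transformation is the product of the weight
    [rho_T] and the squared conformal factor: this identity is what makes
    [J_T] isometric. *)
Definition jacobian z : R := rho_T a b c d z * `|C_T a b c d z| ^+ 2.

Lemma jacobian_ge0 z : 0 <= jacobian z.
Proof.
by rewrite /jacobian /rho_T mulr_ge0 ?sqr_ge0//; case: ifP.
Qed.

Lemma rho_T_gt0 z : regular_points z -> 0 < rho_T a b c d z.
Proof.
move=> cd0; rewrite /rho_T; case: (eqVneq c 0) => // c0.
by rewrite invr_gt0 exprn_gt0// normr_gt0 (ycoef_eq0 Hc1).
Qed.

Lemma jacobian_affine z : c = 0 -> jacobian z = `|a| ^+ 4 * `|d^-1| ^+ 4.
Proof.
move=> c0; have [a0 d0] := ad_neq0 Hc0 c0.
rewrite /jacobian /rho_T /C_T c0 eqxx mul1r normrZ qnormV !ger0_norm.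
  have := d0; rewrite -normr_eq0; move: `|a| `|d| => s t t0.
  by field.
by rewrite divr_ge0// sqr_ge0.
Qed.

Lemma jacobian_inversion z : c != 0 ->
  jacobian z = `|c| ^+ 4 * `|beta^-1| ^+ 4 * `|y z| ^- 8.
Proof.
move=> c0; have b0 := beta_neq0 Hc1 c0.
rewrite /jacobian /rho_T /C_T (negbTE c0) (normrZ (`|c| ^+ 2 / _)) qnormM (normrZ (`|y z| ^- 4)) !qnormV qnorm_conj.
rewrite (@ger0_norm _ (_ / _)); last by rewrite divr_ge0// sqr_ge0.
rewrite (@ger0_norm _ (_ ^- 4)); last by rewrite invr_ge0 exprn_ge0.
have [->|y0] := eqVneq (y z) 0.
  by rewrite normr0 !expr0n /= !invr0 !mulr0 mul0r.
have ny : `|y z| != 0 by rewrite normr_eq0.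
rewrite -!exprVn (exprSr _ 3) mulfVK//.
by move: `|c| `|beta|^-1 `|y z|^-1 => r s t; ring.
Qed.

Lemma measurable_moebius : measurable_fun setT T.
Proof.
apply: measurable_quat_mul => //.
  apply: measurable_quat_add => //; exact: measurable_quat_mul.
apply: measurableT_comp; first exact: measurable_qinv.
by apply: measurable_quat_add => //; exact: measurable_quat_mul.
Qed.

Local Open Scope ereal_scope.

Lemma integral_moebius (h : quat R -> \bar R) : measurable_fun setT h ->
  (forall x, 0 <= h x) ->
  \int[qvol]_x h x = \int[qvol]_z (h (T z) * (jacobian z)%:E).
Proof.
move=> mh h0; have [c0|c0] := eqVneq c 0%R.
  have [a0 d0] := ad_neq0 Hc0 c0.
  have dV0 : (d^-1 != 0)%R by rewrite quat_inv_eq0.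
  transitivity (\int[qvol]_z ((`|a| ^+ 4 * `|d^-1| ^+ 4)%:E * h (a * z * d^-1 + b * d^-1)%R)).
    rewrite ge0_integralZl//; last first.
      apply: (measurableT_comp mh); apply: measurable_quat_add => //.
      by do 2 apply: measurable_quat_mul => //.
    rewrite integral_qvol_affine// muleA -EFinM mulrACA !divff ?mulr1 ?mul1e//.
      by rewrite expf_neq0// normr_eq0.
    by rewrite expf_neq0// normr_eq0.
  by apply: eq_integral => z _; rewrite (moebius_affine _ _ _ _ c0) jacobian_affine// muleC.
have b0 := beta_neq0 Hc1 c0; have bV0 : (beta^-1 != 0)%R by rewrite quat_inv_eq0.
pose F (x : quat R) : \bar R := h (x^-1 + a * c^-1)%R * (`|x| ^- 8)%:E.
have mn : measurable_fun setT (fun x : quat R => (`|x| ^- 8)%:E).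
  have mw := @measurable_haar_density R.
  rewrite (_ : (fun x => _) = (fun z => haar_density z * haar_density z)); last first.
    by apply/funext => z; rewrite -EFinM -invfM -exprD.
  exact: emeasurable_funM.
have mF : measurable_fun setT F.
  apply: emeasurable_funM => //; apply: measurableT_comp => //.
  by apply: measurable_quat_add => //; exact: measurable_qinv.
have F0 x : 0 <= F x by rewrite mule_ge0// lee_fin invr_ge0 exprn_ge0.
transitivity (\int[qvol]_x F x).
  rewrite -(integral_qvol_addr (a * c^-1)%R mh h0) integral_qvol_inv//.
  by apply: measurableT_comp => //; exact: measurable_quat_add.
transitivity (\int[qvol]_z ((`|c| ^+ 4 * `|beta^-1| ^+ 4)%:E * F (c * z * beta^-1 + d * beta^-1)%R)).
  rewrite ge0_integralZl//; last first.
    apply: (measurableT_comp mF); apply: measurable_quat_add => //.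
    by do 2 apply: measurable_quat_mul => //.
  rewrite integral_qvol_affine// muleA -EFinM mulrACA !divff ?mulr1 ?mul1e//.
    by rewrite expf_neq0// normr_eq0.
  by rewrite expf_neq0// normr_eq0.
apply: eq_integral => z _; rewrite /F -/(y z) jacobian_inversion// muleCA -EFinM.
have [y0|y0] := eqVneq (y z) 0%R.
  by rewrite y0 normr0 expr0n /= !invr0 mulr0 !mule0.
congr (h _ * _); rewrite (moebius_inversion Hc1 c0) 1?addrC//.
by rewrite addrC -(ycoef_eq0 Hc1).
Qed.

Section on_domains.
Variables (Xi Omega : set (quat R)).
Hypothesis mXi : measurable Xi.
Hypothesis mOmega : measurable Omega.
Hypothesis Xi_regular : forall z, Xi z -> (c * z + d)%R <> 0%R.
Hypothesis TXi : T @` Xi = Omega.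

Lemma moebius_preimage z : regular_points z -> Omega (T z) <-> Xi z.
Proof.
move=> rz; rewrite -TXi; split=> [[w Xw]|Xz]; last by exists z.
by move=> /(moebius_inj Hc0 Hc1) <-//; apply/eqP; exact: Xi_regular.
Qed.

Lemma integral_moebius_on (h : quat R -> \bar R) : measurable_fun Omega h ->
  (forall x, Omega x -> 0 <= h x) ->
  \int[qvol]_(x in Omega) h x = \int[qvol]_(z in Xi) (h (T z) * (jacobian z)%:E).
Proof.
move=> mh h0; rewrite integral_mkcond [RHS]integral_mkcond.
have mhp : measurable_fun setT (h \_ Omega) by exact: (measurable_restrictT _ mOmega).1.
have h0p x : 0 <= (h \_ Omega) x by exact: erestrict_ge0.
(* At a pole [T] takes a junk value, possibly in [Omega]; there [jacobian] is 0. *)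
rewrite integral_moebius//; apply: eq_integral => z _; rewrite !patchE.
have [rz|] := pselect (regular_points z).
  have E := moebius_preimage rz.
  case: ifPn; rewrite ?inE ?notin_setE => Tz; case: ifPn; rewrite ?inE ?notin_setE => Xz //.
  - by case: Xz; exact/E.
  - by case: Tz; exact/E.
  - by rewrite mul0e.
move=> /negP; rewrite negbK => /eqP s0.
have -> : z \in Xi = false by apply/negbTE; rewrite notin_setE => /Xi_regular.
have -> : jacobian z = 0%R.
  have [c0|c0] := eqVneq c 0%R.
    have [_ d0] := ad_neq0 Hc0 c0.
    by move: s0; rewrite c0 mul0r add0r => /eqP; rewrite (negbTE d0).
  rewrite jacobian_inversion// ycoefE s0 mul0r normr0 expr0n /= invr0 mulr0//.
by rewrite mule0.
Qed.

Lemma integral_moebius_signed (h : quat R -> \bar R) : measurable_fun Omega h ->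
  \int[qvol]_(x in Omega) h x = \int[qvol]_(z in Xi) (h (T z) * (jacobian z)%:E).
Proof.
move=> mh; rewrite integralE [RHS]integralE.
rewrite integral_moebius_on//; last exact: measurable_funepos.
rewrite (integral_moebius_on (h := h^\-))//; last exact: measurable_funeneg.
congr (_ - _); apply: eq_integral => z _; rewrite ?funeposE ?funenegE /=.
- by rewrite muleC maxe_pMr// ?mule0 ?(muleC (h _))// lee_fin jacobian_ge0.
- by rewrite muleC maxe_pMr ?mule0 ?muleN ?(muleC (h _))// lee_fin jacobian_ge0.
Qed.

End on_domains.
End moebius_change_of_variables.

(** * Quaternion-valued integrals *)

Section quaternionic_integral.
Context {R : realType}.
Variable D : set (quat R).
Hypothesis mD : measurable D.
Implicit Types (f g : quat R -> R) (F G : quat R -> quat R) (q : quat R).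

(** Real integrability is stated for the extended-real function; [qintegrable] is
    its componentwise version. *)
Definition rintegrable f := (@qvol R).-integrable D (EFin \o f).

Lemma rintegrable_eq f g : {in D, f =1 g} -> rintegrable f -> rintegrable g.
Proof. by move=> fg; apply: eq_integrable => // x xD; rewrite /= fg. Qed.

Lemma rintegrableD f g : rintegrable f -> rintegrable g -> rintegrable (fun x => f x + g x).
Proof. by move=> hf hg; have := integrableD mD hf hg. Qed.

Lemma rintegrableZ s f : rintegrable f -> rintegrable (fun x => s * f x).
Proof. by move=> hf; have := integrableZl mD s hf. Qed.

Lemma rintegrable_lin4 (c0 c1 c2 c3 : R) f0 f1 f2 f3 :
  rintegrable f0 -> rintegrable f1 -> rintegrable f2 -> rintegrable f3 ->
  rintegrable (fun x => c0 * f0 x + c1 * f1 x + c2 * f2 x + c3 * f3 x).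
Proof.
by move=> h0 h1 h2 h3; do 3 (apply: rintegrableD; last exact: rintegrableZ);
  exact: rintegrableZ.
Qed.

Lemma Rintegral_lin4 (c0 c1 c2 c3 : R) f0 f1 f2 f3 :
  rintegrable f0 -> rintegrable f1 -> rintegrable f2 -> rintegrable f3 ->
  \int[qvol]_(x in D) (c0 * f0 x + c1 * f1 x + c2 * f2 x + c3 * f3 x) =
  c0 * (\int[qvol]_(x in D) f0 x) + c1 * (\int[qvol]_(x in D) f1 x) +
  c2 * (\int[qvol]_(x in D) f2 x) + c3 * (\int[qvol]_(x in D) f3 x).
Proof.
move=> h0 h1 h2 h3.
have z0 := rintegrableZ c0 h0; have z1 := rintegrableZ c1 h1.
have z2 := rintegrableZ c2 h2; have z3 := rintegrableZ c3 h3.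
have d1 := rintegrableD z0 z1; have d2 := rintegrableD d1 z2.
rewrite (RintegralD mD d2 z3) (RintegralD mD d1 z2) (RintegralD mD z0 z1).
by rewrite (RintegralZl c0 mD h0) (RintegralZl c1 mD h1) (RintegralZl c2 mD h2) (RintegralZl c3 mD h3).
Qed.

Definition qintegrable F := [/\ rintegrable (fun x => qre (F x)),
  rintegrable (fun x => qi (F x)), rintegrable (fun x => qj (F x)) &
  rintegrable (fun x => qk (F x))].

Lemma eq_qintegral F G : {in D, F =1 G} -> qintegral D F = qintegral D G.
Proof. by move=> FG; congr Quat; apply: eq_Rintegral => x xD; rewrite FG. Qed.

Lemma qintegralD F G : qintegrable F -> qintegrable G ->
  qintegral D (fun x => F x + G x) = qintegral D F + qintegral D G.
Proof.
move=> [f0 f1 f2 f3] [g0 g1 g2 g3]; congr Quat => /=.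
- exact: (RintegralD mD f0 g0).
- exact: (RintegralD mD f1 g1).
- exact: (RintegralD mD f2 g2).
- exact: (RintegralD mD f3 g3).
Qed.

Lemma qintegrableD F G : qintegrable F -> qintegrable G ->
  qintegrable (fun x => F x + G x).
Proof.
by move=> [f0 f1 f2 f3] [g0 g1 g2 g3]; split; exact: rintegrableD.
Qed.

Lemma eq_lin4_integral (h f0 f1 f2 f3 : quat R -> R) c0 c1 c2 c3 r :
  rintegrable f0 -> rintegrable f1 -> rintegrable f2 -> rintegrable f3 ->
  (forall x, h x = c0 * f0 x + c1 * f1 x + c2 * f2 x + c3 * f3 x) ->
  c0 * (\int[qvol]_(x in D) f0 x) + c1 * (\int[qvol]_(x in D) f1 x) +
  c2 * (\int[qvol]_(x in D) f2 x) + c3 * (\int[qvol]_(x in D) f3 x) = r ->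
  \int[qvol]_(x in D) h x = r.
Proof.
move=> h0 h1 h2 h3 E <-; rewrite -Rintegral_lin4//.
by apply: eq_Rintegral => x _; exact: E.
Qed.

Lemma qintegralMl q F : qintegrable F ->
  qintegral D (fun x => q * F x) = q * qintegral D F.
Proof.
move=> [f0 f1 f2 f3]; congr Quat => /=.
- by apply: (eq_lin4_integral (c0 := qre q) (c1 := - qi q) (c2 := - qj q) (c3 := - qk q)
    f0 f1 f2 f3) => [x|]; ring.
- by apply: (eq_lin4_integral (c0 := qi q) (c1 := qre q) (c2 := - qk q) (c3 := qj q)
    f0 f1 f2 f3) => [x|]; ring.
- by apply: (eq_lin4_integral (c0 := qj q) (c1 := qk q) (c2 := qre q) (c3 := - qi q)
    f0 f1 f2 f3) => [x|]; ring.
- by apply: (eq_lin4_integral (c0 := qk q) (c1 := - qj q) (c2 := qi q) (c3 := qre q)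
    f0 f1 f2 f3) => [x|]; ring.
Qed.

Lemma qintegralMr q F : qintegrable F ->
  qintegral D (fun x => F x * q) = qintegral D F * q.
Proof.
move=> [f0 f1 f2 f3]; congr Quat => /=.
- by apply: (eq_lin4_integral (c0 := qre q) (c1 := - qi q) (c2 := - qj q) (c3 := - qk q)
    f0 f1 f2 f3) => [x|]; ring.
- by apply: (eq_lin4_integral (c0 := qi q) (c1 := qre q) (c2 := qk q) (c3 := - qj q)
    f0 f1 f2 f3) => [x|]; ring.
- by apply: (eq_lin4_integral (c0 := qj q) (c1 := - qk q) (c2 := qre q) (c3 := qi q)
    f0 f1 f2 f3) => [x|]; ring.
- by apply: (eq_lin4_integral (c0 := qk q) (c1 := qj q) (c2 := - qi q) (c3 := qre q)
    f0 f1 f2 f3) => [x|]; ring.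
Qed.

Lemma qintegral_conj F : qintegrable F ->
  qintegral D (fun x => qconj (F x)) = qconj (qintegral D F).
Proof.
move=> [f0 f1 f2 f3].
have N f : rintegrable f -> \int[qvol]_(x in D) (- f x) = - \int[qvol]_(x in D) f x.
  move=> hf; rewrite -mulN1r -(RintegralZl (-1) mD hf).
  by apply: eq_Rintegral => x _; rewrite mulN1r.
by congr Quat => /=; exact: N.
Qed.

Lemma qintegrableMl q F : qintegrable F -> qintegrable (fun x => q * F x).
Proof.
move=> [f0 f1 f2 f3]; split.
- apply: (rintegrable_eq _ (rintegrable_lin4 (qre q) (- qi q) (- qj q) (- qk q) f0 f1 f2 f3)) => x _ /=; ring.
- apply: (rintegrable_eq _ (rintegrable_lin4 (qi q) (qre q) (- qk q) (qj q) f0 f1 f2 f3)) => x _ /=; ring.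
- apply: (rintegrable_eq _ (rintegrable_lin4 (qj q) (qk q) (qre q) (- qi q) f0 f1 f2 f3)) => x _ /=; ring.
- apply: (rintegrable_eq _ (rintegrable_lin4 (qk q) (- qj q) (qi q) (qre q) f0 f1 f2 f3)) => x _ /=; ring.
Qed.

Lemma qintegrable_dominated F g : measurable_fun D F -> rintegrable g ->
  (forall x, D x -> `|F x| <= g x) -> qintegrable F.
Proof.
move=> /measurable_fun_quatP[m0 m1 m2 m3] ig Fg.
have K (l : quat R -> R) : measurable_fun D (fun x => l (F x)) ->
    (forall q, `|l q| <= `|q|) -> rintegrable (fun x => l (F x)).
  move=> ml ll; apply: (le_integrable mD _ _ ig); first exact/measurable_EFinP.
  move=> x Dx; rewrite /= lee_fin; apply: (le_trans (ll _)); apply: (le_trans (Fg x Dx)).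
  exact: ler_norm.
split.
- exact: K m0 (@ler_norm_qre R).
- exact: K m1 (@ler_norm_qi R).
- exact: K m2 (@ler_norm_qj R).
- exact: K m3 (@ler_norm_qk R).
Qed.

Lemma rintegrable_bounded f (M : R) : (qvol D < +oo)%E -> measurable_fun D f ->
  (forall x, D x -> `|f x| <= M) -> rintegrable f.
Proof.
move=> Doo mf fM; apply: measurable_bounded_integrable => //.
exists M; split; first exact: num_real.
by move=> r Mr x Dx /=; apply: (le_trans (fM x Dx)); exact: ltW.
Qed.

End quaternionic_integral.

(** * Compact balls and the bump function *)

Lemma lipschitz_const_continuous {R : realType} (V W : normedModType R)
    (f : V -> W) (C : R) :
  (forall p q, `|f p - f q| <= C * `|p - q|) -> continuous f.
Proof.
move=> h z; apply/cvgrPdist_lt => e e0.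
have C1 : 0 < `|C| + 1 by rewrite ltr_wpDl.
have d0 : 0 < e / (`|C| + 1) by rewrite divr_gt0.
near=> w; apply: (le_lt_trans (h _ _)).
apply: (@le_lt_trans _ _ ((`|C| + 1) * `|z - w|)).
  by rewrite ler_wpM2r// (le_trans (ler_norm C))// lerDl.
by rewrite mulrC -ltr_pdivlMr//; near: w; exact: cvgr_dist_lt.
Unshelve. all: by end_near. Qed.

Lemma continuousM_at {R : realType} (V : normedModType R) (f g : V -> R) z :
  {for z, continuous f} -> {for z, continuous g} ->
  {for z, continuous (fun w => f w * g w)}.
Proof. by move=> cf cg; apply: cvgM. Qed.

Lemma continuous_cst_at {R : realType} (V W : normedModType R) (a : W) (z : V) :
  {for z, continuous (fun=> a)}.
Proof. exact: cvg_cst. Qed.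

(** A second-order Taylor estimate identifies the differential. *)
Lemma quadratic_diff {R : realType} (V W : normedModType R) (F : V -> W)
    (L : {linear V -> W}) z (C delta : R) : 0 < delta -> continuous L ->
  (forall h, `|h| < delta -> `|F (h + z) - F z - L h| <= C * `|h| ^+ 2) ->
  differentiable F z /\ 'd F z = L :> (V -> W).
Proof.
move=> delta0 cL hF.
have E : F \o shift z = cst (F z) + L +o_ 0 id.
  apply/eqaddoP => e e0; near=> h.
  rewrite !fctE /= opprD addrA; apply: (le_trans (hF h _)).
    by near: h; apply: nbhs0_lt.
  rewrite expr2 mulrA ler_wpM2r//.
  have /ltW : `|h| < e / (`|C| + 1).
    by near: h; apply: nbhs0_lt; rewrite divr_gt0// ltr_wpDl.
  rewrite ler_pdivlMr ?ltr_wpDl// mulrDr mulr1 => h1.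
  apply: le_trans h1; rewrite mulrC (@le_trans _ _ (`|h| * `|C|))//.
    by rewrite ler_wpM2l// ler_norm.
  by rewrite lerDl.
have EL := diff_unique cL E.
by split=> //; apply/diff_locallyP; rewrite EL.
Unshelve. all: by end_near. Qed.

Section closed_balls.
Context {R : realType}.
Implicit Types (z w : quat R) (r : R).

Lemma quat_of_prod_continuous : continuous (@quat_of_prod R).
Proof.
have cf (X Y : topologicalType) : continuous (@fst X Y) by move=> p; exact: cvg_fst.
have cs (X Y : topologicalType) : continuous (@snd X Y) by move=> p; exact: cvg_snd.
have cc (X Y Z : topologicalType) (f : X -> Y) (g : Y -> Z) :
    continuous f -> continuous g -> continuous (g \o f).
  by move=> hf hg p; apply: continuous_comp; [exact: hf|exact: hg].
move=> x; apply: cvg_quat.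
- exact: (cc _ _ _ _ _ (cc _ _ _ _ _ (cf _ _) (cf _ _)) (cf _ _) x).
- exact: (cc _ _ _ _ _ (cc _ _ _ _ _ (cf _ _) (cf _ _)) (cs _ _) x).
- exact: (cc _ _ _ _ _ (cf _ _) (cs _ _) x).
- exact: (cs _ _ x).
Qed.

(** A closed ball is a closed subset of the image of a product of segments. *)
Lemma compact_cball z r : compact [set w | `|z - w| <= r].
Proof.
pose I (s : R) : set R := `[s - r, s + r]%classic.
apply: (@subclosed_compact _ _ (@quat_of_prod R @` (I (qre z) `*` I (qi z) `*` I (qj z) `*` I (qk z)))).
- rewrite (_ : [set w | _] = (fun w => `|z - w|) @^-1` [set x | x <= r])//.
  apply: closed_comp; last exact: closed_le.
  move=> w _; apply: (@lipschitz_continuous R (quat R) R (fun w => `|z - w|)) => p q.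
  apply: (le_trans (ler_dist_dist _ _)).
  by rewrite opprB addrC addrA subrK distrC.
- apply: continuous_compact; first exact: continuous_subspaceT quat_of_prod_continuous.
  by do 3 (apply: compact_setX; last exact: segment_compact); exact: segment_compact.
- move=> w /= zw; exists (prod_of_quat w); last exact: prod_of_quatK.
  have H (l : quat R -> R) : (forall q, `|l q| <= `|q|) -> l (z - w) = l z - l w -> I (l z) (l w).
    move=> ll E; rewrite /I /= in_itv /= -ler_distlC -E.
    exact: le_trans zw.
  split; [split; [split|]|]; rewrite /prod_of_quat /=; apply: H => //.
  - exact: ler_norm_qre.
  - exact: ler_norm_qi.
  - exact: ler_norm_qj.
  - exact: ler_norm_qk.
Qed.

Lemma bounded_on_cball (f : quat R -> R) z r :
  (forall w, `|z - w| <= r -> {for w, continuous f}) ->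
  exists2 M, 0 <= M & forall w, `|z - w| <= r -> `|f w| <= M.
Proof.
move=> cf; have cK := @compact_cball z r.
have cfK : {within [set w | `|z - w| <= r], continuous f}.
  by apply: continuous_in_subspaceT => w; rewrite inE => /cf.
have [M [_ hM]] := compact_bounded (continuous_compact cfK cK).
exists (`|M| + 1); first by rewrite addr_ge0.
move=> w zw; apply: (hM (`|M| + 1)); last by exists w.
by rewrite (le_lt_trans (ler_norm M))// ltrDl.
Qed.

Lemma open_contains_cball (U : set (quat R)) z : open U -> U z ->
  exists2 r, 0 < r & forall w, `|z - w| <= r -> U w.
Proof.
move=> oU Uz; have /nbhs_ballP[e /= e0 eU] : nbhs z U by exact: open_nbhs_nbhs.
exists (e / 2); first by rewrite divr_gt0.
move=> w zw; apply: eU; rewrite -ball_normE /=; apply: (le_lt_trans zw).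
by rewrite ltr_pdivrMr// ltr_pMr// ltr1n.
Qed.

End closed_balls.

Section bump_function.
Context {R : realType}.
Implicit Types (x v w h : quat R) (s t : R).

Definition pos_part s : R := Num.max 0 s.

Lemma pos_part_ge0 s : 0 <= pos_part s.
Proof. by rewrite le_max lexx. Qed.

Lemma pos_part_taylor s t :
  `|pos_part t ^+ 2 - pos_part s ^+ 2 - 2 * pos_part s * (t - s)| <= (t - s) ^+ 2.
Proof.
have := sqr_ge0 s; have := sqr_ge0 t; have := sqr_ge0 (t - s); rewrite !expr2.
rewrite /pos_part ler_norml; have [s0|s0] := leP 0 s; have [t0|t0] := leP 0 t => h1 h2 h3.
- by apply/andP; split; lra.
- have h : 0 <= s * - t by apply: mulr_ge0 => //; lra.
  by apply/andP; split; lra.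
- have h : 0 <= t * - s by apply: mulr_ge0 => //; lra.
  by apply/andP; split; lra.
- by apply/andP; split; lra.
Qed.

Lemma pos_part_lipschitz s t : `|pos_part s - pos_part t| <= `|s - t|.
Proof.
rewrite /pos_part ler_norml; have := ler_norm (s - t); have := ler_norm (t - s).
rewrite (distrC t); have [s0|s0] := leP 0 s; have [t0|t0] := leP 0 t => a b;
  apply/andP; split; lra.
Qed.

(** The radial bump [(1 - |x|^2)_+^2], supported in the unit ball. Its gradient
    [-4 (1 - |x|^2)_+ x = bump' x x] is locally Lipschitz, and convolutions with
    it are [C1]. *)
Definition bump x : R := pos_part (1 - qnormsq x) ^+ 2.
Definition bump' x : R := -4 * pos_part (1 - qnormsq x).

Lemma qdotC v w : qdot v w = qdot w v.
Proof. by rewrite /qdot; ring. Qed.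

Lemma qdot_is_linear v : linear (qdot v).
Proof. by move=> s p q; rewrite /qdot /= /GRing.scale /=; ring. Qed.

Lemma qdot_norm v w : `|qdot v w| <= `|v| * `|w|.
Proof.
rewrite -(@ler_pXn2r _ 2) ?nnegrE ?mulr_ge0// exprMn !qnorm_sqr real_normK ?num_real//.
rewrite -subr_ge0 /qdot /qnormsq.
set D := (X in 0 <= X).
have -> : D = (qre v * qi w - qi v * qre w) ^+ 2
  + (qre v * qj w - qj v * qre w) ^+ 2 + (qre v * qk w - qk v * qre w) ^+ 2
  + (qi v * qj w - qj v * qi w) ^+ 2 + (qi v * qk w - qk v * qi w) ^+ 2
  + (qj v * qk w - qk v * qj w) ^+ 2 by rewrite /D; ring.
by rewrite !addr_ge0 ?sqr_ge0.
Qed.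

Lemma qnormsqD x h : qnormsq (x + h) = qnormsq x + 2 * qdot x h + qnormsq h.
Proof. by rewrite /qnormsq /qdot /=; ring. Qed.

Lemma bump_ge0 x : 0 <= bump x. Proof. exact: sqr_ge0. Qed.

Lemma bump_eq0 x : 1 <= `|x| -> bump x = 0 /\ bump' x = 0.
Proof.
move=> x1; have : 1 - qnormsq x <= 0.
  by rewrite subr_le0 -qnorm_sqr; rewrite -(expr1n _ 2) ler_pXn2r// nnegrE.
by rewrite /bump /bump' /pos_part => h; rewrite max_l// expr0n mulr0.
Qed.

Lemma bump_taylor (A : R) x h : 0 <= A -> `|x| <= A -> `|h| < 1 ->
  `|bump (h + x) - bump x - bump' x * qdot x h| <= ((2 * A + 1) ^+ 2 + 2) * `|h| ^+ 2.
Proof.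
move=> A0 xA h1.
have := pos_part_taylor (1 - qnormsq x) (1 - qnormsq (h + x)).
rewrite /bump /bump' (addrC h) qnormsqD -[qnormsq h]qnorm_sqr.
set n := `|h| in h1 *; have n0 : 0 <= n by exact: normr_ge0.
set t := 1 - (_ + _ + _); set s := 1 - qnormsq x; set D := qdot x h.
have ts : t - s = - 2 * D - n ^+ 2 by rewrite /t /s -/D; ring.
have DA : `|D| <= A * n.
  by apply: (le_trans (qdot_norm _ _)); rewrite ler_wpM2r.
have p0 : 0 <= pos_part s := pos_part_ge0 s.
have p1 : pos_part s <= 1.
  by rewrite /pos_part ge_max ler01 /= /s lerBlDr lerDl qnormsq_ge0.
move: (pos_part t ^+ 2) (pos_part s) p0 p1 => P p p0 p1; rewrite ts => hP.
rewrite (_ : P - p ^+ 2 - -4 * p * D = (P - p ^+ 2 - 2 * p * (-2 * D - n ^+ 2)) - 2 * p * n ^+ 2); last by ring.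
apply: (le_trans (ler_normB _ _)); rewrite [leRHS]mulrDl; apply: lerD.
  apply: (le_trans hP); rewrite -exprMn -[X in X <= _]real_normK ?num_real//.
  rewrite ler_pXn2r ?nnegrE// ?mulr_ge0 ?addr_ge0 ?mulr_ge0//.
  apply: (le_trans (ler_normB _ _)); rewrite normrM normrN [leRHS]mulrDl mul1r.
  apply: lerD; first by rewrite (@ger0_norm _ 2)// -mulrA ler_wpM2l.
  by rewrite ger0_norm ?sqr_ge0// expr2 ler_piMr// ltW.
rewrite ger0_norm ?mulr_ge0 ?sqr_ge0//.
by rewrite ler_wpM2r ?sqr_ge0// ler_piMr.
Qed.

Lemma qdot_continuous v : continuous (qdot v).
Proof.
apply: (@lipschitz_const_continuous R (quat R) R (qdot v) `|v|) => p q.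
by rewrite (_ : qdot v p - qdot v q = qdot v (p - q)) ?qdot_norm// /qdot /=; ring.
Qed.

Lemma bump_diff x : differentiable bump x /\ forall v, 'D_v bump x = bump' x * qdot x v.
Proof.
pose L (h : quat R) : R := bump' x * qdot x h.
have lL : linear L by move=> s p q; rewrite /L /qdot /= /GRing.scale /=; ring.
pose LM := GRing.isLinear.Build _ _ _ _ _ lL.
pose LL : {linear quat R -> R} := HB.pack L LM.
have cL : continuous LL.
  move=> z; exact: (@continuousM_at R (quat R) (fun=> bump' x) (qdot x) z
    (@continuous_cst_at R _ R _ z) (@qdot_continuous x z)).
have [db E] := @quadratic_diff R (quat R) R bump LL x _ 1 ltr01 cL
  (fun h => @bump_taylor `|x| x h (normr_ge0 x) (lexx _)).
by split=> // v; rewrite deriveE// E.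
Qed.

Lemma bump'_continuous : continuous bump'.
Proof.
move=> z; apply: (@continuousM_at R (quat R) (fun=> -4)
  (fun w => pos_part (1 - qnormsq w)) z); first exact: continuous_cst_at.
apply: (@continuous_comp_at R (quat R) R R (fun x => 1 - qnormsq x) pos_part).
  have C := C1on_qnormsq openT (C1on_id (R := R) setT).
  have := @C1on_continuous R (quat R) R setT _ z
    (C1onD openT (@C1on_cst R (quat R) R setT 1) (C1onN openT C)) I.
  exact.
exact: (lipschitz_continuous pos_part_lipschitz).
Qed.

Lemma C1on_bump U : C1on U bump.
Proof.
split=> [z _|v z _]; first exact: (bump_diff z).1.
rewrite (_ : (fun w => 'D_v bump w) = fun w => bump' w * qdot v w).
  by apply: (@continuousM_at R (quat R) bump' (qdot v) z); [exact: bump'_continuous|exact: qdot_continuous].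
by apply/funext => w; rewrite (bump_diff w).2 qdotC.
Qed.

End bump_function.

(** * Integration by parts and the mean value property *)

Section integration_by_parts.
Context {R : realType}.
Implicit Types (x v w z p : quat R) (s t : R) (U V : set (quat R)).

Lemma integral_qvol_similarity s p (f : quat R -> \bar R) : 0 < s -> measurable_fun setT f ->
  (\int[qvol]_x f x = \int[qvol]_x (f (s *: x + p)%R * (s ^+ 4)%:E))%E.
Proof.
move=> s0 mf.
have H0 : (0 : quat R) = 0 -> s%:A * 1 <> 0 :> quat R.
  by rewrite mulr1 => _ /eqP; rewrite scaler_eq0 oner_eq0 orbF gt_eqF.
have H1 : (0 : quat R) <> 0 -> p - s%:A * 0^-1 * 1 <> 0 by [].
have TE x : moebius s%:A p 0 1 x = s *: x + p.
  by rewrite /moebius mul0r add0r invr1 mulr1 -scalerAl mul1r.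
have Tsurj : moebius s%:A p 0 1 @` setT = setT.
  apply/seteqP; split=> // x _; exists (s^-1 *: (x - p)) => //.
  by rewrite TE scalerA divff ?gt_eqF// scale1r subrK.
have reg x : [set: quat R] x -> 0 * x + 1 <> 0 :> quat R.
  by move=> _; rewrite mul0r add0r; exact/eqP/oner_neq0.
rewrite (@integral_moebius_signed R _ _ _ _ H0 H1 setT setT measurableT reg Tsurj)//.
apply: eq_integral => x _; rewrite TE; congr (_ * _%:E)%E.
by rewrite jacobian_affine// invr1 qnorm1 expr1n mulr1 normrZ qnorm1 mulr1 gtr0_norm.
Qed.

Lemma Rintegral_qvol_similarity s p (f : quat R -> R) : 0 < s -> measurable_fun setT f ->
  \int[qvol]_x f x = \int[qvol]_x (f (s *: x + p) * s ^+ 4).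
Proof.
move=> s0 mf; rewrite /Rintegral (integral_qvol_similarity p s0)//.
exact/measurable_EFinP.
Qed.

Lemma Rintegral_qvol_addr p (f : quat R -> R) : measurable_fun setT f ->
  \int[qvol]_x f (x + p) = \int[qvol]_x f x.
Proof.
move=> mf; rewrite [RHS](Rintegral_qvol_similarity p ltr01 mf).
by apply: eq_Rintegral => x _; rewrite scale1r expr1n mulr1.
Qed.

Lemma Rintegral_support (A B : set (quat R)) (f : quat R -> R) : A `<=` B ->
  (forall x, B x -> ~ A x -> f x = 0) ->
  \int[qvol]_(x in A) f x = \int[qvol]_(x in B) f x.
Proof.
move=> AB f0; rewrite Rintegral_mkcond [RHS]Rintegral_mkcond; apply: eq_Rintegral => x _.
rewrite !patchE; case: ifPn; rewrite ?inE ?notin_setE => Ax.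
  by rewrite ifT// inE; exact: AB.
by case: ifPn => //; rewrite inE => Bx; rewrite f0.
Qed.

Lemma derive_line (W : normedModType R) (h : quat R -> W) x v t :
  'D_1 (fun s => h (x + s *: v)) t = 'D_v h (x + t *: v) /\
  (derivable h (x + t *: v) v -> derivable (fun s => h (x + s *: v)) t 1).
Proof.
have E : (fun s : R => s^-1 *: (((fun s => h (x + s *: v)) \o shift t) (s *: 1) - h (x + t *: v))) =
    (fun s => s^-1 *: ((h \o shift (x + t *: v)) (s *: v) - h (x + t *: v))).
  apply/funext => s /=; congr (_ *: (h _ - _)).
  rewrite (_ : s *: 1 = s); last exact: mulr1.
  by rewrite scalerDl addrCA.
by split; [rewrite /derive E|rewrite /derivable E].
Qed.

Lemma ball_lt x (r : R) : ball (0 : quat R) r x <-> `|x| < r.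
Proof. by rewrite -ball_normE /= sub0r normrN. Qed.

Lemma rintegrable_cball (f : quat R -> R) (r : R) : 0 < r ->
  (forall x, `|x| <= r -> {for x, continuous f}) ->
  rintegrable (ball (0 : quat R) r) f.
Proof.
move=> r0 cf; have cf0 x : `|0 - x| <= r -> {for x, continuous f} by rewrite sub0r normrN; exact: cf.
have [M M0 hM] := bounded_on_cball cf0.
apply: (@rintegrable_bounded _ _ (measurable_qball _ _) f M).
- exact: qvol_qball_lty.
- apply: continuous_measurable_quat_real; first exact: ball_open.
  by move=> x /ball_lt/ltW; exact: cf.
- by move=> x /ball_lt/ltW xr; apply: hM; rewrite sub0r normrN.
Qed.

(** The integral of a directional derivative of a compactly supported function
    vanishes: it is the derivative at [0] of the constant function
    [t |-> \int h (x + t v) dx]. *)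
Lemma integral_derive_eq0 (h : quat R -> R) v : C1on setT h ->
  (forall x, 1 <= `|x| -> h x = 0) ->
  \int[qvol]_(x in ball (0 : quat R) 2) 'D_v h x = 0.
Proof.
move=> [dh ch] h0; pose delta := (`|v| + 1)^-1.
have v1 : 0 < `|v| + 1 by rewrite ltr_wpDl.
have delta0 : 0 < delta by rewrite invr_gt0.
have chc : continuous h by move=> x; apply: differentiable_continuous; exact: dh.
have mh : measurable_fun setT h.
  by apply: (continuous_measurable_quat_real openT) => x _; exact: chc.
have small t : t \in `]- delta, delta[ -> `|t *: v| < 1.
  rewrite in_itv /= -ltr_norml normrZ => td.
  apply: (@le_lt_trans _ _ (`|t| * (`|v| + 1))); first by rewrite ler_wpM2l// lerDl.
  by rewrite -ltr_pdivlMr// mul1r.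
have I0 : `]- delta, delta[%classic (0 : R) by rewrite /= in_itv /= oppr_lt0 delta0.
pose F t := \int[qvol]_(x in ball (0 : quat R) 2) h (x + t *: v).
have FE t : t \in `]- delta, delta[ -> F t = \int[qvol]_x h x.
  move=> /small tv; rewrite -(Rintegral_qvol_addr (t *: v) mh).
  apply: Rintegral_support => // x _ /ball_lt/negP; rewrite -leNgt => x2.
  apply: h0; have := ler_normB (x + t *: v) (t *: v); rewrite addrK.
  by move: (`|x|) (`|t *: v|) (`|x + _|) x2 tv => a b c; lra.
have caff t x : {for x, continuous (fun x => x + t *: v)}.
  by apply: lipschitz_continuous => p q; rewrite opprD addrACA subrr addr0.
have cline t x : {for x, continuous (fun x => h (x + t *: v))}.
  exact: (@continuous_comp_at R (quat R) (quat R) R _ h x (caff t x) (chc _)).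
have cv0 x : `|0 - x| <= 3 -> {for x, continuous (fun x => 'D_v h x)} by move=> _; exact: ch.
have [M M0 hM] := bounded_on_cball cv0.
have mB := measurable_qball (0 : quat R) 2.
have fB : (qvol (ball (0%R : quat R) 2%R) < +oo)%E by exact: qvol_qball_lty.
have intf t : `]- delta, delta[%classic t ->
    (@qvol R).-integrable (ball (0 : quat R) 2) (EFin \o (fun x => h (x + t *: v))).
  by move=> _; apply: rintegrable_cball => // x _; exact: cline.
have derf t x : `]- delta, delta[%classic t -> ball (0 : quat R) 2 x ->
    derivable (fun t => h (x + t *: v)) t 1.
  by move=> _ _; apply: (derive_line _ _ _ _).2; apply: diff_derivable; exact: dh.
have Gub t x : `]- delta, delta[%classic t -> ball (0 : quat R) 2 x ->
    `|partial1of2 (fun t x => h (x + t *: v)) t x| <= M.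
  move=> /= /small tv /ball_lt x2; rewrite partial1of2E (derive_line _ _ _ _).1.
  apply: hM; rewrite sub0r normrN; apply: (le_trans (ler_normD _ _)); apply: ltW.
  by move: (`|x|) (`|t *: v|) x2 tv => a b; lra.
have intG : (@qvol R).-integrable (ball (0 : quat R) 2) (EFin \o (fun=> M)).
  by apply: rintegrable_cball => // x _; exact: continuous_cst_at.
have D := @differentiation_under_integral R _ (quat R) qvol (fun t x => h (x + t *: v))
  (ball (0 : quat R) 2) mB 0 (- delta) delta I0 intf derf (fun=> M) (fun=> M0) intG Gub.
transitivity (\int[qvol]_(x in ball (0 : quat R) 2) partial1of2 (fun t x => h (x + t *: v)) 0 x).
  by apply: eq_Rintegral => x _; rewrite partial1of2E (derive_line _ _ _ _).1 scale0r addr0.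
rewrite -D derive1E (@near_eq_derive _ _ _ _ (fun=> \int[qvol]_x h x)).
  exact: derive_cst.
near=> t; apply: FE; near: t; exact: near_in_itvoo.
Unshelve. all: by end_near. Qed.

End integration_by_parts.

Lemma quat_ext {R : realType} (p q : quat R) :
  qre p = qre q -> qi p = qi q -> qj p = qj q -> qk p = qk q -> p = q.
Proof. by case: p q => [????] [????] /= -> -> -> ->. Qed.

Section mean_value.
Context {R : realType}.
Implicit Types (x v w : quat R) (s t r : R).

Definition unit_ball : set (quat R) := ball (0 : quat R) 1.

Lemma measurable_unit_ball : measurable unit_ball.
Proof. exact: measurable_qball. Qed.

Lemma C1on_setU (V W : normedModType R) (A B : set V) (f : V -> W) :
  C1on A f -> C1on B f -> C1on (A `|` B) f.
Proof.
by move=> [dA cA] [dB cB]; split=> [z [/dA|/dB]|v z [|]] //; [exact: cA|exact: cB].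
Qed.

Lemma C1on_qdot (U : set (quat R)) v : open U -> C1on U (fun x => qdot x v).
Proof.
move=> oU; have [c0 c1 c2 c3] := C1on_comp_quat oU (C1on_id U).
have C (l : quat R -> R) s : C1on U l -> C1on U (fun x => l x * s).
  by move=> cl; apply: (C1onM oU cl); exact: C1on_cst.
exact: (C1onD oU (C1onD oU (C1onD oU (C _ (qre v) c0) (C _ (qi v) c1)) (C _ (qj v) c2))
  (C _ (qk v) c3)).
Qed.

Lemma derive_qdot v w x : 'D_w (fun x => qdot x v) x = qdot w v.
Proof.
have cl : continuous (qdot v) := @qdot_continuous R v.
pose LM := GRing.isLinear.Build _ _ _ _ _ (@qdot_is_linear R v).
pose L : {linear quat R -> R} := HB.pack (qdot v) LM.
rewrite (_ : (fun x => _) = L); last by apply/funext => y; rewrite qdotC.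
rewrite deriveE; last exact: linear_differentiable.
by rewrite (diff_lin _ (cl : continuous L)) /= qdotC.
Qed.

Variables (U : set (quat R)) (g : quat R -> quat R) (z : quat R) (rho : R).
Hypothesis oU : open U.
Hypothesis Cg : C1on U g.
Hypothesis Dg : forall w, U w -> fueter g w = 0.
Hypothesis rho0 : 0 < rho.
Hypothesis cballU : forall w, `|z - w| <= rho -> U w.

Lemma in_domain r x : `|r| <= rho -> `|x| <= 1 -> U (z + r *: x).
Proof.
move=> rr x1; apply: cballU; rewrite opprD addrA subrr add0r normrN normrZ.
by apply: (le_trans (ler_pM _ _ rr x1)); rewrite ?mulr1.
Qed.

Lemma aff_continuous r : continuous (fun x : quat R => z + r *: x).
Proof.
apply: (@lipschitz_const_continuous _ _ _ _ `|r|) => p q.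
by rewrite opprD addrACA subrr add0r -scalerBr normrZ.
Qed.

Lemma continuous_along (W : normedModType R) (f : quat R -> W) r x :
  {for (z + r *: x), continuous f} -> {for x, continuous (fun x => f (z + r *: x))}.
Proof.
by move=> cf; exact: (@continuous_comp_at R (quat R) (quat R) W _ f x (@aff_continuous r x) cf).
Qed.

(** First moments of the gradient of [g] against the bump on the ball of radius
    [r] about [z], pulled back to the unit ball. *)
Definition moment r v w : quat R :=
  qintegral unit_ball (fun x => (qdot x v * bump x) *: 'D_w g (z + r *: x)).

Lemma rintegrable_unit (f : quat R -> R) :
  (forall x, `|x| <= 1 -> {for x, continuous f}) -> rintegrable unit_ball f.
Proof. exact: rintegrable_cball. Qed.

Section component.
(* [l] is one of the four real components. *)
Variable l : {linear quat R -> R}.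
Hypothesis cl : continuous l.

Lemma continuous_comp_derive r v x : `|r| <= rho -> `|x| <= 1 ->
  {for x, continuous (fun x => l ('D_v g (z + r *: x)))}.
Proof.
move=> rr x1; apply: (@continuous_along _ (fun w => l ('D_v g w))).
apply: (@continuous_comp_at R (quat R) (quat R) R (fun w => 'D_v g w) l); last exact: cl.
by apply: Cg.2; exact: in_domain.
Qed.

Lemma continuous_comp_g r x : `|r| <= rho -> `|x| <= 1 ->
  {for x, continuous (fun x => l (g (z + r *: x)))}.
Proof.
move=> rr x1; apply: (@continuous_along _ (fun w => l (g w))).
apply: (@continuous_comp_at R (quat R) (quat R) R g l); last exact: cl.
by apply: C1on_continuous Cg _; exact: in_domain.
Qed.

Lemma continuous_weight v x : {for x, continuous (fun x => qdot x v * bump x)}.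
Proof.
apply: (C1on_continuous (U := setT)) => //.
exact: (C1onM openT (C1on_qdot v openT) (C1on_bump setT)).
Qed.

Lemma derive_weight v w x :
  'D_w (fun x => qdot x v * bump x) x = qdot w v * bump x + bump' x * qdot x v * qdot x w.
Proof.
have [db Eb] := bump_diff x.
have dq : differentiable (fun x => qdot x v) x := (C1on_qdot v openT).1 x I.
have db' : derivable bump x w by exact: diff_derivable.
have dq' : derivable (fun x => qdot x v) x w by exact: diff_derivable.
rewrite (@deriveM _ _ (fun x => qdot x v) bump x w dq' db').
rewrite derive_qdot Eb /GRing.scale /=; ring.
Qed.

(** The derivative of [x |-> qdot x v * bump x] along [w]. It is symmetric in [v]
    and [w] because the bump is radial. *)
Definition sym_kernel v w x : R := qdot w v * bump x + bump' x * qdot x v * qdot x w.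

Lemma continuous_sym_kernel v w x : {for x, continuous (sym_kernel v w)}.
Proof.
have Cb : {for x, continuous (@bump R)} := C1on_continuous (C1on_bump setT) I.
have Cq v' : {for x, continuous (fun x => qdot x v')} := C1on_continuous (C1on_qdot v' openT) I.
have Cb' : {for x, continuous (@bump' R)} := @bump'_continuous R x.
apply: (@continuousD_at R (quat R) R (fun x => qdot w v * bump x)
  (fun x => bump' x * qdot x v * qdot x w)).
  exact: (@continuousM_at R (quat R) (fun=> qdot w v) (@bump R) x (@continuous_cst_at R (quat R) R _ x) Cb).
exact: (@continuousM_at R (quat R) (fun x => bump' x * qdot x v) _ x
  (@continuousM_at R (quat R) _ _ x Cb' (Cq v)) (Cq w)).
Qed.

(** The boundary term vanishes with the bump. *)
Lemma integration_by_parts r v w : `|r| <= rho ->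
  r * \int[qvol]_(x in unit_ball) (qdot x v * bump x * l ('D_w g (z + r *: x))) =
  - \int[qvol]_(x in unit_ball) (sym_kernel v w x * l (g (z + r *: x))).
Proof.
move=> rr; (* [h] is [C1] on the whole space: near the closed unit ball by assumption on
   [g], and elsewhere because it is zero. *)
pose h x := qdot x v * bump x * l (g (z + r *: x)).
pose V := [set x : quat R | U (z + r *: x)].
have oV : open V by apply: (open_comp _ oU) => x _; exact: aff_continuous.
have Ca : C1on V (fun x => z + r *: x).
  have Cr : C1on V (fun _ : quat R => r) by exact: (@C1on_cst R (quat R) R).
  have Cz : C1on V (fun _ : quat R => z) by exact: (@C1on_cst R (quat R) (quat R)).
  exact: (@C1onD R (quat R) (quat R) V _ _ oV Cz (C1on_qscale oV Cr (C1on_id V))).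
have Clg : C1on V (fun x => l (g (z + r *: x))).
  have Clg0 := @C1on_lin R (quat R) (quat R) R U l g oU cl Cg.
  exact: (@C1on_comp R R U V (l \o g) (fun x => z + r *: x) oU oV (fun x Vx => Vx) Clg0 Ca).
have Cw : C1on setT (fun x => qdot x v * bump x).
  exact: (C1onM openT (C1on_qdot v openT) (C1on_bump setT)).
have CV : C1on V h by exact: (C1onM oV (C1on_sub (@subsetT _ V) Cw) Clg).
pose E := [set x : quat R | 1 < `|x|].
have oE : open E.
  rewrite (_ : E = (fun x : quat R => `|x|) @^-1` [set t | 1 < t])//.
  apply: (open_comp (f := fun x : quat R => `|x|)); last exact: open_gt.
  move=> x _; apply: (@lipschitz_continuous R (quat R) R (fun w => `|w|)) => p q.
  exact: ler_dist_dist.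
have hE x : 1 <= `|x| -> h x = 0.
  by move=> /bump_eq0[b0 _]; rewrite /h b0 mulr0 mul0r.
have CE : C1on E h.
  apply: (@C1on_eq R (quat R) R E (fun=> 0) h oE); last exact: C1on_cst.
  by move=> x /ltW/hE.
have Ch : C1on setT h.
  apply: (C1on_sub _ (C1on_setU CV CE)) => x _.
  have [x1|x1] := leP `|x| 1; [left; exact: in_domain|by right].
have DV x : V x -> 'D_w h x = sym_kernel v w x * l (g (z + r *: x)) +
    r * (qdot x v * bump x * l ('D_w g (z + r *: x))).
  move=> Vx.
  have d1 : derivable (fun x => qdot x v * bump x) x w by apply: diff_derivable; exact: Cw.1.
  have d2 : derivable (fun x => l (g (z + r *: x))) x w by apply: diff_derivable; exact: Clg.1.
  rewrite (@deriveM _ _ (fun x => qdot x v * bump x) (fun x => l (g (z + r *: x))) x w d1 d2).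
  rewrite derive_weight.
  have da : differentiable (fun x => z + r *: x) x by exact: Ca.1.
  have dg : differentiable g (z + r *: x) by exact: Cg.1.
  have dga : differentiable (fun x => g (z + r *: x)) x.
    exact: (@differentiable_comp R (quat R) (quat R) (quat R) _ g x da dg).
  rewrite (@derive_lin R l (fun x => g (z + r *: x)) w x cl dga).
  rewrite (@derive_qcomp R (quat R) g (fun x => z + r *: x) w x da dg).
  have -> : 'D_w (fun x : quat R => z + r *: x) x = r *: w.
    rewrite (_ : (fun x => _) = (fun x => r%:A * x * 1 + z)); last first.
      by apply/funext => y; rewrite mulr1 -scalerAl mul1r addrC.
    by rewrite derive_qaffine mulr1 -scalerAl mul1r.
  have -> : 'D_(r *: w) g (z + r *: x) = r *: 'D_w g (z + r *: x).
    by rewrite !deriveE// linearZ.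
  have sc (s t : R) : s *: t = s * t by [].
  by rewrite linearZ /sym_kernel /= !sc; ring.
have DE x : 1 <= `|x| -> 'D_w h x = 0.
  rewrite le_eqVlt => /predU1P[x1|x1].
    have [b0 b1] : bump x = 0 /\ bump' x = 0 by apply: bump_eq0; rewrite -x1.
    rewrite DV; last by apply: in_domain => //; rewrite -x1.
    by rewrite /sym_kernel b0 b1 !(mulr0, mul0r, addr0).
  rewrite (@derive_eq_on R (quat R) R E h (fun=> 0) w x oE x1); first exact: derive_cst.
  by move=> y /ltW/hE.
have := integral_derive_eq0 w Ch hE.
rewrite -(@Rintegral_support R unit_ball); last 2 first.
- by move=> x /ball_lt x1; apply/ball_lt; lra.
- by move=> x _ x1; apply: (DE x); rewrite leNgt; apply/negP => /ball_lt.
have i1 : rintegrable unit_ball (fun x => sym_kernel v w x * l (g (z + r *: x))).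
  apply: rintegrable_unit => x x1; apply: (@continuousM_at R (quat R)); last exact: continuous_comp_g.
  exact: continuous_sym_kernel.
have i2 : rintegrable unit_ball (fun x => qdot x v * bump x * l ('D_w g (z + r *: x))).
  apply: rintegrable_unit => x x1; apply: (@continuousM_at R (quat R)).
    exact: continuous_weight.
  exact: continuous_comp_derive.
rewrite (@eq_Rintegral _ _ _ _ _ (fun x => 1 * (sym_kernel v w x * l (g (z + r *: x))) +
    r * (qdot x v * bump x * l ('D_w g (z + r *: x))))); last first.
  move=> x; rewrite inE => /ball_lt/ltW x1; rewrite mul1r DV//.
  exact: in_domain.
have z1 := rintegrableZ measurable_unit_ball 1 i1.
have z2 := rintegrableZ measurable_unit_ball r i2.
rewrite (RintegralD measurable_unit_ball z1 z2).
rewrite (RintegralZl 1 measurable_unit_ball i1) (RintegralZl r measurable_unit_ball i2).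
by rewrite mul1r addrC => /eqP; rewrite addr_eq0 => /eqP.
Qed.

End component.

Lemma qintegrable_moment r v w : `|r| <= rho ->
  qintegrable unit_ball (fun x => (qdot x v * bump x) *: 'D_w g (z + r *: x)).
Proof.
move=> rr; have H (l : {linear quat R -> R}) : continuous l ->
    rintegrable unit_ball (fun x => qdot x v * bump x * l ('D_w g (z + r *: x))).
  move=> cl; apply: rintegrable_unit => x x1; apply: (@continuousM_at R (quat R)).
    exact: continuous_weight.
  exact: continuous_comp_derive.
split.
- exact: (H _ qre_continuous).
- exact: (H _ qi_continuous).
- exact: (H _ qj_continuous).
- exact: (H _ qk_continuous).
Qed.

Lemma moment_sym r v w : 0 < r -> r <= rho -> moment r v w = moment r w v.
Proof.
move=> r0 rr; have rr' : `|r| <= rho by rewrite gtr0_norm.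
have H (l : {linear quat R -> R}) : continuous l ->
    \int[qvol]_(x in unit_ball) (qdot x v * bump x * l ('D_w g (z + r *: x))) =
    \int[qvol]_(x in unit_ball) (qdot x w * bump x * l ('D_v g (z + r *: x))).
  move=> cl; apply: (mulfI (x := r)); first by rewrite gt_eqF.
  apply: (etrans (integration_by_parts cl v w rr')).
  apply: (etrans _ (esym (integration_by_parts cl w v rr'))).
  congr (- _); apply: eq_Rintegral => x _.
  by rewrite /sym_kernel (qdotC v w); congr (_ * _); ring.
apply: quat_ext.
- exact: (H _ qre_continuous).
- exact: (H _ qi_continuous).
- exact: (H _ qj_continuous).
- exact: (H _ qk_continuous).
Qed.

Lemma moment_fueter r v : `|r| <= rho ->
  moment r v 1 + unit_i * moment r v unit_i + unit_j * moment r v unit_j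
    + unit_k * moment r v unit_k = 0.
Proof.
move=> rr; have I w := qintegrable_moment v w rr.
have mB := measurable_unit_ball.
have iM p w := qintegrableMl mB p (I w).
rewrite /moment -!(qintegralMl mB _ (I _)).
rewrite -(qintegralD mB (I 1) (iM _ _)).
rewrite -(qintegralD mB (qintegrableD mB (I 1) (iM _ _)) (iM _ _)).
rewrite -(qintegralD mB (qintegrableD mB (qintegrableD mB (I 1) (iM _ _)) (iM _ _)) (iM _ _)).
rewrite (@eq_qintegral _ _ _ (fun=> 0)).
  by congr Quat; rewrite /Rintegral integral0.
move=> x; rewrite inE => /ball_lt/ltW x1.
by rewrite -!scalerAr -!scalerDr -/(fueter g (z + r *: x)) Dg ?scaler0//; exact: in_domain.
Qed.

(** Left-multiply the equations for [v = 1, i, j, k] by [1, -i, -j, -k] and add: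
    the off-diagonal terms cancel by symmetry and the diagonal ones remain. *)
Lemma symmetric_fueter_trace (P : quat R -> quat R -> quat R) :
  (forall v w, P v w = P w v) ->
  (forall v, P v 1 + unit_i * P v unit_i + unit_j * P v unit_j + unit_k * P v unit_k = 0) ->
  P 1 1 + P unit_i unit_i + P unit_j unit_j + P unit_k unit_k = 0.
Proof.
move=> sP DP.
have h0 := DP 1; have h1 := DP unit_i; have h2 := DP unit_j; have h3 := DP unit_k.
rewrite (sP unit_i 1) in h1; rewrite (sP unit_j 1) (sP unit_j unit_i) in h2.
rewrite (sP unit_k 1) (sP unit_k unit_i) (sP unit_k unit_j) in h3.
have := congr2 +%R (congr2 +%R h0 (congr1 ( *%R (- unit_i)) h1))
  (congr2 +%R (congr1 ( *%R (- unit_j)) h2) (congr1 ( *%R (- unit_k)) h3)).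
rewrite !(mulr0, addr0) => <-.
move: (P 1 1) (P 1 unit_i) (P 1 unit_j) (P 1 unit_k) (P unit_i unit_i) (P unit_i unit_j)
  (P unit_i unit_k) (P unit_j unit_j) (P unit_j unit_k) (P unit_k unit_k) => *.
by congr Quat => /=; ring.
Qed.

Lemma moment_trace r : 0 < r -> r <= rho ->
  moment r 1 1 + moment r unit_i unit_i + moment r unit_j unit_j + moment r unit_k unit_k = 0.
Proof.
move=> r0 rr; apply: symmetric_fueter_trace => [v w|v]; first exact: moment_sym.
by apply: moment_fueter; rewrite gtr0_norm.
Qed.

Lemma linear_sum4 (l : {linear quat R -> R}) (p0 p1 p2 p3 : quat R) :
  1 * l p0 + 1 * l p1 + 1 * l p2 + 1 * l p3 = l (p0 + p1 + p2 + p3).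
Proof. by rewrite !mul1r !linearD. Qed.

Section radial_average.
Variable l : {linear quat R -> R}.
Hypothesis cl : continuous l.

Definition average r := \int[qvol]_(x in unit_ball) (bump x * l (g (z + r *: x))).

Lemma bounded_gradient : exists2 M, 0 <= M & forall w x, `|z - w| <= rho -> `|x| <= 1 ->
  `|l ('D_x g w)| <= M.
Proof.
have B v : exists2 M, 0 <= M & forall w, `|z - w| <= rho -> `|l ('D_v g w)| <= M.
  apply: bounded_on_cball => w /cballU Uw.
  apply: (@continuous_comp_at R (quat R) (quat R) R (fun w => 'D_v g w) l); last exact: cl.
  exact: Cg.2.
have [M0 p0 h0] := B 1; have [M1 p1 h1] := B unit_i.
have [M2 p2 h2] := B unit_j; have [M3 p3 h3] := B unit_k.
exists (M0 + M1 + M2 + M3); first by rewrite !addr_ge0.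
move=> w x zw x1; rewrite derive_expand; last by apply: Cg.1; exact: cballU.
rewrite !linearD !linearZ /=.
have T (s t M : R) : `|s| <= `|x| -> `|t| <= M -> `|s *: t| <= M.
  move=> sx tM; rewrite normrM; apply: (@le_trans _ _ (1 * `|t|)); last by rewrite mul1r.
  by rewrite ler_wpM2r// (le_trans sx).
apply: (le_trans (ler_normD _ _)); apply: lerD; last exact: T (ler_norm_qk _) (h3 _ zw).
apply: (le_trans (ler_normD _ _)); apply: lerD; last exact: T (ler_norm_qj _) (h2 _ zw).
apply: (le_trans (ler_normD _ _)); apply: lerD; last exact: T (ler_norm_qi _) (h1 _ zw).
exact: T (ler_norm_qre _) (h0 _ zw).
Qed.

Lemma average_derivable r : r \in `]- rho, rho[ -> derivable average r 1 /\
  average^`()%classic r = \int[qvol]_(x in unit_ball) (bump x * l ('D_x g (z + r *: x))).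
Proof.
move=> rI; have [M M0 hM] := bounded_gradient.
have mB := measurable_unit_ball.
have rr t : `]- rho, rho[%classic t -> `|t| < rho by rewrite /= in_itv /= -ltr_norml.
have cb x : {for x, continuous (@bump R)} := C1on_continuous (C1on_bump setT) I.
have intf t : `]- rho, rho[%classic t ->
    (@qvol R).-integrable unit_ball (EFin \o (fun x => bump x * l (g (z + t *: x)))).
  move=> /rr/ltW tr; apply: rintegrable_unit => x x1.
  apply: (@continuousM_at R (quat R)); first exact: cb.
  exact: continuous_comp_g.
have dline t x : `|t| < rho -> `|x| <= 1 ->
    derivable (fun t => l (g (z + t *: x))) t 1 /\
    'D_1 (fun t => l (g (z + t *: x))) t = l ('D_x g (z + t *: x)).
  move=> tr x1; have Ut : U (z + t *: x) by apply: in_domain => //; exact: ltW.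
  have dg : differentiable g (z + t *: x) by exact: Cg.1.
  have dlg : differentiable (fun w => l (g w)) (z + t *: x).
    by apply: (@differentiable_comp R _ _ _ g l) => //; exact: linear_differentiable.
  have [E D] := @derive_line R R (fun w => l (g w)) z x t.
  split; first by apply: D; exact: diff_derivable.
  by rewrite E (derive_lin x cl dg).
have derf t x : `]- rho, rho[%classic t -> unit_ball x ->
    derivable (fun t => bump x * l (g (z + t *: x))) t 1.
  move=> /rr tr /ball_lt/ltW x1.
  exact: (@derivableZ R R R _ (bump x) t 1 (dline t x tr x1).1).
have D1 t x : `|t| < rho -> `|x| <= 1 ->
    'D_1 (fun t => bump x * l (g (z + t *: x))) t = bump x * l ('D_x g (z + t *: x)).
  move=> tr x1; have [d1 E] := dline t x tr x1.
  by rewrite (@deriveZ R R R _ (bump x) t 1 d1) E.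
have bump1 x : bump x <= 1.
  rewrite /bump expr_le1 ?pos_part_ge0// /pos_part ge_max ler01 /=.
  by rewrite lerBlDr lerDl qnormsq_ge0.
have Gub t x : `]- rho, rho[%classic t -> unit_ball x ->
    `|partial1of2 (fun t x => bump x * l (g (z + t *: x))) t x| <= M.
  move=> /rr tr /ball_lt/ltW x1; rewrite partial1of2E D1//.
  rewrite normrM (ger0_norm (bump_ge0 x)).
  apply: (@le_trans _ _ (1 * `|l ('D_x g (z + t *: x))|)); first by rewrite ler_wpM2r.
  rewrite mul1r; apply: hM => //; rewrite opprD addrA subrr add0r normrN normrZ.
  by apply: (le_trans (ler_pM _ _ (ltW tr) x1)); rewrite ?mulr1.
have intG : (@qvol R).-integrable unit_ball (EFin \o (fun=> M)).
  by apply: rintegrable_unit => x _; exact: continuous_cst_at.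
have D := @differentiation_under_integral R _ (quat R) qvol
  (fun t x => bump x * l (g (z + t *: x)))
  unit_ball mB r (- rho) rho rI intf derf (fun=> M) (fun=> M0) intG Gub.
have d := @derivable_under_integral R _ (quat R) qvol
  (fun t x => bump x * l (g (z + t *: x)))
  unit_ball mB r (- rho) rho rI intf derf (fun=> M) (fun=> M0) intG Gub.
split=> //; rewrite D; apply: eq_Rintegral => x; rewrite inE => /ball_lt/ltW x1.
by rewrite partial1of2E D1//; exact: rr.
Qed.

(* Again satisfied by the components. *)
Hypothesis lint : forall F, l (qintegral unit_ball F) = \int[qvol]_(x in unit_ball) l (F x).

(** Expanding [x] in the basis, the radial derivative of the average is the trace
    of the symmetric matrix of moments, which vanishes for a solution of the
    Fueter equation. *)
Lemma average_derivative_eq0 r : 0 < r -> r <= rho ->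
  \int[qvol]_(x in unit_ball) (bump x * l ('D_x g (z + r *: x))) = 0.
Proof.
move=> r0 rr; have rr' : `|r| <= rho by rewrite gtr0_norm.
have sc (s t : R) : s *: t = s * t by [].
have I v : rintegrable unit_ball (fun x => qdot x v * bump x * l ('D_v g (z + r *: x))).
  apply: rintegrable_unit => x x1; apply: (@continuousM_at R (quat R)).
    exact: continuous_weight.
  exact: continuous_comp_derive.
have M v : \int[qvol]_(x in unit_ball) (qdot x v * bump x * l ('D_v g (z + r *: x))) =
    l (moment r v v).
  by rewrite lint; apply: eq_Rintegral => x _; rewrite linearZ.
pose h x := qdot x 1 * bump x * l ('D_1 g (z + r *: x)) +
    qdot x unit_i * bump x * l ('D_unit_i g (z + r *: x)) +
    qdot x unit_j * bump x * l ('D_unit_j g (z + r *: x)) +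
    qdot x unit_k * bump x * l ('D_unit_k g (z + r *: x)).
transitivity (\int[qvol]_(x in unit_ball) h x).
  apply: eq_Rintegral => x; rewrite inE => /ball_lt/ltW x1.
  rewrite derive_expand; last by apply: Cg.1; exact: in_domain.
  rewrite !linearD !linearZ /= !sc /h /qdot /=; ring.
apply: (eq_lin4_integral measurable_unit_ball (c0 := 1) (c1 := 1) (c2 := 1) (c3 := 1)
  (I 1) (I unit_i) (I unit_j) (I unit_k)).
  by move=> x; rewrite (mul1r (qdot x 1 * _ * _)) (mul1r (qdot x unit_i * _ * _))
    (mul1r (qdot x unit_j * _ * _)) (mul1r (qdot x unit_k * _ * _)).
rewrite (M 1) (M unit_i) (M unit_j) (M unit_k).
apply: (etrans (linear_sum4 l _ _ _ _)).
by rewrite (moment_trace r0 rr) (linear0 l).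
Qed.

Lemma average_const r : 0 <= r -> r < rho -> average r = average 0.
Proof.
rewrite le_eqVlt => /predU1P[<-//|r0] rr.
have rI t : t \in `[0, r] -> t \in `]- rho, rho[.
  by rewrite !in_itv /= => /andP[t0 tr]; apply/andP; split; move: rho0; lra.
have dI t : t \in `]0, r[ -> is_derive t (1 : R) average (average^`()%classic t).
  move=> tI; have /rI/average_derivable[d _] : t \in `[0, r] by exact: subset_itv_oo_cc.
  by rewrite derive1E; exact: DeriveDef.
have cI : {within `[0, r], continuous average}.
  apply: derivable_within_continuous => t /rI/average_derivable[d _]; exact: d.
have [t tI E] := MVT r0 dI cI.
have /rI/average_derivable[_ Dt] : t \in `[0, r] by exact: subset_itv_oo_cc.
move: tI; rewrite in_itv /= => /andP[t0 tr].
move/eqP: E; rewrite Dt average_derivative_eq0//; last by rewrite (le_trans (ltW tr)) ?ltW.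
by rewrite mul0r subr_eq0 => /eqP.
Qed.

End radial_average.

Definition bump_mass : R := \int[qvol]_(x in unit_ball) bump x.

(** The weighted averages do not depend on the radius, and at radius [0] they
    give the value at the center. *)
Lemma mean_value r : 0 <= r -> r < rho ->
  qintegral unit_ball (fun x => bump x *: g (z + r *: x)) = bump_mass *: g z.
Proof.
move=> r0 rr.
have cb (x : quat R) : `|x| <= 1 -> {for x, continuous (@bump R)}.
  by move=> _; exact: C1on_continuous (C1on_bump setT) I.
have H (l : {linear quat R -> R}) : continuous l ->
    (forall F, l (qintegral unit_ball F) = \int[qvol]_(x in unit_ball) l (F x)) ->
    \int[qvol]_(x in unit_ball) (bump x * l (g (z + r *: x))) = bump_mass * l (g z).
  move=> cl lint; rewrite -/(average l r) (average_const cl lint r0 rr) /average.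
  rewrite mulrC /bump_mass -(RintegralZl (l (g z)) measurable_unit_ball (rintegrable_unit cb)).
  by apply: eq_Rintegral => x _; rewrite scale0r addr0 mulrC.
apply: quat_ext.
- exact: (H _ qre_continuous).
- exact: (H _ qi_continuous).
- exact: (H _ qj_continuous).
- exact: (H _ qk_continuous).
Qed.

End mean_value.

(** * Locally uniform limits of monogenic functions *)

Lemma lipschitz_at_continuous {R : realType} (V W : normedModType R) (F : V -> W)
    z (C delta : R) : 0 < delta ->
  (forall h, `|h| < delta -> `|F (h + z) - F z| <= C * `|h|) ->
  {for z, continuous F}.
Proof.
move=> delta0 hF; apply/cvgrPdist_lt => e e0.
have C1 : 0 < `|C| + 1 by rewrite ltr_wpDl.
have d0 : 0 < e / (`|C| + 1) by rewrite divr_gt0.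
near=> w; have wz : `|w - z| < delta by rewrite distrC; near: w; exact: cvgr_dist_lt.
have := hF _ wz; rewrite subrK distrC => h; apply: (le_lt_trans h).
apply: (@le_lt_trans _ _ ((`|C| + 1) * `|w - z|)).
  by rewrite ler_wpM2r// (le_trans (ler_norm C))// lerDl.
by rewrite mulrC -ltr_pdivlMr// distrC; near: w; exact: cvgr_dist_lt.
Unshelve. all: by end_near. Qed.

Lemma qvol_ball_lty {R : realType} (z : quat R) (r : R) : 0 < r ->
  (qvol (ball z r) < +oo)%E.
Proof.
move=> r0; have rz : 0 < `|z| + r by rewrite ltr_wpDl.
apply: le_lt_trans (qvol_qball_lty rz).
apply: le_measure; rewrite ?inE; [exact: measurable_qball|exact: measurable_qball|].
move=> w; rewrite -ball_normE /= => zw; apply/ball_lt.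
rewrite (_ : w = z - (z - w)); last by rewrite opprB addrC subrK.
by apply: (le_lt_trans (ler_normB _ _)); rewrite ltrD2l.
Qed.

Section bump_convolution.
Context {R : realType}.
Implicit Types (x v w z h : quat R) (r : R).

Section bounded_integrals.
Variable D : set (quat R).
Hypothesis mD : measurable D.
Hypothesis Doo : (qvol D < +oo)%E.

Lemma Rintegral_bounded (f : quat R -> R) (M : R) : measurable_fun D f ->
  (forall w, D w -> `|f w| <= M) -> `|\int[qvol]_(w in D) f w| <= M * fine (qvol D).
Proof.
move=> mf fM; have If := rintegrable_bounded mD Doo mf fM.
have IM : rintegrable D (fun=> M).
  by apply: (rintegrable_bounded (M := `|M|) mD Doo (measurable_cst _)).
apply: (le_trans (le_normr_Rintegral mD If)).
rewrite -Rintegral_cst//; apply: le_Rintegral => //.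
exact: (integrable_norm If).
Qed.

End bounded_integrals.

(** The derivative of the bump along [v], as a function of the base point. *)
Definition bump_grad x v : R := bump' x * qdot x v.

Lemma bump'_norm x : `|bump' x| <= 4.
Proof.
rewrite /bump' normrM normrN (@ger0_norm _ 4)// (ger0_norm (pos_part_ge0 _)).
rewrite -[leRHS]mulr1 ler_wpM2l// /pos_part ge_max ler01 /=.
by rewrite lerBlDr lerDl qnormsq_ge0.
Qed.

Lemma bump_grad_norm x v : `|bump_grad x v| <= 4 * `|x| * `|v|.
Proof.
rewrite /bump_grad normrM -mulrA; apply: ler_pM => //; first exact: bump'_norm.
exact: qdot_norm.
Qed.

Lemma bump_grad_lipschitz (A : R) x h v : 0 <= A -> `|x| <= A -> `|h| < 1 ->
  `|bump_grad (h + x) v - bump_grad x v| <= (4 * (2 * A + 1) * (A + 1) + 4) * `|v| * `|h|.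
Proof.
move=> A0 xA h1.
have -> : bump_grad (h + x) v - bump_grad x v =
    (bump' (h + x) - bump' x) * qdot (h + x) v + bump' x * qdot h v.
  by rewrite /bump_grad /qdot /=; ring.
apply: (le_trans (ler_normD _ _)).
rewrite (_ : (4 * (2 * A + 1) * (A + 1) + 4) * `|v| * `|h| =
  4 * ((2 * A + 1) * `|h|) * ((A + 1) * `|v|) + 4 * (`|h| * `|v|)); last by ring.
apply: lerD; last first.
  by rewrite normrM; apply: ler_pM => //; [exact: bump'_norm|exact: qdot_norm].
rewrite normrM; apply: ler_pM => //; last first.
  apply: (le_trans (qdot_norm _ _)); rewrite ler_wpM2r//.
  apply: (le_trans (ler_normD _ _)); rewrite addrC; apply: lerD => //; exact: ltW.
rewrite /bump' -mulrBr normrM normrN (@ger0_norm _ 4)// ler_wpM2l//.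
apply: (le_trans (pos_part_lipschitz _ _)).
rewrite (_ : 1 - qnormsq (h + x) - (1 - qnormsq x) = - (2 * qdot x h + `|h| ^+ 2)); last first.
  by rewrite qnorm_sqr addrC (addrC h) qnormsqD; ring.
rewrite normrN; apply: (le_trans (ler_normD _ _)).
rewrite [leRHS]mulrDl (mul1r `|h|); apply: lerD.
  rewrite normrM (@ger0_norm _ 2)// -mulrA ler_wpM2l//.
  by apply: (le_trans (qdot_norm _ _)); rewrite ler_wpM2r.
by rewrite ger0_norm ?sqr_ge0// expr2 ler_piMr// ltW.
Qed.

Variables (z0 : quat R) (rho s M : R) (H : quat R -> R).
Hypothesis rho0 : 0 < rho.
Hypothesis s0 : 0 < s.
Notation D := (ball z0 rho).
Hypothesis mH : measurable_fun D H.
Hypothesis HM : forall w, D w -> `|H w| <= M.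

(** Convolution of [H] with a rescaled bump, and its derivative along [v]. *)
Definition bump_conv (H : quat R -> R) z : R := \int[qvol]_(w in D) (bump (s *: (w - z)) * H w).
Definition bump_conv' (H : quat R -> R) z v : R :=
  \int[qvol]_(w in D) (- s * bump_grad (s *: (w - z)) v * H w).

Let mD : measurable D := measurable_qball z0 rho.
Let Doo : (qvol D < +oo)%E := qvol_ball_lty z0 rho0.

Lemma affine_continuous z : continuous (fun w => s *: (w - z)).
Proof.
apply: (@lipschitz_const_continuous R (quat R) (quat R) _ `|s|) => p q.
by rewrite -scalerBr normrZ opprB addrA subrK.
Qed.

Lemma bump_continuous : continuous (@bump R).
Proof. by move=> x; exact: C1on_continuous (C1on_bump setT) I. Qed.

Lemma bump_grad_continuous v : continuous (fun x => bump_grad x v).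
Proof.
move=> x; apply: (@continuousM_at R (quat R)); first exact: bump'_continuous.
exact: C1on_continuous (C1on_qdot v openT) I.
Qed.

Lemma measurable_kernel (k : quat R -> R) z : continuous k ->
  measurable_fun D (fun w => k (s *: (w - z))).
Proof.
move=> ck; apply: continuous_measurable_quat_real; first exact: ball_open.
move=> w _; exact: (@continuous_comp_at R (quat R) (quat R) R _ k w (@affine_continuous z w) (ck _)).
Qed.

Lemma kernel_arg z w : D w -> `|s *: (w - z)| <= s * (rho + `|z0 - z|).
Proof.
rewrite -ball_normE /= => wD; rewrite normrZ gtr0_norm// ler_pM2l//.
rewrite (_ : w - z = - (z0 - w) + (z0 - z)); last by rewrite opprB addrA subrK.
by apply: (le_trans (ler_normD _ _)); rewrite normrN lerD2r ltW.
Qed.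

Lemma bump_le1 x : bump x <= 1.
Proof.
rewrite /bump expr_le1 ?pos_part_ge0// /pos_part ge_max ler01 /=.
by rewrite lerBlDr lerDl qnormsq_ge0.
Qed.

Lemma rintegrable_conv z : rintegrable D (fun w => bump (s *: (w - z)) * H w).
Proof.
apply: (rintegrable_bounded (M := M) mD Doo).
  by apply: measurable_funM => //; exact: measurable_kernel bump_continuous.
move=> w Dw; rewrite normrM (ger0_norm (bump_ge0 _)).
apply: (le_trans _ (HM Dw)); rewrite ler_piMl//; exact: bump_le1.
Qed.

Lemma measurable_conv' z v : measurable_fun D (fun w => - s * bump_grad (s *: (w - z)) v * H w).
Proof.
apply: measurable_funM => //; apply: measurable_funM => //.
exact: (measurable_kernel z (@bump_grad_continuous v)).
Qed.

Lemma bound_conv' z v w : D w -> `|- s * bump_grad (s *: (w - z)) v * H w| <=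
  s * (4 * (s * (rho + `|z0 - z|)) * `|v|) * M.
Proof.
move=> Dw; rewrite normrM (normrM (- s)) normrN (gtr0_norm s0); apply: ler_pM => //; last exact: HM.
  by apply: mulr_ge0 => //; exact: ltW.
apply: ler_pM => //; first exact: ltW.
apply: (le_trans (bump_grad_norm _ _)); rewrite ler_wpM2r// ler_wpM2l//.
exact: kernel_arg.
Qed.

Lemma rintegrable_conv' z v :
  rintegrable D (fun w => - s * bump_grad (s *: (w - z)) v * H w).
Proof.
exact: (rintegrable_bounded mD Doo (@measurable_conv' z v) (@bound_conv' z v)).
Qed.

Lemma bump_conv'_norm z v :
  `|bump_conv' H z v| <= s * (4 * (s * (rho + `|z0 - z|)) * `|v|) * M * fine (qvol D).
Proof. exact: (Rintegral_bounded mD Doo (@measurable_conv' z v) (@bound_conv' z v)). Qed.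

Lemma bump_conv'_linear z : linear (bump_conv' H z).
Proof.
move=> t p q; have Ip := rintegrable_conv' z p; have Iq := rintegrable_conv' z q.
have Itp := rintegrableZ mD t Ip.
have sc (a b : R) : a *: b = a * b by [].
rewrite sc /bump_conv' -(RintegralZl t mD Ip) -(RintegralD mD Itp Iq).
by apply: eq_Rintegral => w _; rewrite /bump_grad /qdot /=; ring.
Qed.

(** Integrate the second-order Taylor estimate of the bump. *)
Lemma bump_conv_diff z : differentiable (bump_conv H) z /\
  forall v, 'D_v (bump_conv H) z = bump_conv' H z v.
Proof.
pose LM := GRing.isLinear.Build _ _ _ _ _ (bump_conv'_linear z).
pose L : {linear quat R -> R} := HB.pack (bump_conv' H z) LM.
pose A := s * (rho + `|z0 - z|).
have A0 : 0 <= A by rewrite mulr_ge0 ?addr_ge0// ltW.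
have cL : continuous L.
  apply: (@lipschitz_const_continuous R (quat R) R L (s * (4 * A) * M * fine (qvol D))) => p q.
  rewrite -linearB; apply: (le_trans (bump_conv'_norm z (p - q))).
  by rewrite -/A le_eqVlt; apply/orP; left; apply/eqP; ring.
have [|h hs|dF EF] := @quadratic_diff R (quat R) R (bump_conv H) L z
  (((2 * A + 1) ^+ 2 + 2) * s ^+ 2 * M * fine (qvol D)) s^-1 _ cL.
- by rewrite invr_gt0.
- have sh : `|- s *: h| < 1 by rewrite normrZ normrN gtr0_norm// mulrC -ltr_pdivlMr// div1r.
  have -> : bump_conv H (h + z) - bump_conv H z - L h = \int[qvol]_(w in D)
      ((bump (- s *: h + s *: (w - z)) - bump (s *: (w - z)) -
        bump' (s *: (w - z)) * qdot (s *: (w - z)) (- s *: h)) * H w).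
    have I1 := rintegrable_conv (h + z); have I2 := rintegrable_conv z.
    have I3 := rintegrable_conv' z h.
    rewrite /= /bump_conv /bump_conv' -(RintegralB mD I1 I2).
    rewrite -(RintegralB mD (integrableB mD I1 I2) I3).
    apply: eq_Rintegral => w _.
    have -> : s *: (w - (h + z)) = - s *: h + s *: (w - z).
      by rewrite scaleNr -scalerN -scalerDr opprD addrCA.
    by rewrite /bump_grad /qdot /=; ring.
  rewrite (_ : _ * `|h| ^+ 2 = ((2 * A + 1) ^+ 2 + 2) * (s * `|h|) ^+ 2 * M * fine (qvol D)); last by ring.
  apply: (Rintegral_bounded mD Doo) => [|w Dw].
    apply: measurable_funM => //; apply: measurable_funB; first apply: measurable_funB.
    + have := measurable_kernel (h + z) bump_continuous; congr measurable_fun.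
      by apply/funext => w; rewrite scaleNr -scalerN -scalerDr opprD addrCA.
    + exact: measurable_kernel bump_continuous.
    + exact: (measurable_kernel z (@bump_grad_continuous (- s *: h))).
  rewrite normrM; apply: ler_pM => //; last exact: HM.
  have := bump_taylor A0 (kernel_arg z Dw) sh.
  by rewrite normrZ normrN (gtr0_norm s0).
by split=> // v; rewrite deriveE// EF.
Qed.

Lemma bump_conv_C1 : C1on setT (bump_conv H).
Proof.
split=> [z _|v z _]; first exact: (bump_conv_diff z).1.
rewrite (_ : (fun w => _) = (fun w => bump_conv' H w v)); last first.
  by apply/funext => w; rewrite (bump_conv_diff w).2.
pose A := s * (rho + `|z0 - z|).
have A0 : 0 <= A by rewrite mulr_ge0 ?addr_ge0// ltW.
have si : 0 < s^-1 by rewrite invr_gt0.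
apply: (@lipschitz_at_continuous R (quat R) R _ z
  (s * ((4 * (2 * A + 1) * (A + 1) + 4) * `|v| * s) * M * fine (qvol D)) s^-1 si) => h hs.
have sh : `|- s *: h| < 1 by rewrite normrZ normrN gtr0_norm// mulrC -ltr_pdivlMr// div1r.
have I1 := rintegrable_conv' (h + z) v; have I2 := rintegrable_conv' z v.
rewrite /bump_conv' -(RintegralB mD I1 I2).
rewrite (_ : _ * `|h| = s * ((4 * (2 * A + 1) * (A + 1) + 4) * `|v| * (s * `|h|)) * M * fine (qvol D)); last by ring.
apply: (Rintegral_bounded mD Doo) => [|w Dw].
  by apply: measurable_funB; exact: measurable_conv'.
rewrite -mulrBl -mulrBr normrM (normrM (- s)) normrN (gtr0_norm s0).
apply: ler_pM => //; last exact: HM.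
  by apply: mulr_ge0 => //; exact: ltW.
rewrite ler_pM2l//.
have -> : s *: (w - (h + z)) = - s *: h + s *: (w - z).
  by rewrite scaleNr -scalerN -scalerDr opprD addrCA.
have := bump_grad_lipschitz v A0 (kernel_arg z Dw) sh.
by rewrite normrZ normrN (gtr0_norm s0).
Qed.

End bump_convolution.

Section mean_value_convolution.
Context {R : realType}.
Implicit Types (x v w z : quat R) (r : R) (U : set (quat R)).

(** On the ball of radius [1 / 2] the bump is at least [(3 / 4)^2 > 1 / 2]. *)
Lemma bump_mass_gt0 : 0 < @bump_mass R.
Proof.
have cb (x : quat R) : `|x| <= 1 -> {for x, continuous (@bump R)} by move=> _; exact: bump_continuous.
have Ib := rintegrable_cball ltr01 cb.
have h0 : (0 : R) < 1 / 2 by lra.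
have cb' (x : quat R) : `|x| <= 1 / 2 -> {for x, continuous (@bump R)} by move=> _; exact: bump_continuous.
have Ib' := rintegrable_cball h0 cb'.
have mB := measurable_qball (0 : quat R) (1 / 2).
have vpos := qvol_qball_gt0 h0; have vfin := qvol_qball_lty h0.
have I2 : rintegrable (ball (0 : quat R) (1 / 2)) (fun=> 2^-1).
  by apply: (rintegrable_bounded (M := `|2^-1|) mB vfin (measurable_cst _)).
apply: (@lt_le_trans _ _ (2^-1 * fine (qvol (ball (0 : quat R) (1 / 2))))).
  by rewrite mulr_gt0 ?invr_gt0// fine_gt0// vpos.
rewrite -Rintegral_cst//; apply: (@le_trans _ _ (\int[qvol]_(x in ball (0 : quat R) (1 / 2)) bump x)).
  apply: le_Rintegral => // x /ball_lt x1; rewrite /bump.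
  have q1 : qnormsq x <= 1 / 4.
    rewrite -qnorm_sqr (_ : 1 / 4 = (1 / 2) ^+ 2); last by field.
    by rewrite ler_pXn2r ?nnegrE// ltW.
  have : 3 / 4 <= pos_part (1 - qnormsq x) by rewrite /pos_part le_max; apply/orP; right; lra.
  move: (pos_part _) => p p1; rewrite expr2.
  by have := ler_pM _ _ p1 p1; lra.
rewrite /bump_mass -lee_fin /Rintegral (fineK (integrable_fin_num _ Ib)); last exact: measurable_qball.
rewrite (fineK (integrable_fin_num mB Ib')).
apply: ge0_subset_integral => //.
- exact: measurable_unit_ball.
- by apply/measurable_EFinP; apply: continuous_measurable_quat_real => [|x _]; [exact: ball_open|exact: bump_continuous].
- by move=> x _; rewrite lee_fin bump_ge0.
- by move=> x /ball_lt x1; apply/ball_lt; lra.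
Qed.

Variables (U : set (quat R)) (g : quat R -> quat R) (z0 : quat R) (r : R).
Hypothesis oU : open U.
Hypothesis Cg : C1on U g.
Hypothesis Dg : forall w, U w -> fueter g w = 0.
Hypothesis r0 : 0 < r.
Hypothesis cballU : forall w, `|z0 - w| <= 3 * r -> U w.

(** The mean value property as a convolution identity: the integral now runs over
    a ball that does not move with [z], so [z] may be varied. *)
Lemma mean_value_conv (l : {linear quat R -> R}) z : continuous l ->
  (forall F, l (qintegral (@unit_ball R) F) = \int[qvol]_(x in @unit_ball R) l (F x)) ->
  `|z0 - z| < r ->
  bump_conv z0 (2 * r) r^-1 (fun w => l (g w)) z = r ^+ 4 * bump_mass * l (g z).
Proof.
move=> cl lint zr; have zU w : `|z - w| <= 2 * r -> U w.
  move=> zw; apply: cballU; rewrite (_ : z0 - w = (z0 - z) + (z - w)).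
    by apply: (le_trans (ler_normD _ _)); move: (`|z0 - z|) (`|z - w|) zr zw => a b; lra.
  by rewrite addrA subrK.
have r2 : 0 < 2 * r by rewrite mulr_gt0.
have rr2 : r < 2 * r by lra.
have := congr1 l (mean_value oU Cg Dg r2 zU (ltW r0) rr2).
rewrite lint linearZ -mulrA => /= /(congr1 ( *%R (r ^+ 4))).
rewrite [X in _ = _ * X]/GRing.scale /= => <-.
have mball := measurable_qball z0 (2 * r).
pose f w := bump (r^-1 *: (w - z)) * l (g w).
have cf w : ball z0 (2 * r) w -> {for w, continuous f}.
  rewrite -ball_normE /= => zw; apply: (@continuousM_at R (quat R) (fun w => bump (r^-1 *: (w - z)))).
    by apply: (@continuous_comp_at R (quat R) (quat R)); [exact: affine_continuous|exact: bump_continuous].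
  apply: (@continuous_comp_at R (quat R) (quat R) R g l); last exact: cl.
  by apply: (C1on_continuous Cg); apply: cballU; move: (`|_ - _|) zw r0 => a; lra.
have mf : measurable_fun setT (f \_ (ball z0 (2 * r)) : quat R -> R).
  apply/(measurable_restrictT _ mball).
  by apply: continuous_measurable_quat_real => //; exact: ball_open.
rewrite /bump_conv -/f [LHS]Rintegral_mkcond.
rewrite (Rintegral_qvol_similarity z r0 mf).
have cb x : `|x| <= 1 -> {for x, continuous (fun x => l (bump x *: g (z + r *: x)))}.
  move=> x1; apply: (@continuous_comp_at R (quat R) (quat R) R (fun x => bump x *: g (z + r *: x)) l); last exact: cl.
  apply: (@continuousZ_at R (quat R) (quat R) (@bump R)); first exact: bump_continuous.
  apply: (@continuous_comp_at R (quat R) (quat R) (quat R) (fun x => z + r *: x) g); first exact: aff_continuous.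
  apply: (C1on_continuous Cg); apply: zU; rewrite opprD addrA subrr add0r normrN normrZ gtr0_norm//.
  by rewrite mulrC; apply: ler_pM => //; [exact: ltW|move: (`|x|) x1 => a; lra].
rewrite -(RintegralZl (r ^+ 4) measurable_unit_ball (rintegrable_cball ltr01 cb)).
rewrite [RHS]Rintegral_mkcond; apply: eq_Rintegral => x _.
have rx : r^-1 *: (r *: x + z - z) = x by rewrite addrK scalerA mulVf ?gt_eqF// scale1r.
rewrite !patchE; case: ifPn => [_|]; last first.
  rewrite notin_setE => xD; case: ifPn => xB; last by rewrite mul0r.
  case: xD; rewrite -ball_normE /=; move: xB; rewrite inE => /ball_lt x1.
  rewrite (_ : z0 - (r *: x + z) = (z0 - z) - r *: x); last by rewrite opprD addrA addrAC.
  apply: (le_lt_trans (ler_normB _ _)); rewrite normrZ gtr0_norm//.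
  by have := ler_pM (ltW r0) (normr_ge0 x) (lexx r) (ltW x1); move: (`|z0 - z|) (`|x|) zr => a b; lra.
rewrite /f rx; case: ifPn; first by rewrite linearZ /= /GRing.scale /= mulrC (addrC z).
rewrite notin_setE => xB; have x1 : 1 <= `|x| by rewrite leNgt; apply/negP => /ball_lt.
by have [-> _] := bump_eq0 x1; rewrite !mul0r.
Qed.

End mean_value_convolution.

Section monogenic_limits.
Context {R : realType}.
Implicit Types (x v w z : quat R) (r e : R) (U : set (quat R)).

Lemma norm_components (p : quat R) e : `|qre p| <= e -> `|qi p| <= e -> `|qj p| <= e ->
  `|qk p| <= e -> `|p| <= 4 * e.
Proof.
move=> h0 h1 h2 h3; apply: (le_trans (qnorm_le_sum p)).
by move: h0 h1 h2 h3; move: (`|qre p|) (`|qi p|) (`|qj p|) (`|qk p|) => a b c d; lra.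
Qed.

(** The volume of the ball over which [mean_value_conv] integrates. *)
Definition conv_mass (z0 : quat R) r : R := fine (qvol (ball z0 (2 * r))).

Lemma conv_mass_ge0 z0 r : 0 <= conv_mass z0 r.
Proof. by rewrite fine_ge0. Qed.

Lemma subr_sum4 (V : zmodType) (x0 x1 x2 x3 y0 y1 y2 y3 : V) :
  x0 + x1 + x2 + x3 - (y0 + y1 + y2 + y3) = x0 - y0 + (x1 - y1) + (x2 - y2) + (x3 - y3).
Proof.
by rewrite !opprD (addrACA (x0 + x1 + x2)) (addrACA (x0 + x1)) (addrACA x0).
Qed.

Lemma norm_sum4 (x0 x1 x2 x3 : quat R) e : `|x0| <= e -> `|x1| <= e -> `|x2| <= e ->
  `|x3| <= e -> `|x0 + x1 + x2 + x3| <= e + e + e + e.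
Proof.
move=> h0 h1 h2 h3; apply: (le_trans (ler_normD _ x3)); apply: lerD => //.
apply: (le_trans (ler_normD _ x2)); apply: lerD => //.
by apply: (le_trans (ler_normD _ x1)); apply: lerD.
Qed.

Section estimate.
Variables (U : set (quat R)) (z0 : quat R) (r : R).
Hypothesis oU : open U.
Hypothesis r0 : 0 < r.
Hypothesis cballU : forall w, `|z0 - w| <= 3 * r -> U w.
Notation D := (ball z0 (2 * r)).

Lemma conv_ball_sub w : D w -> U w.
Proof.
by rewrite -ball_normE /= => zw; apply: cballU; move: (`|z0 - w|) zw r0 => a; lra.
Qed.

(** Point evaluations are bounded by the [L2] norm over a ball. The bound is
    stated for a given [e] and follows by integrating [t <= e / 2 + t^2 / (2 e)]
    with [t = |g w|]. *)
Lemma local_estimate g e : C1on U g -> (forall w, U w -> fueter g w = 0) -> 0 < e ->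
  (\int[qvol]_(w in D) (`|g w| ^+ 2)%:E <= (e ^+ 2)%:E)%E ->
  forall z, `|z0 - z| < r ->
  `|g z| <= 4 * ((conv_mass z0 r + 1) / (r ^+ 4 * bump_mass)) * e.
Proof.
move=> Cg Dg e0 ge z zr; have r2 : 0 < 2 * r by rewrite mulr_gt0.
have mD := measurable_qball z0 (2 * r); have Doo := qvol_ball_lty z0 r2.
have k0 : 0 < r ^+ 4 * @bump_mass R by rewrite mulr_gt0 ?exprn_gt0 ?bump_mass_gt0.
have cg w : D w -> {for w, continuous g} by move=> /conv_ball_sub; exact: C1on_continuous.
have mg : measurable_fun D g by apply: continuous_measurable_quat => //; exact: ball_open.
have mng : measurable_fun D (fun w => `|g w| ^+ 2).
  apply: measurable_funX; apply: continuous_measurable_quat_real; first exact: ball_open.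
  move=> w Dw; apply: (@continuous_comp_at R (quat R) (quat R) R g (fun q => `|q|)); first exact: cg.
  exact: (@lipschitz_continuous R (quat R) R (fun q => `|q|) (fun p q => ler_dist_dist p q)).
have I2 : rintegrable D (fun w => `|g w| ^+ 2).
  apply/integrableP; split; first exact/measurable_EFinP.
  under eq_integral do rewrite /= ger0_norm ?sqr_ge0//.
  by apply: (le_lt_trans ge); rewrite ltry.
have I1 : rintegrable D (fun=> e / 2).
  by apply: (rintegrable_bounded (M := `|e / 2|) mD Doo (measurable_cst _)).
have I3 := rintegrableD mD I1 (rintegrableZ mD ((2 * e)^-1) I2).
have amgm (t : R) : 0 <= t -> t <= e / 2 + (2 * e)^-1 * t ^+ 2.
  move=> t0; rewrite -subr_ge0 (_ : _ - t = (2 * e)^-1 * (t - e) ^+ 2); last by field; rewrite gt_eqF.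
  by rewrite mulr_ge0 ?sqr_ge0// invr_ge0 mulr_ge0// ltW.
have H (l : {linear quat R -> R}) : continuous l -> (forall q, `|l q| <= `|q|) ->
    (forall F, l (qintegral (@unit_ball R) F) = \int[qvol]_(x in @unit_ball R) l (F x)) ->
    `|l (g z)| <= (conv_mass z0 r + 1) / (r ^+ 4 * bump_mass) * e.
  move=> cl ll lint; have E := mean_value_conv oU Cg Dg r0 cballU cl lint zr.
  rewrite mulrAC ler_pdivlMr// -[X in _ * X](gtr0_norm k0) -normrM mulrC -E /bump_conv.
  have clg w : D w -> {for w, continuous (fun w => l (g w))}.
    by move=> Dw; apply: (@continuous_comp_at R (quat R) (quat R) R g l); [exact: cg|exact: cl].
  have ml : measurable_fun D (fun w => bump (r^-1 *: (w - z)) * l (g w)).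
    apply: continuous_measurable_quat_real; first exact: ball_open.
    move=> w Dw; apply: (@continuousM_at R (quat R) (fun w => bump (r^-1 *: (w - z)))); last exact: clg.
    by apply: (@continuous_comp_at R (quat R) (quat R)); [exact: affine_continuous|exact: bump_continuous].
  have bd w : D w -> `|bump (r^-1 *: (w - z)) * l (g w)| <= e / 2 + (2 * e)^-1 * `|g w| ^+ 2.
    move=> Dw; apply: le_trans (amgm _ (normr_ge0 (g w))).
    rewrite normrM (ger0_norm (bump_ge0 _)); apply: (le_trans _ (ll (g w))).
    by rewrite ler_piMl// bump_le1.
  have Il : rintegrable D (fun w => bump (r^-1 *: (w - z)) * l (g w)).
    apply: (le_integrable mD _ _ I3); first exact/measurable_EFinP.
    by move=> w Dw; rewrite /= lee_fin; apply: (le_trans (bd w Dw)); exact: ler_norm.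
  apply: (le_trans (le_normr_Rintegral mD Il)).
  apply: (@le_trans _ _ (\int[qvol]_(w in D) (e / 2 + (2 * e)^-1 * `|g w| ^+ 2))).
    by apply: le_Rintegral => //; exact: (integrable_norm Il).
  rewrite (RintegralD mD I1 (rintegrableZ mD ((2 * e)^-1) I2)) (RintegralZl _ mD I2) Rintegral_cst//.
  rewrite -/(conv_mass z0 r).
  have : \int[qvol]_(w in D) (`|g w| ^+ 2) <= e ^+ 2.
    by rewrite -lee_fin /Rintegral fineK//; exact: (integrable_fin_num mD I2).
  move: (\int[qvol]_(w in D) _) => J hJ.
  have : (2 * e)^-1 * J <= e / 2.
    rewrite mulrC ler_pdivrMr ?mulr_gt0//; apply: (le_trans hJ).
    by rewrite le_eqVlt; apply/orP; left; apply/eqP; field.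
  have := mulr_ge0 (conv_mass_ge0 z0 r) (ltW e0); move: (conv_mass z0 r) => V.
  move: ((2 * e)^-1 * J) => K; move: e0; lra.
rewrite -[leRHS]mulrA; apply: norm_components.
- exact: (H _ qre_continuous (@ler_norm_qre R)).
- exact: (H _ qi_continuous (@ler_norm_qi R)).
- exact: (H _ qj_continuous (@ler_norm_qj R)).
- exact: (H _ qk_continuous (@ler_norm_qk R)).
Qed.

End estimate.

Section limits.
Variables (U : set (quat R)) (g_ : nat -> quat R -> quat R) (g : quat R -> quat R).
Hypothesis oU : open U.
Hypothesis Cg : forall n, C1on U (g_ n).
Hypothesis Dg : forall n w, U w -> fueter (g_ n) w = 0.

Section local_limit.
Variables (z0 : quat R) (r : R).
Hypothesis r0 : 0 < r.
Hypothesis cballU : forall w, `|z0 - w| <= 3 * r -> U w.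
Notation D := (ball z0 (2 * r)).
Hypothesis ucvg : forall e, 0 < e -> exists N, forall n, (N <= n)%N -> forall w, D w ->
  `|g_ n w - g w| <= e.

Let r2 : 0 < 2 * r. Proof. by rewrite mulr_gt0. Qed.
Let ri : 0 < r^-1. Proof. by rewrite invr_gt0. Qed.
Let k0 : 0 < r ^+ 4 * @bump_mass R.
Proof. by rewrite mulr_gt0 ?exprn_gt0 ?bump_mass_gt0. Qed.

Section limit_component.
Variable l : {linear quat R -> R}.
Hypothesis cl : continuous l.
Hypothesis ll : forall q, `|l q| <= `|q|.
Hypothesis lint : forall F, l (qintegral (@unit_ball R) F) = \int[qvol]_(x in @unit_ball R) l (F x).

Lemma measurable_term n : measurable_fun D (fun w => l (g_ n w)).
Proof.
apply: continuous_measurable_quat_real; first exact: ball_open.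
move=> w Dw; apply: (@continuous_comp_at R (quat R) (quat R) R (g_ n) l); last exact: cl.
by apply: (C1on_continuous (Cg n)); exact: (conv_ball_sub r0 cballU).
Qed.

Lemma bounded_term n : exists M, forall w, D w -> `|l (g_ n w)| <= M.
Proof.
have [|M M0 hM] := @bounded_on_cball R (fun w => l (g_ n w)) z0 (3 * r).
  move=> w /cballU Uw; apply: (@continuous_comp_at R (quat R) (quat R) R (g_ n) l); last exact: cl.
  exact: (C1on_continuous (Cg n)).
exists M => w; rewrite -ball_normE /= => zw; apply: hM; move: (`|z0 - w|) zw r0 => a; lra.
Qed.

Lemma measurable_limit : measurable_fun D (fun w => l (g w)).
Proof.
apply: (measurable_fun_cvg (h := fun n w => l (g_ n w))); first exact: measurable_term.
move=> w Dw; apply/cvgrPdist_le => e /ucvg[N hN].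
exists N => // n /= Nn; rewrite distrC -linearB.
by apply: (le_trans (ll _)); exact: hN.
Qed.

Lemma bounded_limit : exists M, forall w, D w -> `|l (g w)| <= M.
Proof.
have [N hN] := ucvg ltr01; have [M hM] := bounded_term N.
exists (M + 1) => w Dw; rewrite (_ : l (g w) = l (g_ N w) - l (g_ N w - g w)).
  apply: (le_trans (ler_normB _ _)); apply: lerD; first exact: hM.
  by apply: (le_trans (ll _)); exact: hN.
by rewrite linearB opprB addrC subrK.
Qed.

(** The convolution identity passes to the uniform limit. *)
Lemma conv_limit z : `|z0 - z| < r ->
  l (g z) = (r ^+ 4 * bump_mass)^-1 * bump_conv z0 (2 * r) r^-1 (fun w => l (g w)) z.
Proof.
move=> zr; have mD := measurable_qball z0 (2 * r); have Doo := qvol_ball_lty z0 r2.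
have Dz : D z by rewrite -ball_normE /=; move: (`|_ - _|) zr r0 => a; lra.
apply: (mulfI (lt0r_neq0 k0)); rewrite mulVKf ?gt_eqF//; apply/eqP.
rewrite -subr_eq0 -normr_le0; apply/ler_addgt0Pr => e e0; rewrite add0r.
pose V := conv_mass z0 r; have V0 : 0 <= V := conv_mass_ge0 z0 r.
set k := r ^+ 4 * bump_mass.
have kV : 0 < k + V by rewrite ltr_pwDl.
have [N /(_ N (leqnn N)) hN] := ucvg (divr_gt0 e0 kV).
have E := mean_value_conv oU (Cg N) (@Dg N) r0 cballU cl lint zr.
set X := bump_conv _ _ _ _ _.
rewrite (_ : k * l (g z) - X = (bump_conv z0 (2 * r) r^-1 (fun w => l (g_ N w)) z - X) -
  k * l (g_ N z - g z)); last by rewrite E linearB /k; ring.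
apply: (@le_trans _ _ ((e / (k + V)) * V + k * (e / (k + V)))); last first.
  by rewrite mulrC -mulrDl addrC mulrC divfK ?gt_eqF.
apply: (le_trans (ler_normB _ _)); apply: lerD; last first.
  rewrite normrM (gtr0_norm k0) ler_pM2l//; apply: (le_trans (ll _)); exact: hN.
have [M1 h1] := bounded_term N; have [M2 h2] := bounded_limit.
have I1 := rintegrable_conv r^-1 r2 (measurable_term N) h1 z.
have I2 := rintegrable_conv r^-1 r2 measurable_limit h2 z.
rewrite /X /bump_conv -(RintegralB mD I1 I2).
apply: (Rintegral_bounded mD Doo).
  by apply/measurable_EFinP; have := integrableB mD I1 I2 => /measurable_int.
move=> w Dw; rewrite -mulrBr -linearB normrM (ger0_norm (bump_ge0 _)).
apply: (le_trans _ (hN w Dw)); apply: (le_trans _ (ll _)).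
by rewrite ler_piMl// bump_le1.
Qed.

Let ball_r : ball z0 r z0. Proof. exact: ballxx. Qed.

Lemma C1on_limit_component : C1on (ball z0 r) (fun w => l (g w)).
Proof.
have [M hM] := bounded_limit; have oB : open (ball z0 r) by exact: ball_open.
have C := bump_conv_C1 r2 ri measurable_limit hM.
apply: (C1on_eq oB (f := fun z => (r ^+ 4 * bump_mass)^-1 *
    bump_conv z0 (2 * r) r^-1 (fun w => l (g w)) z)).
  by move=> z; rewrite -ball_normE => zr; rewrite conv_limit.
by apply: (C1onM oB); [exact: C1on_cst|exact: C1on_sub C].
Qed.

Lemma derive_bump_conv (f : quat R -> quat R) v M : measurable_fun D (fun w => l (f w)) ->
  (forall w, D w -> `|l (f w)| <= M) ->
  (forall z, `|z0 - z| < r -> l (f z) =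
    (r ^+ 4 * bump_mass)^-1 * bump_conv z0 (2 * r) r^-1 (fun w => l (f w)) z) ->
  'D_v (fun w => l (f w)) z0 =
    (r ^+ 4 * bump_mass)^-1 * bump_conv' z0 (2 * r) r^-1 (fun w => l (f w)) z0 v.
Proof.
move=> mf bf E; have oB : open (ball z0 r) by exact: ball_open.
have [d <-] := bump_conv_diff r2 ri mf bf z0.
rewrite (@derive_eq_on R (quat R) R (ball z0 r) _ (fun z => (r ^+ 4 * bump_mass)^-1 *:
    bump_conv z0 (2 * r) r^-1 (fun w => l (f w)) z) v z0 oB ball_r); last first.
  by move=> z; rewrite -ball_normE => /E.
have dv : derivable (bump_conv z0 (2 * r) r^-1 (fun w => l (f w))) z0 v by exact: diff_derivable.
exact: (@deriveZ R (quat R) R _ (r ^+ 4 * bump_mass)^-1 z0 v dv).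
Qed.

(** The derivatives converge because both sides are convolutions, and the
    derivative of a convolution is bounded by the supremum of its density. *)
Lemma derive_limit v e : 0 < e -> exists N, forall n, (N <= n)%N ->
  `|'D_v (fun w => l (g_ n w)) z0 - 'D_v (fun w => l (g w)) z0| <= e.
Proof.
move=> e0; have mD := measurable_qball z0 (2 * r).
set k := (r ^+ 4 * bump_mass)^-1.
pose A := r^-1 * (4 * (r^-1 * (2 * r + `|z0 - z0|)) * `|v|) * conv_mass z0 r.
have ki : 0 < k by rewrite invr_gt0.
have A0 : 0 <= A.
  apply: mulr_ge0; last exact: conv_mass_ge0.
  apply: mulr_ge0; first exact: ltW.
  apply: mulr_ge0; last exact: normr_ge0.
  rewrite pmulr_rge0//; apply: mulr_ge0; first exact: ltW.
  by apply: addr_ge0 => //; exact: ltW.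
have kA : 0 < k * A + 1 by rewrite ltr_wpDl// mulr_ge0// ltW.
have [N hN] := ucvg (divr_gt0 e0 kA); exists N => n /hN {}hN.
have [M1 h1] := bounded_term n; have [M2 h2] := bounded_limit.
have E1 z : `|z0 - z| < r -> l (g_ n z) =
    k * bump_conv z0 (2 * r) r^-1 (fun w => l (g_ n w)) z.
  move=> zr; rewrite (mean_value_conv oU (Cg n) (@Dg n) r0 cballU cl lint zr).
  by rewrite mulKf// gt_eqF.
rewrite (derive_bump_conv v (measurable_term n) h1 E1).
rewrite (derive_bump_conv v measurable_limit h2 conv_limit) -/k -mulrBr normrM (gtr0_norm ki).
have hd w : D w -> `|l (g_ n w) - l (g w)| <= e / (k * A + 1).
  by move=> Dw; rewrite -linearB; apply: (le_trans (ll _)); exact: hN.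
have md : measurable_fun D (fun w => l (g_ n w) - l (g w)).
  by apply: measurable_funB; [exact: measurable_term|exact: measurable_limit].
have := bump_conv'_norm r2 ri md hd z0 v.
have I1 := rintegrable_conv' r2 ri (measurable_term n) h1 z0 v.
have I2 := rintegrable_conv' r2 ri measurable_limit h2 z0 v.
rewrite (_ : bump_conv' _ _ _ _ _ _ = bump_conv' z0 (2 * r) r^-1 (fun w => l (g_ n w)) z0 v -
    bump_conv' z0 (2 * r) r^-1 (fun w => l (g w)) z0 v); last first.
  rewrite /bump_conv' -(RintegralB mD I1 I2); apply: eq_Rintegral => w _; ring.
move=> h; apply: (@le_trans _ _ (k * (A * (e / (k * A + 1))))).
  rewrite ler_pM2l//; apply: (le_trans h).
  by rewrite le_eqVlt /A; apply/orP; left; apply/eqP; rewrite /conv_mass; ring.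
rewrite mulrA mulrA ler_pdivrMr// mulrC ler_pM2l// lerDl//.
Qed.

End limit_component.

Lemma C1on_limit_local : C1on (ball z0 r) g.
Proof.
apply: C1on_quat; first exact: ball_open.
- exact: (C1on_limit_component qre_continuous (@ler_norm_qre R)).
- exact: (C1on_limit_component qi_continuous (@ler_norm_qi R)).
- exact: (C1on_limit_component qj_continuous (@ler_norm_qj R)).
- exact: (C1on_limit_component qk_continuous (@ler_norm_qk R)).
Qed.

Lemma derive_limit_norm v e : 0 < e -> exists N, forall n, (N <= n)%N ->
  `|'D_v (g_ n) z0 - 'D_v g z0| <= e.
Proof.
move=> e0; have e4 : 0 < e / 4 by rewrite divr_gt0.
have dg : differentiable g z0 by apply: C1on_limit_local.1; exact: ballxx.
have Uz0 : U z0 by apply: cballU; rewrite subrr normr0 mulr_ge0// ltW.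
have K (l : {linear quat R -> R}) n : continuous l -> l ('D_v (g_ n) z0 - 'D_v g z0) =
    'D_v (fun w => l (g_ n w)) z0 - 'D_v (fun w => l (g w)) z0.
  by move=> cl; rewrite linearB (derive_lin v cl dg) (derive_lin v cl ((Cg n).1 z0 Uz0)).
have [N0 h0] := derive_limit qre_continuous (@ler_norm_qre R) (fun=> erefl) v e4.
have [N1 h1] := derive_limit qi_continuous (@ler_norm_qi R) (fun=> erefl) v e4.
have [N2 h2] := derive_limit qj_continuous (@ler_norm_qj R) (fun=> erefl) v e4.
have [N3 h3] := derive_limit qk_continuous (@ler_norm_qk R) (fun=> erefl) v e4.
exists (maxn (maxn N0 N1) (maxn N2 N3)) => n.
rewrite !geq_max => /andP[/andP[n0 n1] /andP[n2 n3]].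
have -> : e = 4 * (e / 4) by field.
apply: norm_components.
- by rewrite (K _ n qre_continuous); exact: h0.
- by rewrite (K _ n qi_continuous); exact: h1.
- by rewrite (K _ n qj_continuous); exact: h2.
- by rewrite (K _ n qk_continuous); exact: h3.
Qed.

Lemma fueter_limit : fueter g z0 = 0.
Proof.
have Uz0 : U z0 by apply: cballU; rewrite subrr normr0 mulr_ge0// ltW.
apply/eqP; rewrite -normr_le0; apply/ler_addgt0Pr => e e0; rewrite add0r.
have e4 : 0 < e / 4 by rewrite divr_gt0.
have [N0 h0] := derive_limit_norm 1 e4; have [N1 h1] := derive_limit_norm unit_i e4.
have [N2 h2] := derive_limit_norm unit_j e4; have [N3 h3] := derive_limit_norm unit_k e4.
pose n := maxn (maxn N0 N1) (maxn N2 N3).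
have n0 : (N0 <= n)%N by rewrite !leq_max leqnn.
have n1 : (N1 <= n)%N by rewrite !leq_max leqnn ?orbT.
have n2 : (N2 <= n)%N by rewrite !leq_max leqnn ?orbT.
have n3 : (N3 <= n)%N by rewrite !leq_max leqnn ?orbT.
have {}h0 := h0 n n0; have {}h1 := h1 n n1; have {}h2 := h2 n n2; have {}h3 := h3 n n3.
rewrite -normrN -[- _]add0r -(@Dg n _ Uz0) /fueter.
rewrite (_ : _ - _ = ('D_1 (g_ n) z0 - 'D_1 g z0) +
  unit_i * ('D_unit_i (g_ n) z0 - 'D_unit_i g z0) +
  unit_j * ('D_unit_j (g_ n) z0 - 'D_unit_j g z0) +
  unit_k * ('D_unit_k (g_ n) z0 - 'D_unit_k g z0)); last first.
  by rewrite !mulrBr; exact: subr_sum4.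
have -> : e = e / 4 + e / 4 + e / 4 + e / 4 by field.
have ui : `|unit_i : quat R| = 1.
  by rewrite quat_normE /qnormsq /= !expr0n /= expr1n addr0 add0r !addr0 sqrtr1.
have uj : `|unit_j : quat R| = 1.
  by rewrite quat_normE /qnormsq /= !expr0n /= expr1n !addr0 add0r sqrtr1.
have uk : `|unit_k : quat R| = 1.
  by rewrite quat_normE /qnormsq /= !expr0n /= expr1n !add0r sqrtr1.
have T (p q : quat R) t : `|p| = 1 -> `|q| <= t -> `|p * q| <= t.
  by move=> p1 qt; rewrite qnormM p1 mul1r.
exact: (norm_sum4 h0 (T _ _ _ ui h1) (T _ _ _ uj h2) (T _ _ _ uk h3)).
Qed.

End local_limit.

Hypothesis ucvg : forall z0, U z0 -> exists2 rho, 0 < rho & forall e, 0 < e ->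
  exists N, forall n, (N <= n)%N -> forall w, `|z0 - w| < rho -> `|g_ n w - g w| <= e.

(** The limit reproduces itself by convolution with the bump, hence is [C1], and
    its derivatives are the limits of the derivatives. *)
Lemma monogenic_limit : C1on U g /\ forall z, U z -> fueter g z = 0.
Proof.
have L z0 : U z0 -> exists2 r, 0 < r & C1on (ball z0 r) g /\ fueter g z0 = 0.
  move=> Uz0; have [rho rho0 hrho] := ucvg Uz0.
  have [s s0 hs] := open_contains_cball oU Uz0.
  pose r := Num.min rho s / 3; have r0 : 0 < r by rewrite divr_gt0// lt_min rho0.
  have r3 : 3 * r = Num.min rho s by rewrite /r mulrC divfK.
  have hU w : `|z0 - w| <= 3 * r -> U w.
    by rewrite r3 le_min => /andP[_ /hs].
  have hu e : 0 < e -> exists N, forall n, (N <= n)%N -> forall w, ball z0 (2 * r) w ->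
      `|g_ n w - g w| <= e.
    move=> /hrho[N hN]; exists N => n Nn w; rewrite -ball_normE /= => zw; apply: hN => //.
    have : 3 * r <= rho by rewrite r3 ge_min lexx.
    by move: (`|z0 - w|) zw r0 => a; lra.
  by exists r => //; split; [exact: (C1on_limit_local r0 hU hu)|exact: (fueter_limit r0 hU hu)].
split; last by move=> z /L[r _ []].
split=> [z|v z] /L[r r0 [[d c] _]]; first by apply: d; exact: ballxx.
by apply: c; exact: ballxx.
Qed.

End limits.
End monogenic_limits.

(** * Weighted square-integrable functions *)

Section weighted_L2.
Context {R : realType}.
Variables (D : set (quat R)) (gamma : quat R -> R).
Hypothesis mD : measurable D.
Hypothesis mgamma : measurable_fun D gamma.
Hypothesis gamma_ge0 : forall x, D x -> 0 <= gamma x.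
Implicit Types (f g h : quat R -> quat R) (q : quat R) (s t : R).

Lemma measurable_qnorm : measurable_fun setT (fun q : quat R => `|q|).
Proof.
apply: continuous_measurable_quat_real; first exact: openT.
move=> z _; exact: (@lipschitz_continuous R (quat R) R (fun q => `|q|) (fun p q => ler_dist_dist p q)).
Qed.

Lemma measurable_conj_mul f g : measurable_fun D f -> measurable_fun D g ->
  measurable_fun D (fun z => qconj (f z) * g z).
Proof.
move=> mf mg; apply: measurable_quat_mul => //.
apply: (measurableT_comp (f := @qconj R)) => //.
by apply: continuous_measurable_quat; [exact: openT|move=> z _; exact: qconj_continuous].
Qed.

Lemma measurable_energy f : measurable_fun D f -> measurable_fun D (fun z => gamma z * `|f z| ^+ 2).
Proof.
move=> mf; apply: measurable_funM => //; apply: measurable_funX.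
exact: (measurableT_comp measurable_qnorm mf).
Qed.

Lemma energy_ge0 f x : D x -> 0 <= gamma x * `|f x| ^+ 2.
Proof. by move=> Dx; rewrite mulr_ge0 ?sqr_ge0// gamma_ge0. Qed.

Lemma sq_integrableP f : sq_integrable gamma D f <->
  measurable_fun D f /\ rintegrable D (fun z => gamma z * `|f z| ^+ 2).
Proof.
split=> -[mf h]; split=> //.
  apply/integrableP; split; first by apply/measurable_EFinP; exact: measurable_energy.
  rewrite (eq_integral (fun z => (gamma z * `|f z| ^+ 2)%:E))// => x; rewrite inE => Dx.
  by rewrite /= ger0_norm// energy_ge0.
have /integrableP[_] := h; rewrite (eq_integral (fun z => (gamma z * `|f z| ^+ 2)%:E))// => x; rewrite inE => Dx.
by rewrite /= ger0_norm// energy_ge0.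
Qed.

Lemma sq_integrable_dominated f g h s t :
  measurable_fun D f -> sq_integrable gamma D g -> sq_integrable gamma D h ->
  (forall z, D z -> `|f z| ^+ 2 <= s * `|g z| ^+ 2 + t * `|h z| ^+ 2) ->
  sq_integrable gamma D f.
Proof.
move=> mf /sq_integrableP[_ Ig] /sq_integrableP[_ Ih] fgh; apply/sq_integrableP; split=> //.
have I := rintegrableD mD (rintegrableZ mD s Ig) (rintegrableZ mD t Ih).
apply: (le_integrable mD _ _ I); first by apply/measurable_EFinP; exact: measurable_energy.
move=> x Dx; rewrite /= lee_fin (ger0_norm (energy_ge0 _ Dx)); apply: le_trans (ler_norm _).
rewrite (_ : _ + _ = gamma x * (s * `|g x| ^+ 2 + t * `|h x| ^+ 2)); last by ring.
by apply: ler_wpM2l; [exact: gamma_ge0|exact: fgh].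
Qed.

Lemma sq_integrable0 : sq_integrable gamma D (fun=> 0).
Proof.
split; first exact: measurable_cst.
rewrite (eq_integral (cst 0%E)) ?integral0// => x _.
by rewrite normr0 expr0n mulr0.
Qed.

Lemma sq_integrableD f g : sq_integrable gamma D f -> sq_integrable gamma D g ->
  sq_integrable gamma D (fun z => f z + g z).
Proof.
move=> hf hg; apply: (sq_integrable_dominated (s := 2) (t := 2) _ hf hg) => [|z _].
  by apply: measurable_quat_add => //; [exact: hf.1|exact: hg.1].
have := ler_normD (f z) (g z); have := normr_ge0 (f z + g z).
move: (`|f z|) (`|g z|) (`|f z + g z|) => a b c c0 cab.
apply: (@le_trans _ _ ((a + b) ^+ 2)); first by rewrite ler_pXn2r ?nnegrE//; lra.
rewrite -subr_ge0 (_ : _ - _ = (a - b) ^+ 2) ?sqr_ge0//; ring.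
Qed.

Lemma sq_integrableMr f q : sq_integrable gamma D f -> sq_integrable gamma D (fun z => f z * q).
Proof.
move=> hf; apply: (sq_integrable_dominated (s := `|q| ^+ 2) (t := 0) _ hf hf) => [|z _].
  by apply: measurable_quat_mul => //; exact: hf.1.
by rewrite qnormM exprMn mul0r addr0 mulrC.
Qed.

Lemma sq_integrableB f g : sq_integrable gamma D f -> sq_integrable gamma D g ->
  sq_integrable gamma D (fun z => f z - g z).
Proof.
move=> hf hg; have := sq_integrableD hf (sq_integrableMr (-1) hg).
by under [X in sq_integrable _ _ X -> _]eq_fun do rewrite mulrN1.
Qed.

(** The inner product and the squared norm, on arbitrary functions: they are
    [inner] and [inner_norm] squared on all spaces of weight [gamma] on [D]. *)
Definition ip f g : quat R := qintegral D (fun z => gamma z *: (qconj (f z) * g z)).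
Definition normsq f : R := \int[qvol]_(z in D) (gamma z * `|f z| ^+ 2).

Lemma qintegrable_ip f g : sq_integrable gamma D f -> sq_integrable gamma D g ->
  qintegrable D (fun z => gamma z *: (qconj (f z) * g z)).
Proof.
move=> /sq_integrableP[mf If] /sq_integrableP[mg Ig].
have I := rintegrableD mD If Ig.
apply: (qintegrable_dominated mD _ I).
  have [m0 m1 m2 m3] := measurable_fun_quatP (measurable_conj_mul mf mg).
  by apply: measurable_fun_quat => //; apply: measurable_funM.
move=> x Dx; rewrite normrZ (ger0_norm (gamma_ge0 Dx)) -mulrDr ler_wpM2l ?gamma_ge0//.
rewrite qnormM qnorm_conj; move: (normr_ge0 (f x)) (normr_ge0 (g x)).
move: (`|f x|) (`|g x|) => a b a0 b0; have := sqr_ge0 (a - b); rewrite sqrrB.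
have := mulr_ge0 a0 b0; move: (a ^+ 2) (b ^+ 2) (a * b) => *; lra.
Qed.

Lemma ipC f g : sq_integrable gamma D f -> sq_integrable gamma D g -> ip g f = qconj (ip f g).
Proof.
move=> hf hg; rewrite /ip -(qintegral_conj mD (qintegrable_ip hf hg)).
by apply: eq_qintegral => z _; rewrite qconjZ qconjM qconjK.
Qed.

Lemma ipDr f g h : sq_integrable gamma D f -> sq_integrable gamma D g -> sq_integrable gamma D h ->
  ip f (fun z => g z + h z) = ip f g + ip f h.
Proof.
move=> hf hg hh; rewrite /ip -(qintegralD mD (qintegrable_ip hf hg) (qintegrable_ip hf hh)).
by apply: eq_qintegral => z _; rewrite mulrDr scalerDr.
Qed.

Lemma ipMr f g q : sq_integrable gamma D f -> sq_integrable gamma D g ->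
  ip f (fun z => g z * q) = ip f g * q.
Proof.
move=> hf hg; rewrite /ip -(qintegralMr mD q (qintegrable_ip hf hg)).
by apply: eq_qintegral => z _; rewrite mulrA scalerAl.
Qed.

Lemma ip_self f : ip f f = (normsq f)%:A.
Proof.
have Z (l : quat R -> R) : (forall q, l (gamma q *: (qconj (f q) * f q)) = 0) ->
    \int[qvol]_(z in D) l (gamma z *: (qconj (f z) * f z)) = 0.
  by move=> l0; under eq_Rintegral do rewrite l0; rewrite /Rintegral integral0.
apply: quat_ext.
- rewrite [RHS]mulr1; apply: eq_Rintegral => z _.
  by rewrite qnorm_sqr /qnormsq /=; ring.
- by rewrite [RHS]mulr0; apply: Z => z /=; ring.
- by rewrite [RHS]mulr0; apply: Z => z /=; ring.
- by rewrite [RHS]mulr0; apply: Z => z /=; ring.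
Qed.

Lemma normsq_ge0 f : 0 <= normsq f.
Proof. by apply: Rintegral_ge0 => z Dz; exact: energy_ge0. Qed.

Lemma normsqE f : sq_integrable gamma D f ->
  (\int[qvol]_(z in D) (gamma z * `|f z| ^+ 2)%:E)%E = (normsq f)%:E.
Proof.
by move=> /sq_integrableP[_ If]; rewrite /normsq /Rintegral fineK//; exact: (integrable_fin_num mD If).
Qed.

End weighted_L2.

(** * Hyperholomorphic functions and exponential factors *)

Section exponential_factor.
Context {R : realType}.
Implicit Types (p u v w z : quat R) (f g : quat R -> quat R) (U : set (quat R)).

Definition qexpdot p z : R := expR (qdot p z).

Lemma qexpdot_gt0 p z : 0 < qexpdot p z. Proof. exact: expR_gt0. Qed.

Lemma qexpdotN p z : qexpdot (- p) z * qexpdot p z = 1.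
Proof.
rewrite /qexpdot -expRD (_ : _ + _ = 0) ?expR0// /qdot /=; ring.
Qed.

Lemma C1on_qexpdot U p : open U -> C1on U (qexpdot p).
Proof.
move=> oU; apply: (C1on_expR oU); have := C1on_qdot p oU.
by rewrite (_ : (fun x => qdot x p) = qdot p)//; apply/funext => x; rewrite qdotC.
Qed.

Lemma derive_qexpdot p v z : 'D_v (qexpdot p) z = qdot p v * qexpdot p z.
Proof.
have E : (fun x => qdot x p) = qdot p by apply/funext => x; rewrite qdotC.
have df : differentiable (qdot p) z by rewrite -E; exact: (C1on_qdot p openT).1.
rewrite [LHS](derive_expR_comp v df) mulrC; congr (_ * _).
by rewrite -E derive_qdot qdotC.
Qed.

(** The gradient of the exponential contributes [\sum_k e_k <p, e_k> = p]: an
    exponential factor shifts the potential by a constant. *)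
Lemma fueter_qexpdot p f z : differentiable f z ->
  fueter (fun w => qexpdot p w *: f w) z = qexpdot p z *: (fueter f z + p * f z).
Proof.
move=> df; have dk : differentiable (qexpdot p) z := (C1on_qexpdot p openT).1 z I.
have dkA : differentiable (fun w => qexpdot p w *: (1 : quat R)) z.
  by apply: differentiableZl.
have E v : 'D_v (fun w => qexpdot p w *: f w) z =
    qexpdot p z *: ((qdot p v)%:A * f z + 'D_v f z).
  rewrite (_ : (fun w => _) = fun w => (qexpdot p w)%:A * f w); last first.
    by apply/funext => w; rewrite -scalerAl mul1r.
  rewrite derive_qmul//.
  have -> : 'D_v (fun w => qexpdot p w *: (1 : quat R)) z = (qdot p v * qexpdot p z)%:A.
    by rewrite deriveE// diffZl//= -(deriveE v dk) derive_qexpdot.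
  by rewrite -!scalerAl !mul1r scalerDr scalerA (mulrC (qdot p v)).
rewrite /fueter !E -!scalerAr -!scalerDr; congr (_ *: _).
rewrite !mulrDr.
rewrite (addr_sum4 _ _ _ _ _ _ _ _) addrC; congr (_ + _).
rewrite !mulrA -!mulrDl; congr (_ * _).
by rewrite [RHS]quat_decomp /qdot -!scalerAr !mulr1; congr Quat => /=; ring.
Qed.

Lemma fueterD f g z : differentiable f z -> differentiable g z ->
  fueter (fun w => f w + g w) z = fueter f z + fueter g z.
Proof.
move=> df dg.
have E v : 'D_v (fun w => f w + g w) z = 'D_v f z + 'D_v g z.
  have f' : derivable f z v by exact: diff_derivable.
  have g' : derivable g z v by exact: diff_derivable.
  exact: deriveD f' g'.
by rewrite /fueter !E !mulrDr addr_sum4.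
Qed.

Lemma fueterMr f q z : differentiable f z -> fueter (fun w => f w * q) z = fueter f z * q.
Proof. by move=> df; rewrite /fueter !derive_qmulr// !mulrDl !mulrA. Qed.

Lemma hyperholE theta (delta : quat R -> quat R) U f : open U ->
  hyperhol theta delta U f <->
  C1on U f /\ forall z, U z -> fueter f z + delta z * f z = 0.
Proof.
move=> oU; split=> -[Cf Df]; split=> // z Uz.
  by rewrite -(Dtheta_fueter theta (Cf.1 z Uz)); exact: Df.
by rewrite (Dtheta_fueter theta (Cf.1 z Uz)); exact: Df.
Qed.

Section closure_properties.
Variables (theta : R) (delta : quat R -> quat R) (U : set (quat R)).
Hypothesis oU : open U.

Lemma hyperhol0 : hyperhol theta delta U (fun=> 0).
Proof.
apply: (hyperholE theta delta _ oU).2; split; first exact: (@C1on_cst R (quat R) (quat R) U 0).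
move=> z _; rewrite mulr0 addr0 /fueter.
have E v : 'D_v (fun _ : quat R => 0 : quat R) z = 0 by rewrite derive_cst.
by rewrite !E !mulr0 !addr0.
Qed.

Lemma hyperholD f g : hyperhol theta delta U f -> hyperhol theta delta U g ->
  hyperhol theta delta U (fun z => f z + g z).
Proof.
move=> /((hyperholE theta delta f oU).1)[Cf Df] /((hyperholE theta delta g oU).1)[Cg Dg].
apply: (hyperholE theta delta _ oU).2.
split; first exact: C1onD.
move=> z Uz; rewrite fueterD; [|exact: Cf.1|exact: Cg.1].
by rewrite mulrDr addrACA Df// Dg// addr0.
Qed.

Lemma hyperholMr f q : hyperhol theta delta U f -> hyperhol theta delta U (fun z => f z * q).
Proof.
move=> /((hyperholE theta delta f oU).1)[Cf Df]; apply: (hyperholE theta delta _ oU).2.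
split; first by apply: C1on_qmul => //; exact: C1on_cst.
by move=> z Uz; rewrite fueterMr; [rewrite mulrA -mulrDl Df// mul0r|exact: Cf.1].
Qed.

Lemma hyperholB f g : hyperhol theta delta U f -> hyperhol theta delta U g ->
  hyperhol theta delta U (fun z => f z - g z).
Proof.
move=> hf hg; have := hyperholD hf (hyperholMr (-1) hg).
by under [X in hyperhol _ _ _ X -> _]eq_fun do rewrite mulrN1.
Qed.

End closure_properties.
End exponential_factor.

(** * Reproducing kernels of Bergman spaces *)

Section bergman_theory.
Context {R : realType}.
Variables (theta : R) (delta : quat R -> quat R) (gamma : quat R -> R) (U : set (quat R)).
Hypothesis oU : open U.
Hypothesis mgamma : measurable_fun U gamma.
Hypothesis gamma_ge0 : forall x, U x -> 0 <= gamma x.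
Implicit Types (f g h : quat R -> quat R) (q z w : quat R) (s t e : R).

Let mU : measurable U := measurable_open_quat oU.
Notation X := (bergman_space theta delta gamma U).
Notation normsq := (normsq U gamma).
Notation ip := (ip U gamma).

Lemma normsqD f g : sq_integrable gamma U f -> sq_integrable gamma U g ->
  normsq (fun z => f z + g z) = normsq f + 2 * qre (ip f g) + normsq g.
Proof.
move=> hf hg; have [_ If] := (sq_integrableP mgamma gamma_ge0 f).1 hf.
have [_ Ig] := (sq_integrableP mgamma gamma_ge0 g).1 hg.
have [Ifg _ _ _] := qintegrable_ip mU mgamma gamma_ge0 hf hg.
apply: (eq_lin4_integral mU (c0 := 1) (c1 := 2) (c2 := 1) (c3 := 0) If Ifg Ig Ig).
  by move=> z; rewrite !qnorm_sqr /qnormsq /=; ring.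
by rewrite mul1r mul1r mul0r addr0.
Qed.

Lemma normsqMr f q : sq_integrable gamma U f ->
  normsq (fun z => f z * q) = `|q| ^+ 2 * normsq f.
Proof.
move=> hf; have [_ If] := (sq_integrableP mgamma gamma_ge0 f).1 hf.
rewrite /normsq -(RintegralZl _ mU If); apply: eq_Rintegral => z _.
by rewrite qnormM; ring.
Qed.

Lemma parallelogram f g : sq_integrable gamma U f -> sq_integrable gamma U g ->
  normsq (fun z => f z + g z) + normsq (fun z => f z - g z) = 2 * normsq f + 2 * normsq g.
Proof.
move=> hf hg; rewrite normsqD//.
have hN := sq_integrableMr mU mgamma gamma_ge0 (-1) hg.
have -> : (fun z => f z - g z) = (fun z => f z + g z * -1).
  by apply/funext => z; rewrite mulrN1.
rewrite normsqD// (ipMr mU mgamma gamma_ge0)// mulrN1 (normsqMr _ hg) normrN qnorm1 expr1n.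
by rewrite linearN; ring.
Qed.

Lemma bergman_memD f g : fs_mem X f -> fs_mem X g -> fs_mem X (fun z => f z + g z).
Proof.
move=> [hf sf] [hg sg]; split; first exact: hyperholD.
exact: sq_integrableD.
Qed.

Lemma bergman_memM f q : fs_mem X f -> fs_mem X (fun z => f z * q).
Proof.
move=> [hf sf]; split; first exact: hyperholMr.
exact: sq_integrableMr.
Qed.

Lemma bergman_memB f g : fs_mem X f -> fs_mem X g -> fs_mem X (fun z => f z - g z).
Proof.
move=> [hf sf] [hg sg]; split; first exact: hyperholB.
exact: sq_integrableB.
Qed.

Lemma bergman_mem0 : fs_mem X (fun=> 0).
Proof. by split; [exact: hyperhol0|exact: sq_integrable0]. Qed.

Lemma inner_normE f : inner_norm X f = Num.sqrt (normsq f).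
Proof. by rewrite /inner_norm [inner X f f]ip_self /= mulr1. Qed.

Lemma inner_norm_lt f e : 0 < e -> inner_norm X f < e -> normsq f <= e ^+ 2.
Proof.
move=> e0; rewrite inner_normE => /ltW h.
rewrite -[leLHS]sqr_sqrtr; last exact: normsq_ge0.
by rewrite ler_pXn2r// nnegrE; [exact: sqrtr_ge0|exact: ltW].
Qed.

Lemma inner_norm_le f e : 0 <= e -> normsq f <= e ^+ 2 -> inner_norm X f <= e.
Proof.
by move=> e0 h; rewrite inner_normE -[leRHS]ger0_norm// -sqrtr_sqr ler_wsqrtr.
Qed.

(** Bounded point evaluations and completeness are the two analytic facts from
    which the Hilbert space structure, the existence of the kernel and its
    uniqueness follow. As in [local_estimate], the bound is in terms of an
    upper estimate [e] of the norm. *)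
Definition eval_bounded := forall z, U z -> exists2 C, 0 <= C & forall f e,
  fs_mem X f -> 0 < e -> normsq f <= e ^+ 2 -> `|f z| <= C * e.

Definition complete_space := forall F : nat -> quat R -> quat R,
    (forall n, fs_mem X (F n)) ->
    (forall e : R, 0 < e -> exists N : nat, forall m n : nat,
      (N <= m)%N -> (N <= n)%N -> inner_norm X (fun z => F m z - F n z) < e) ->
    exists2 f, fs_mem X f &
      inner_norm X (fun z => F n z - f z) @[n --> \oo] --> (0 : R).

Hypothesis Xeval : eval_bounded.
Hypothesis Xcomplete : complete_space.

Lemma small_eval_eq0 f z : fs_mem X f -> U z -> (forall e, 0 < e -> normsq f <= e ^+ 2) -> f z = 0.
Proof.
move=> hf /Xeval[C C0 hC] small; apply/eqP; rewrite -normr_le0; apply/ler_addgt0Pr => e e0.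
rewrite add0r; have C1 : 0 < C + 1 by rewrite ltr_wpDl.
have d0 : 0 < e / (C + 1) by rewrite divr_gt0.
apply: (le_trans (hC f _ hf d0 (small _ d0))).
by rewrite mulrA ler_pdivrMr// mulrC ler_pM2l// lerDl.
Qed.

Lemma bergman_right_hilbert : right_hilbert X.
Proof.
split.
- exact: bergman_mem0.
- exact: bergman_memD.
- exact: bergman_memM.
- by move=> f g [_ hf] [_ hg]; exact: (ipC mU mgamma gamma_ge0 hf hg).
- by move=> f g h [_ hf] [_ hg] [_ hh]; exact: (ipDr mU mgamma gamma_ge0 hf hg hh).
- by move=> f g q [_ hf] [_ hg]; exact: (ipMr mU mgamma gamma_ge0 q hf hg).
- by move=> f _; rewrite [inner X f f]ip_self /= mulr1; exact: normsq_ge0.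
- move=> f hf; rewrite [inner X f f]ip_self => /(congr1 (@qre R)); rewrite /= mulr1 => n0 z Uz.
  by apply: small_eval_eq0 => // e e0; rewrite n0 sqr_ge0.
- exact: Xcomplete.
Qed.

Section riesz.
Variable z : quat R.
Hypothesis Uz : U z.

Let unit_value := [set s | exists2 f, fs_mem X f & f z = 1 /\ normsq f = s].

(** The functions with value [1] at [z] form a convex set, closed because
    evaluation is bounded; it has an element of minimal norm, the limit of any
    minimizing sequence by the parallelogram law. *)
Lemma minimizer f1 : fs_mem X f1 -> f1 z != 0 ->
  exists2 f0, fs_mem X f0 & f0 z = 1 /\
    forall f, fs_mem X f -> f z = 1 -> normsq f0 <= normsq f.
Proof.
move=> hf1 f1z; have nS : unit_value !=set0.
  exists (normsq (fun w => f1 w * (f1 z)^-1)); exists (fun w => f1 w * (f1 z)^-1).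
    exact: bergman_memM.
  by split=> //; rewrite quat_mulfV.
have lS : lbound unit_value 0 by move=> _ [f _ [_ <-]]; exact: normsq_ge0.
have iS : has_inf unit_value by split=> //; exists 0.
pose m := inf unit_value.
have mS f : fs_mem X f -> f z = 1 -> m <= normsq f.
  by move=> hf fz; apply: ge_inf; [exists 0|exists f].
have /choice[F hF] (n : nat) : exists f, [/\ fs_mem X f, f z = 1 & normsq f < m + n.+1%:R^-1].
  have n0 : 0 < n.+1%:R^-1 :> R by rewrite invr_gt0.
  by have [_ [f hf [fz <-]] lt] := inf_adherent n0 iS; exists f.
have FX n : fs_mem X (F n) by have [] := hF n.
have Fz n : F n z = 1 by have [] := hF n.
have Fm n : normsq (F n) < m + n.+1%:R^-1 by have [] := hF n.
have harch e : 0 < e -> exists N : nat, forall n, (N <= n)%N -> n.+1%:R^-1 < e.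
  move=> e0; have [N _ hN] := near_infty_natSinv_lt (PosNum e0).
  by exists N => n Nn; exact: hN.
have cauchyF e : 0 < e -> exists N : nat, forall i j : nat,
    (N <= i)%N -> (N <= j)%N -> inner_norm X (fun z => F i z - F j z) < e.
  move=> e0; have e2 : 0 < (e / 2) ^+ 2 / 4 by rewrite divr_gt0// exprn_gt0// divr_gt0.
  have [N hN] := harch _ e2; exists N => i j /hN Ni /hN Nj.
  apply: (@le_lt_trans _ _ (e / 2)); last by rewrite ltr_pdivrMr// ltr_pMr// ltr1n.
  apply: inner_norm_le; first by rewrite divr_ge0// ltW.
  have := parallelogram (FX i).2 (FX j).2.
  have hS := bergman_memD (FX i) (FX j).
  have := mS _ (bergman_memM (2^-1%:A) hS); rewrite !Fz normsqMr; last exact: hS.2.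
  rewrite (_ : (1 + 1) * 2^-1%:A = 1 :> quat R); last first.
    by congr Quat => /=; rewrite ?mulr0 ?mulr1; lra.
  rewrite normrZ qnorm1 mulr1 ger0_norm ?invr_ge0// => /(_ erefl).
  have := Fm i; have := Fm j; move: Ni Nj.
  move: (normsq (F i)) (normsq (F j)) (normsq _) (normsq _) (i.+1%:R^-1) (j.+1%:R^-1).
  move: ((e / 2) ^+ 2) => E a b c d x y; rewrite expr2 -invfM; lra.
have [f0 hf0 cv] := Xcomplete FX cauchyF.
have small e : 0 < e -> exists N : nat, forall n, (N <= n)%N ->
    normsq (fun w => F n w - f0 w) <= e ^+ 2.
  move=> e0; have [N _ hN] := (cvgrPdist_lt _ _).1 cv e e0; exists N => n Nn.
  apply: inner_norm_lt => //; have := hN n Nn; rewrite sub0r normrN.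
  by move=> h; apply: le_lt_trans h; exact: ler_norm.
have f0z : f0 z = 1.
  apply/esym/eqP; rewrite -subr_eq0 -normr_le0; apply/ler_addgt0Pr => e e0; rewrite add0r.
  have [C C0 hC] := Xeval Uz; have C1 : 0 < C + 1 by rewrite ltr_wpDl.
  have d0 : 0 < e / (C + 1) by rewrite divr_gt0.
  have [N /(_ N (leqnn N)) hN] := small _ d0.
  have := hC _ _ (bergman_memB (FX N) hf0) d0 hN; rewrite Fz => h; apply: (le_trans h).
  by rewrite mulrA ler_pdivrMr// mulrC ler_pM2l// lerDl.
exists f0 => //; split=> // f hf fz; apply: le_trans (mS f hf fz).
apply/ler_addgt0Pr => e e0.
have e4 : 0 < e / 4 by rewrite divr_gt0.
have s4 : 0 < Num.sqrt (e / 4) by rewrite sqrtr_gt0.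
(* With [d = F n - f0], minimality bounds [F n + d] from below, since this
   function has value [1] at [z], and then the parallelogram law bounds
   [f0 = F n - d] from above. *)
have [N1 h1] := small _ s4; have [N2 h2] := harch _ e4.
pose n := maxn N1 N2.
have := h1 n (leq_maxl _ _); rewrite sqr_sqrtr; last exact: ltW.
have := h2 n (leq_maxr _ _); have := Fm n.
have hd := bergman_memB (FX n) hf0.
have := parallelogram (FX n).2 hd.2.
have := mS _ (bergman_memD (FX n) hd); rewrite Fz f0z subrr addr0 => /(_ erefl).
have -> : (fun w => F n w - (F n w - f0 w)) = f0.
  by apply/funext => w; rewrite opprB addrC subrK.
move: (normsq f0) (normsq (F n)) (normsq _) (normsq _) (n.+1%:R^-1) => a b c d x; lra.
Qed.

(** The Riesz representation of evaluation at [z]. The element [f0] of minimal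
    norm with [f0 z = 1] is orthogonal to all functions vanishing at [z], and
    every [f] is the sum of such a function and of [f0 * f z]. *)
Lemma reproducing_element : exists2 k, fs_mem X k & forall f, fs_mem X f -> ip k f = f z.
Proof.
have [all0|] := pselect (forall f, fs_mem X f -> f z = 0).
  exists (fun=> 0); first exact: bergman_mem0.
  move=> f hf; rewrite all0// /ip.
  have r0 : ip (fun=> 0) f = ip (fun=> 0) (fun w => f w * 0).
    by apply: eq_qintegral => w _; rewrite (_ : qconj 0 = 0) ?mul0r// linear0.
  by rewrite -/(ip _ f) r0 (ipMr mU mgamma gamma_ge0) ?mulr0//; [exact: bergman_mem0.2|exact: hf.2].
move=> /existsNP[f1 /not_implyP[hf1 /eqP f1z]].
have [f0 hf0 [f0z fmin]] := minimizer hf1 f1z.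
(* Compare [f0] with [f0 + h q] for [q = - t conj p] and a small [t > 0]. *)
have orth h : fs_mem X h -> h z = 0 -> ip f0 h = 0.
  move=> hh hz; set p := ip f0 h; pose N := normsq h.
  have N0 : 0 <= N by exact: normsq_ge0.
  pose t := (N + 1)^-1; have N1 : 0 < N + 1 by rewrite ltr_wpDl.
  have hq := bergman_memM (- t *: qconj p) hh.
  have := fmin _ (bergman_memD hf0 hq); rewrite hz mul0r addr0 f0z => /(_ erefl).
  rewrite (normsqD hf0.2 hq.2) (normsqMr _ hh.2) (ipMr mU mgamma gamma_ge0 _ hf0.2 hh.2).
  rewrite -/p -/N -scalerAr qconjMr normrZ normrN qnorm_conj exprMn -qnorm_sqr /= mulr1.
  rewrite real_normK ?num_real// -addrA lerDl => ineq.
  apply/eqP; rewrite -normr_eq0 -sqrf_eq0 eq_le sqr_ge0 andbT leNgt; apply/negP => p0.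
  move: ineq; rewrite (_ : _ + _ = `|p| ^+ 2 * t * (t * N - 2)); last by ring.
  rewrite pmulr_rge0; last by rewrite mulr_gt0// invr_gt0.
  rewrite subr_ge0 leNgt => /negP; apply.
  by rewrite /t mulrC ltr_pdivrMr// mulrDr mulr1; move: N0; lra.
have nf0 : normsq f0 != 0.
  apply/eqP => n0; have : f0 z = 0.
    by apply: small_eval_eq0 => // e e0; rewrite n0 sqr_ge0.
  by move/eqP; rewrite f0z oner_eq0.
exists (fun w => f0 w * (normsq f0)^-1%:A); first exact: bergman_memM.
move=> f hf; have hk := bergman_memM (normsq f0)^-1%:A hf0.
have hd := bergman_memB hf (bergman_memM (f z) hf0).
have E : ip f0 f = (normsq f0)%:A * f z.
  rewrite (_ : f = (fun w => (f w - f0 w * f z) + f0 w * f z)); last first.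
    by apply/funext => w; rewrite subrK.
  rewrite (ipDr mU mgamma gamma_ge0 hf0.2 hd.2 (bergman_memM (f z) hf0).2).
  by rewrite orth ?add0r// ?(ipMr mU mgamma gamma_ge0 _ hf0.2 hf0.2) ?ip_self ?subrK// f0z mul1r subrr.
rewrite (ipC mU mgamma gamma_ge0 hf.2 hk.2) (ipMr mU mgamma gamma_ge0 _ hf.2 hf0.2).
rewrite qconjM (ipC mU mgamma gamma_ge0 hf0.2 hf.2) qconjK E.
have -> : qconj (normsq f0)^-1%:A = (normsq f0)^-1%:A :> quat R.
  by congr Quat => /=; rewrite mulr0 oppr0.
by rewrite mulrA -scalerAl mul1r scalerA mulVf// scale1r mul1r.
Qed.

End riesz.

Lemma bergman_kernel_exists : exists K, bergman_kernel X K.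
Proof.
have /choice[k hk] z : exists k, U z -> fs_mem X k /\ forall f, fs_mem X f -> ip k f = f z.
  have [Uz|nUz] := pselect (U z); last by exists (fun=> 0).
  by have [k hk kf] := reproducing_element Uz; exists k.
exists (fun z w => qconj (k z w)); split=> [z Uz|f z hf Uz].
  by under eq_fun do rewrite qconjK; have [] := hk z Uz.
by have [_ /(_ f hf) <-] := hk z Uz.
Qed.

Lemma bergman_kernel_unique K K' : bergman_kernel X K -> bergman_kernel X K' ->
  forall z w, U z -> U w -> K z w = K' z w.
Proof.
move=> [K1 K2] [K1' K2'] z w Uz Uw; pose k w := qconj (K z w); pose k' w := qconj (K' z w).
have hk : fs_mem X k := K1 z Uz; have hk' : fs_mem X k' := K1' z Uz.
have rep f : fs_mem X f -> ip k f = f z.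
  move=> hf; rewrite (K2 f z hf Uz); apply: eq_qintegral => x _; by rewrite /k qconjK.
have rep' f : fs_mem X f -> ip k' f = f z.
  move=> hf; rewrite (K2' f z hf Uz); apply: eq_qintegral => x _; by rewrite /k' qconjK.
have hd := bergman_memB hk hk'.
have d0 : ip (fun x => k x - k' x) (fun x => k x - k' x) = 0.
  set d := fun x => k x - k' x.
  rewrite {2}/d (_ : (fun x => k x - k' x) = (fun x => k x + k' x * -1)); last first.
    by apply/funext => x; rewrite mulrN1.
  rewrite (ipDr mU mgamma gamma_ge0 hd.2 hk.2 (bergman_memM _ hk').2).
  rewrite (ipMr mU mgamma gamma_ge0 _ hd.2 hk'.2).
  rewrite (ipC mU mgamma gamma_ge0 hk.2 hd.2) (ipC mU mgamma gamma_ge0 hk'.2 hd.2).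
  by rewrite rep// rep'// mulrN1 subrr.
have := rh_inner_eq0 bergman_right_hilbert hd d0 _ Uw.
by move/eqP; rewrite subr_eq0 => /eqP/(congr1 (@qconj R)); rewrite /k /k' !qconjK.
Qed.

End bergman_theory.

(** * Bergman spaces with a constant potential *)

Section quat_limits.
Context {R : realType}.

Lemma real_cauchy_limit (x : nat -> R) :
  (forall e, 0 < e -> exists N : nat, forall m n, (N <= m)%N -> (N <= n)%N -> `|x m - x n| <= e) ->
  exists p, forall e (N : nat), (forall m n, (N <= m)%N -> (N <= n)%N -> `|x m - x n| <= e) ->
    forall n, (N <= n)%N -> `|x n - p| <= e.
Proof.
move=> hx; have cx : cvgn x.
  apply/cauchy_cvgP/cauchy_exP => e e0; have e2 : 0 < e / 2 by rewrite divr_gt0.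
  have [N hN] := hx _ e2; exists (x N); exists N => // n /= Nn.
  rewrite -ball_normE /=; apply: (le_lt_trans (hN N n _ Nn)) => //.
  by rewrite ltr_pdivrMr// ltr_pMr// ltr1n.
exists (limn x) => e N hN n Nn; apply/ler_addgt0Pr => t t0.
have [M _ hM] := (cvgrPdist_lt _ _).1 cx t t0.
have := hM (maxn M N) (leq_maxl _ _); have := hN n (maxn M N) Nn (leq_maxr _ _).
move: (x (maxn M N)) (limn x) => y l h1 h2.
rewrite (_ : x n - l = (x n - y) - (l - y)); last by rewrite opprB addrA subrK.
by apply: (le_trans (ler_normB _ _)); apply: lerD => //; exact: ltW.
Qed.

(** The limit comes with the rate of convergence, so that locally uniform Cauchy
    estimates pass to it. *)
Lemma quat_cauchy_limit (x : nat -> quat R) :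
  (forall e, 0 < e -> exists N : nat, forall m n, (N <= m)%N -> (N <= n)%N -> `|x m - x n| <= e) ->
  exists p, forall e (N : nat), (forall m n, (N <= m)%N -> (N <= n)%N -> `|x m - x n| <= e) ->
    forall n, (N <= n)%N -> `|x n - p| <= 4 * e.
Proof.
move=> hx; have C (l : {linear quat R -> R}) : (forall q, `|l q| <= `|q|) ->
    exists p, forall e (N : nat), (forall m n, (N <= m)%N -> (N <= n)%N -> `|x m - x n| <= e) ->
    forall n, (N <= n)%N -> `|l (x n) - p| <= e.
  move=> ll; have K (m n : nat) e : `|x m - x n| <= e -> `|l (x m) - l (x n)| <= e.
    by move=> h; rewrite -linearB; exact: le_trans (ll _) h.
  have [|p hp] := @real_cauchy_limit (fun n => l (x n)).
    by move=> e /hx[N hN]; exists N => m n Nm Nn; apply: K; exact: hN.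
  by exists p => e N hN; apply: hp => m n Nm Nn; apply: K; exact: hN.
have [p0 h0] := C _ (@ler_norm_qre R); have [p1 h1] := C _ (@ler_norm_qi R).
have [p2 h2] := C _ (@ler_norm_qj R); have [p3 h3] := C _ (@ler_norm_qk R).
exists (Quat p0 p1 p2 p3) => e N hN n Nn; apply: norm_components => /=.
- exact: h0 hN n Nn.
- exact: h1 hN n Nn.
- exact: h2 hN n Nn.
- exact: h3 hN n Nn.
Qed.

Lemma limn_einf_le (u : nat -> \bar R) (l : \bar R) : (forall n, (u n <= l)%E) ->
  (limn_einf u <= l)%E.
Proof.
move=> ul; rewrite limn_einf_lim; apply: lime_le; first exact: is_cvg_einfs.
by apply: nearW => n; apply: le_trans (ul n); apply: ereal_inf_lbound; exists n => /=.
Qed.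

End quat_limits.

Section weighted_bergman.
Context {R : realType}.
Variables (theta : R) (u : quat R) (gamma : quat R -> R) (U : set (quat R)).
Hypothesis oU : open U.
Hypothesis cgamma : forall z, U z -> {for z, continuous gamma}.
Hypothesis gamma_gt0 : forall z, U z -> 0 < gamma z.
Implicit Types (f g : quat R -> quat R) (z w : quat R) (e r : R).
Notation X := (bergman_space theta (fun=> u) gamma U).

Let mU : measurable U := measurable_open_quat oU.
Let gamma_ge0 z : U z -> 0 <= gamma z. Proof. by move=> /gamma_gt0/ltW. Qed.
Let mgamma : measurable_fun U gamma := continuous_measurable_quat_real oU cgamma.

(** The factor [e^<u, z>] removes a constant potential [u]; this reduces the
    spaces of this part to solutions of the Fueter equation. *)
Lemma untwist_monogenic f : hyperhol theta (fun=> u) U f ->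
  C1on U (fun w => qexpdot u w *: f w) /\
  forall w, U w -> fueter (fun w => qexpdot u w *: f w) w = 0.
Proof.
move=> /((hyperholE theta (fun=> u) f oU).1)[Cf Df]; split.
  by apply: (C1on_qscale oU) => //; exact: C1on_qexpdot.
by move=> w Uw; rewrite (fueter_qexpdot u (Cf.1 w Uw)) Df// scaler0.
Qed.

Lemma twist_hyperhol g : C1on U g -> (forall w, U w -> fueter g w = 0) ->
  hyperhol theta (fun=> u) U (fun w => qexpdot (- u) w *: g w).
Proof.
move=> Cg Dg; apply: (hyperholE theta (fun=> u) _ oU).2; split.
  by apply: (C1on_qscale oU) => //; exact: C1on_qexpdot.
move=> w Uw; rewrite (fueter_qexpdot (- u) (Cg.1 w Uw)) Dg// add0r mulNr scalerN.
by rewrite -scalerAr addNr.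
Qed.

(** [local_estimate] transfers because the weight and the exponential factor are
    bounded above and away from zero near [z0]. *)
Lemma eval_bounded_local z0 : U z0 -> exists2 r, 0 < r & exists2 C, 0 <= C &
  forall f e, fs_mem X f -> 0 < e -> normsq U gamma f <= e ^+ 2 ->
    forall z, `|z0 - z| < r -> `|f z| <= C * e.
Proof.
move=> Uz0; have [s s0 hs] := open_contains_cball oU Uz0.
pose r := s / 3; have r0 : 0 < r by rewrite divr_gt0.
have r3 : 3 * r = s by rewrite /r mulrC divfK.
have hU w : `|z0 - w| <= 3 * r -> U w by rewrite r3; exact: hs.
have ck p w : {for w, continuous (@qexpdot R p)} := C1on_continuous (C1on_qexpdot p openT) I.
have [M M0 hM] : exists2 M, 0 <= M & forall w, `|z0 - w| <= 3 * r ->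
    qexpdot u w ^+ 2 <= M * gamma w.
  have [|M M0 hM] := @bounded_on_cball R (fun w => qexpdot u w ^+ 2 * (gamma w)^-1) z0 (3 * r).
    move=> w /hU Uw; apply: (@continuousM_at R (quat R) (fun w => qexpdot u w ^+ 2)).
      exact: (@continuousM_at R (quat R) (qexpdot u) (qexpdot u) w (ck u w) (ck u w)).
    apply: (@continuous_comp_at R (quat R) R R gamma (fun t => t^-1)); first exact: cgamma.
    by apply: inv_continuous; rewrite gt_eqF// gamma_gt0.
  exists M => // w zw; rewrite -ler_pdivrMr ?gamma_gt0//; last exact: hU.
  exact: (le_trans (ler_norm _) (hM w zw)).
have [M' M'0 hM'] := @bounded_on_cball R (qexpdot (- u)) z0 (3 * r) (fun w _ => ck (- u) w).
pose K := 4 * ((conv_mass z0 r + 1) / (r ^+ 4 * @bump_mass R)).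
have K0 : 0 <= K.
  apply: mulr_ge0 => //; apply: divr_ge0; first by rewrite addr_ge0// conv_mass_ge0.
  by rewrite ltW// mulr_gt0 ?exprn_gt0 ?bump_mass_gt0.
exists r => //; exists (M' * (K * (M + 1))).
  by rewrite mulr_ge0// mulr_ge0// addr_ge0.
move=> f e [hf sf] e0 fe z zr.
have [Cg Dg] := untwist_monogenic hf.
have M1 : 0 < (M + 1) * e by rewrite mulr_gt0// ltr_wpDl.
have DU w : ball z0 (2 * r) w -> U w := @conv_ball_sub R U z0 r r0 hU w.
have mD : measurable (ball z0 (2 * r)) := measurable_qball _ _.
have sfD : measurable_fun (ball z0 (2 * r)) f := measurable_funS mU DU sf.1.
have gD : measurable_fun (ball z0 (2 * r)) gamma := measurable_funS mU DU mgamma.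
have kD p : measurable_fun (ball z0 (2 * r)) (qexpdot p).
  by apply: continuous_measurable_quat_real; [exact: ball_open|move=> w _; exact: ck].
have mfD := measurable_energy gD sfD.
have ge : (\int[qvol]_(w in ball z0 (2 * r)) (`|qexpdot u w *: f w| ^+ 2)%:E <=
    (((M + 1) * e) ^+ 2)%:E)%E.
  apply: (@le_trans _ _ (\int[qvol]_(w in ball z0 (2 * r)) (M%:E * (gamma w * `|f w| ^+ 2)%:E)))%E.
    apply: (@ge0_le_integral _ _ _ qvol _ mD).
    - by move=> w _; rewrite lee_fin sqr_ge0.
    - apply/measurable_EFinP; under eq_fun do rewrite normrZ exprMn.
      apply: measurable_funM; last first.
        by apply: measurable_funX; exact: (measurableT_comp (@measurable_qnorm R) sfD).
      by apply: measurable_funX; apply: measurableT_comp => //; exact: kD.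
    - by apply: measurable_funeM; exact/measurable_EFinP.
    move=> w Dw; rewrite -EFinM lee_fin normrZ exprMn (gtr0_norm (qexpdot_gt0 _ _)) [leRHS]mulrA.
    rewrite ler_wpM2r ?sqr_ge0//; apply: hM; move: Dw; rewrite -ball_normE /=.
    by move: (`|z0 - w|) r0 => a; lra.
  rewrite ge0_integralZl//; last 2 first.
  - exact/measurable_EFinP.
  - by move=> w /DU Uw; rewrite lee_fin (energy_ge0 gamma_ge0).
  apply: (@le_trans _ _ (M%:E * (normsq U gamma f)%:E)%E); last first.
    rewrite -EFinM lee_fin; apply: (le_trans (ler_wpM2l M0 fe)); rewrite exprMn.
    rewrite ler_wpM2r ?sqr_ge0// expr2 mulrDl mulrDr mulr1 mul1r.
    by move: (mulr_ge0 M0 M0); move: (M * M) M0 => MM; lra.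
  apply: lee_wpmul2l; first by rewrite lee_fin.
  rewrite -(normsqE mU mgamma gamma_ge0 sf); apply: ge0_subset_integral => //.
  - by apply/measurable_EFinP; apply: measurable_energy => //; exact: sf.1.
  - by move=> w Uw; rewrite lee_fin (energy_ge0 gamma_ge0).
have := local_estimate oU r0 hU Cg Dg M1 ge zr; rewrite -/K => gz.
have -> : f z = qexpdot (- u) z *: (qexpdot u z *: f z) by rewrite scalerA qexpdotN scale1r.
rewrite normrZ -mulrA; apply: ler_pM => //; last by rewrite -mulrA.
by apply: hM'; move: (`|z0 - z|) zr r0 => a; lra.
Qed.

Lemma eval_bounded_weighted : eval_bounded theta (fun=> u) gamma U.
Proof.
move=> z /eval_bounded_local[r r0 [C C0 hC]]; exists C => // f e hf e0 fe.
by apply: (hC f e hf e0 fe); rewrite subrr normr0.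
Qed.

(** A Cauchy sequence is locally uniformly Cauchy by [eval_bounded_local]. Its
    pointwise limit is hyperholomorphic by [monogenic_limit], and it is the
    limit in norm by Fatou's lemma. *)
Lemma complete_weighted : complete_space theta (fun=> u) gamma U.
Proof.
move=> F FX cF.
have BX := bergman_memB oU mgamma gamma_ge0.
have cF2 e : 0 < e -> exists N : nat, forall m n, (N <= m)%N -> (N <= n)%N ->
    normsq U gamma (fun z => F m z - F n z) <= e ^+ 2.
  move=> e0; have [N hN] := cF e e0; exists N => m n Nm Nn.
  by apply: (inner_norm_lt (theta := theta) (delta := fun=> u) gamma_ge0 e0); exact: hN.
have loc z0 : U z0 -> exists2 r, 0 < r & forall e, 0 < e -> exists N : nat,
    forall m n, (N <= m)%N -> (N <= n)%N -> forall w, `|z0 - w| < r -> `|F m w - F n w| <= e.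
  move=> /eval_bounded_local[r r0 [C C0 hC]]; exists r => // e e0.
  have C1 : 0 < C + 1 by rewrite ltr_wpDl.
  have d0 : 0 < e / (C + 1) by rewrite divr_gt0.
  have [N hN] := cF2 _ d0; exists N => m n Nm Nn w zw.
  have h := hC _ _ (BX _ _ _ _ (FX m) (FX n)) d0 (hN m n Nm Nn) w zw; apply: (le_trans h).
  by rewrite mulrA ler_pdivrMr// mulrC ler_pM2l// lerDl.
have /choice[f hf] z : exists p, U z -> forall e (N : nat),
    (forall m n, (N <= m)%N -> (N <= n)%N -> `|F m z - F n z| <= e) ->
    forall n, (N <= n)%N -> `|F n z - p| <= 4 * e.
  have [Uz|nUz] := pselect (U z); last by exists 0.
  have [|p hp] := @quat_cauchy_limit R (fun n => F n z); last by exists p.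
  move=> e e0; have [r r0 /(_ e e0)[N hN]] := loc z Uz; exists N => m n Nm Nn.
  by apply: hN => //; rewrite subrr normr0.
have locf z0 : U z0 -> exists2 r, 0 < r & forall e, 0 < e -> exists N : nat,
    forall n, (N <= n)%N -> forall w, `|z0 - w| < r -> `|F n w - f w| <= e.
  move=> Uz0; have [s s0 hs] := open_contains_cball oU Uz0.
  have [r r0 hr] := loc z0 Uz0; exists (Num.min r s); first by rewrite lt_min r0.
  move=> e e0; have e4 : 0 < e / 4 by rewrite divr_gt0.
  have [N hN] := hr _ e4; exists N => n Nn w; rewrite lt_min => /andP[wr /ltW/hs Uw].
  have := hf w Uw (e / 4) N (fun m n Nm Nn => hN m n Nm Nn w wr) n Nn.
  by rewrite mulrC divfK.
pose g_ n w := qexpdot u w *: F n w; pose g w := qexpdot u w *: f w.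
have [Cg Dg] : C1on U g /\ forall z, U z -> fueter g z = 0.
  apply: (@monogenic_limit R U g_) => //.
  - by move=> n; exact: (untwist_monogenic (FX n).1).1.
  - by move=> n; exact: (untwist_monogenic (FX n).1).2.
  move=> z0 /locf[r r0 hr].
  have ck p w : {for w, continuous (@qexpdot R p)} := C1on_continuous (C1on_qexpdot p openT) I.
  have [M M0 hM] := @bounded_on_cball R (qexpdot u) z0 r (fun w _ => ck u w).
  exists r => // e e0; have M1 : 0 < M + 1 by rewrite ltr_wpDl.
  have [N hN] := hr _ (divr_gt0 e0 M1); exists N => n Nn w zw.
  rewrite /g_ /g -scalerBr normrZ.
  apply: (@le_trans _ _ (M * (e / (M + 1)))).
    by apply: ler_pM => //; [exact: hM (ltW zw)|exact: hN].
  by rewrite mulrA ler_pdivrMr// mulrC ler_pM2l// lerDl.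
have fH : hyperhol theta (fun=> u) U f.
  have := twist_hyperhol Cg Dg; rewrite (_ : (fun w => qexpdot (- u) w *: g w) = f)//.
  by apply/funext => w; rewrite /g scalerA qexpdotN scale1r.
have mf : measurable_fun U f.
  by apply: continuous_measurable_quat => // z Uz; exact: (C1on_continuous fH.1 Uz).
have mFf n : measurable_fun U (fun z => F n z - f z).
  have mc : measurable_fun U (fun _ : quat R => -1 : quat R) by exact: measurable_cst.
  have := measurable_quat_add mU (FX n).2.1 (measurable_quat_mul mU mf mc).
  by under [X in measurable_fun _ X -> _]eq_fun do rewrite mulrN1.
have fatouF e n (N : nat) :
    (forall m, (N <= m)%N -> normsq U gamma (fun z => F n z - F m z) <= e ^+ 2) ->
    (\int[qvol]_(z in U) (gamma z * `|F n z - f z| ^+ 2)%:E <= (e ^+ 2)%:E)%E.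
  move=> hN.
  pose phi m z := (gamma z * `|F n z - F (m + N)%N z| ^+ 2)%:E.
  have SB m := (BX _ _ _ _ (FX n) (FX m)).2.
  have mphi m : measurable_fun U (phi m).
    by apply/measurable_EFinP; apply: measurable_energy => //; exact: (SB _).1.
  have phi0 m z : U z -> (0 <= phi m z)%E.
    by move=> Uz; rewrite lee_fin; exact: (energy_ge0 gamma_ge0 (fun z => F n z - F (m + N)%N z)).
  have := @fatou _ _ _ qvol U mU phi mphi phi0.
  have Elim z : U z -> limn_einf (phi^~ z) = (gamma z * `|F n z - f z| ^+ 2)%:E.
    move=> Uz; have cv : phi^~ z @ \oo --> (gamma z * `|F n z - f z| ^+ 2)%:E.
      apply: cvg_EFin; first by apply: nearW.
      have cn : `|F n z - F (m + N)%N z| @[m --> \oo] --> `|F n z - f z|.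
        apply/cvgrPdist_le => t t0; have [r r0 /(_ t t0)[M hM]] := locf z Uz.
        exists M => // m /= Mm; apply: (le_trans (ler_dist_dist _ _)).
        rewrite opprB addrC addrA subrK; apply: hM; first by rewrite (leq_trans Mm)// leq_addr.
        by rewrite subrr normr0.
      apply: cvgM; first exact: cvg_cst.
      rewrite (_ : (fun x => _) = (fun m => `|F n z - F (m + N)%N z| * `|F n z - F (m + N)%N z|)); last first.
        by apply/funext => m; rewrite /= expr2.
      by rewrite expr2; apply: cvgM.
    rewrite is_cvg_limn_einfE; last by apply/cvg_ex; eexists; exact: cv.
    exact/cvg_lim.
  rewrite (eq_integral (fun z => (gamma z * `|F n z - f z| ^+ 2)%:E)); last first.
    by move=> z; rewrite inE => Uz; rewrite Elim.
  move=> h1; apply: (le_trans h1); apply: limn_einf_le => m.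
  by rewrite (normsqE mU mgamma gamma_ge0 (SB _)) lee_fin; apply: hN; rewrite leq_addl.
have sFf : exists N : nat, sq_integrable gamma U (fun z => F N z - f z).
  have [N hN] := cF2 _ ltr01; exists N; split=> //.
  apply: (le_lt_trans (fatouF 1 N N _)); last by rewrite ltry.
  by move=> m Nm; exact: hN.
have sf : sq_integrable gamma U f.
  have [N sN] := sFf; have := sq_integrableB mU mgamma gamma_ge0 (FX N).2 sN.
  rewrite (_ : (fun z => _) = f)//; apply/funext => z.
  by rewrite opprB addrC subrK.
exists f; first by split.
apply/cvgrPdist_lt => e e0; have e2 : 0 < e / 2 by rewrite divr_gt0.
have [N hN] := cF2 _ e2; exists N => // n /= Nn.
rewrite sub0r normrN inner_normE ger0_norm ?sqrtr_ge0// -(inner_normE theta (fun=> u)).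
apply: (@le_lt_trans _ _ (e / 2)); last by rewrite ltr_pdivrMr// ltr_pMr// ltr1n.
apply: inner_norm_le; first exact: ltW.
have sn := sq_integrableB mU mgamma gamma_ge0 (FX n).2 sf.
rewrite -lee_fin -(normsqE mU mgamma gamma_ge0 sn); apply: (fatouF _ n N).
by move=> m Nm; exact: hN.
Qed.

End weighted_bergman.

(** * The operator J_T *)

Lemma conj_scale_mul {R : realType} (s : R) (p f g : quat R) :
  qconj (s *: (p * f)) * (s *: (p * g)) = (s ^+ 2 * `|p| ^+ 2) *: (qconj f * g).
Proof. by rewrite qnorm_sqr /qnormsq; apply: quat_ext => /=; ring. Qed.

Lemma norm_scale_mul {R : realType} (s : R) (p q : quat R) :
  `|s *: (p * q)| ^+ 2 = s ^+ 2 * `|p| ^+ 2 * `|q| ^+ 2.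
Proof. by rewrite normrZ qnormM !exprMn real_normK ?num_real// mulrA. Qed.

Section transformation.
Context {R : realType}.
Variables (theta : R) (u v a b c d : quat R) (Omega Xi : set (quat R)).
Hypothesis oOmega : open Omega.
Hypothesis oXi : open Xi.
Hypothesis Hc0 : c = 0 -> a * d <> 0.
Hypothesis Hc1 : c <> 0 -> b - a * c^-1 * d <> 0.
Hypothesis Xi_regular : forall z, Xi z -> c * z + d <> 0.
Hypothesis TXi : moebius a b c d @` Xi = Omega.
Implicit Types (f g : quat R -> quat R) (z w zeta : quat R).

Local Notation T := (moebius a b c d).
Local Notation C := (C_T a b c d).
Local Notation gamma := (gamma_T theta a b c d u v).
Local Notation J := (J_T theta a b c d u v).
Local Notation AOmega := (bergman_space theta (delta_T a b c d Xi v) (fun=> 1) Omega).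
Local Notation AXi := (bergman_space theta (fun=> u) gamma Xi).
Local Notation L2Omega := (L2space (fun=> 1) Omega).
Local Notation L2Xi := (L2space gamma Xi).

Let mOmega : measurable Omega := measurable_open_quat oOmega.
Let mXi : measurable Xi := measurable_open_quat oXi.

Lemma Xi_reg z : Xi z -> regular_points c d z.
Proof. by move=> /Xi_regular/eqP. Qed.

Lemma T_Omega z : Xi z -> Omega (T z).
Proof. by move=> Xz; rewrite -TXi; exists z. Qed.

Lemma Omega_T zeta : Omega zeta -> exists2 z, Xi z & T z = zeta.
Proof. by rewrite -TXi => -[z Xz <-]; exists z. Qed.

Local Notation S := (moebius_inv a b c d).

Lemma moebius_invK z : Xi z -> S (T z) = z.
Proof. by move=> /Xi_reg; exact: moebius_inv_left. Qed.

Lemma S_Xi zeta : Omega zeta -> Xi (S zeta).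
Proof. by move=> /Omega_T[z Xz <-]; rewrite moebius_invK. Qed.

Lemma C1on_moebius_inv : C1on Omega S.
Proof.
have C1 := C1on_qaffine (- 1) c a oOmega; have C2 := C1on_qaffine 1 d (- b) oOmega.
have E1 : (fun z => - 1 * z * c + a) = (fun zeta => a - zeta * c).
  by apply/funext => z; rewrite mulN1r mulNr addrC.
have E2 : (fun z => 1 * z * d + - b) = (fun zeta => zeta * d - b).
  by apply/funext => z; rewrite mul1r.
rewrite E1 in C1; rewrite E2 in C2.
apply: (C1on_qmul oOmega _ C2); apply: (C1on_qinv oOmega _ C1).
by move=> _ /Omega_T[z /Xi_reg rz <-]; exact: (moebius_inv_den Hc0 Hc1 rz).
Qed.

Lemma gamma_gt0 z : Xi z -> 0 < gamma z.
Proof.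
move=> /Xi_reg rz; rewrite /gamma_T mulr_gt0 ?expR_gt0//; exact: rho_T_gt0.
Qed.

Lemma gamma_continuous z : Xi z -> {for z, continuous gamma}.
Proof.
move=> Xz; suff Cg : C1on Xi gamma by exact: C1on_continuous Cg Xz.
have CE : C1on Xi (fun z => expR (- 2 * dotq theta (v - u) z)).
  apply: (C1on_expR oXi).
  have := C1onM oXi (@C1on_cst R (quat R) R Xi (- 2)) (C1on_qdot (v - u) oXi).
  by congr C1on; apply/funext => w; rewrite dotqE qdotC.
suff Crho : C1on Xi (rho_T a b c d) by exact: (C1onM oXi CE Crho).
have [c0|c0] := eqVneq c 0.
  rewrite (_ : rho_T a b c d = cst 1); first exact: C1on_cst.
  by apply/funext => w; rewrite /rho_T c0 eqxx.
have Cn : C1on Xi (fun z => (qnormsq (ycoef a b c d z))^-1).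
  apply: (C1onV oXi) => [w /Xi_reg rw|].
    by rewrite qnormsq_eq0 (ycoef_eq0 Hc1).
  by apply: (C1on_qnormsq oXi); exact: C1on_ycoef.
rewrite (_ : rho_T a b c d = fun z => (qnormsq (ycoef a b c d z))^-1)//.
by apply/funext => w; rewrite /rho_T (negbTE c0) qnorm_sqr.
Qed.

Let gamma_ge0 z : Xi z -> 0 <= gamma z. Proof. by move=> /gamma_gt0/ltW. Qed.
Let mgamma : measurable_fun Xi gamma := continuous_measurable_quat_real oXi gamma_continuous.
Let one_ge0 z : Omega z -> 0 <= (1 : R). Proof. by []. Qed.
Let mone : measurable_fun Omega (fun _ : quat R => 1 : R). Proof. exact: measurable_cst. Qed.

Lemma J_TE f z : J f z = qexpdot (v - u) z *: (C z * f (T z)).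
Proof. by rewrite /J_T dotqE. Qed.

Lemma gamma_qexpdot z : gamma z * qexpdot (v - u) z ^+ 2 = rho_T a b c d z.
Proof.
rewrite /gamma_T dotqE /qexpdot mulrAC expr2 -!expRD (_ : _ + _ = 0) ?expR0 ?mul1r//; ring.
Qed.

(** The exponential weights cancel against those in [J], and what is left is the
    Jacobian. *)
Lemma J_pairing f g z : gamma z *: (qconj (J f z) * J g z) =
  jacobian a b c d z *: (qconj (f (T z)) * g (T z)).
Proof.
rewrite !J_TE conj_scale_mul scalerA mulrA gamma_qexpdot //.
Qed.

Lemma measurable_J f : measurable_fun Omega f -> measurable_fun Xi (J f).
Proof.
move=> mf; have mT : measurable_fun Xi (f \o T).
  apply: (measurable_comp mOmega) => //; first by move=> _ [z Xz <-]; exact: T_Omega.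
  by apply: (@measurable_funS _ _ _ _ setT Xi T measurableT (@subsetT _ Xi)); exact: measurable_moebius.
have cC z : Xi z -> {for z, continuous C}.
  by move=> /Xi_reg rz; exact: C1on_continuous (C1on_C_T Hc1) rz.
have mC := continuous_measurable_quat oXi cC.
have mk : measurable_fun Xi (qexpdot (v - u)).
  apply: continuous_measurable_quat_real => // z Xz.
  exact: C1on_continuous (C1on_qexpdot (v - u) oXi) Xz.
have [m0 m1 m2 m3] := measurable_fun_quatP (measurable_quat_mul mXi mC mT).
rewrite (_ : J f = fun z => qexpdot (v - u) z *: (C z * f (T z))); last first.
  by apply/funext => z; rewrite J_TE.
by apply: measurable_fun_quat => //; apply: measurable_funM.
Qed.

Lemma J_isometry f g : measurable_fun Omega f -> measurable_fun Omega g ->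
  inner L2Xi (J f) (J g) = inner L2Omega f g.
Proof.
move=> mf mg; have mp : measurable_fun Omega (fun x => 1 *: (qconj (f x) * g x)).
  by under eq_fun do rewrite scale1r; exact: measurable_conj_mul.
have [m0 m1 m2 m3] := measurable_fun_quatP mp.
have H (l : {linear quat R -> R}) : measurable_fun Omega (fun x => l (1 *: (qconj (f x) * g x))) ->
    \int[qvol]_(z in Xi) l (gamma z *: (qconj (J f z) * J g z)) =
    \int[qvol]_(x in Omega) l (1 *: (qconj (f x) * g x)).
  move=> ml; rewrite /Rintegral; congr fine.
  rewrite (integral_moebius_signed Hc0 Hc1 mOmega Xi_regular TXi); last exact/measurable_EFinP.
  apply: eq_integral => z _; rewrite J_pairing scale1r linearZ /= -EFinM mulrC.
  by congr EFin.
apply: quat_ext.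
- exact: (H _ m0).
- exact: (H _ m1).
- exact: (H _ m2).
- exact: (H _ m3).
Qed.

Lemma J_energy f : measurable_fun Omega f ->
  (\int[qvol]_(z in Xi) (gamma z * `|J f z| ^+ 2)%:E =
   \int[qvol]_(x in Omega) (1 * `|f x| ^+ 2)%:E)%E.
Proof.
move=> mf; rewrite (integral_moebius_signed Hc0 Hc1 mOmega Xi_regular TXi); last first.
  apply/measurable_EFinP; exact: (measurable_energy mone mf).
apply: eq_integral => z _; rewrite -EFinM mul1r; congr EFin.
rewrite J_TE norm_scale_mul /jacobian -(gamma_qexpdot z).
move: (gamma z) (qexpdot _ z) (`|C z|) (`|f (T z)|) => *; ring.
Qed.

Lemma J_sq_integrable f : sq_integrable (fun=> 1) Omega f -> sq_integrable gamma Xi (J f).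
Proof. by move=> [mf hf]; split; [exact: measurable_J|rewrite J_energy]. Qed.

Lemma normsq_J f : measurable_fun Omega f -> normsq Xi gamma (J f) = normsq Omega (fun=> 1) f.
Proof. by move=> mf; rewrite /normsq /Rintegral (J_energy mf). Qed.

Lemma J_add f g : J (fun z => f z + g z) = fun z => J f z + J g z.
Proof. by apply/funext => z; rewrite !J_TE mulrDr scalerDr. Qed.

Lemma J_sub f g : J (fun z => f z - g z) = fun z => J f z - J g z.
Proof. by apply/funext => z; rewrite !J_TE mulrBr scalerBr. Qed.

Lemma J_mulr f q : J (fun z => f z * q) = fun z => J f z * q.
Proof. by apply/funext => z; rewrite !J_TE mulrA scalerAl. Qed.

Definition J_inv g zeta : quat R :=
  (C (S zeta))^-1 * (qexpdot (- (v - u)) (S zeta) *: g (S zeta)).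

Lemma J_invK g z : Xi z -> J (J_inv g) z = g z.
Proof.
move=> Xz; rewrite J_TE /J_inv moebius_invK// mulrA quat_mulfV ?mul1r; last first.
  exact: (C_T_neq0 Hc0 Hc1 (Xi_reg Xz)).
by rewrite scalerA mulrC qexpdotN scale1r.
Qed.

Lemma J_value f z : Xi z -> f (T z) = (C z)^-1 * (qexpdot (- (v - u)) z *: J f z).
Proof.
move=> Xz; rewrite J_TE scalerA qexpdotN scale1r mulrA quat_mulVf ?mul1r//.
exact: (C_T_neq0 Hc0 Hc1 (Xi_reg Xz)).
Qed.

Lemma J_inv_sq_integrable g : sq_integrable gamma Xi g -> sq_integrable (fun=> 1) Omega (J_inv g).
Proof.
move=> [mg hg]; have cS z : Omega z -> {for z, continuous S} := C1on_continuous C1on_moebius_inv.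
have mf : measurable_fun Omega (J_inv g).
  pose h z := (C z)^-1 * (qexpdot (- (v - u)) z *: g z).
  have mh : measurable_fun Xi h.
    apply: (measurable_quat_mul mXi).
      apply: (continuous_measurable_quat oXi) => z Xz; apply: C1on_continuous (Xz).
      apply: (C1on_qinv oXi); last exact: (C1on_sub Xi_reg (C1on_C_T Hc1)).
      by move=> w /Xi_reg rw; exact: (C_T_neq0 Hc0 Hc1 rw).
    have mk : measurable_fun Xi (qexpdot (- (v - u))).
      apply: continuous_measurable_quat_real => // z Xz.
      exact: C1on_continuous (C1on_qexpdot (- (v - u)) oXi) Xz.
    have [m0 m1 m2 m3] := measurable_fun_quatP mg.
    by apply: measurable_fun_quat => //; apply: measurable_funM.
  apply: (@measurable_comp _ _ _ _ _ _ Xi h Omega S mXi) => //.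
    by move=> _ [z Oz <-]; exact: S_Xi.
  exact: continuous_measurable_quat.
split=> //; rewrite -(J_energy mf); apply: le_lt_trans hg.
by rewrite le_eqVlt; apply/orP; left; apply/eqP; apply: eq_integral => z; rewrite inE => /J_invK ->.
Qed.

Lemma delta_TE z : Xi z -> delta_T a b c d Xi v (T z) = (B_T a b c d (T z))^-1 * v * A_T a b c d z.
Proof.
move=> Xz; rewrite /delta_T pinvKV//; last by rewrite inE.
move=> x y; rewrite !inE => Xx Xy; exact: (moebius_inj Hc0 Hc1 (Xi_reg Xx) (Xi_reg Xy)).
Qed.

(** Conformal covariance, in the form used here: conjugating by [C_T] turns
    the potential [delta_T] on [Omega] into the constant [v] on [Xi]. *)
Lemma moebius_covariance f z : Xi z -> differentiable f (T z) ->
  fueter (fun w => C w * f (T w)) z + v * (C z * f (T z)) =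
  weight_ratio a b c d *: (B_T a b c d (T z) *
    (fueter f (T z) + delta_T a b c d Xi v (T z) * f (T z))).
Proof.
move=> Xz df; rewrite (moebius_fueter Hc0 Hc1 (Xi_reg Xz) df).
rewrite [in RHS](mulrDr (B_T a b c d (T z))) [RHS]scalerDr; congr (_ + _).
rewrite delta_TE// (C_T_A_T Hc0 Hc1) -scalerAl -scalerAr; congr (_ *: _).
by rewrite !mulrA quat_mulfV ?mul1r// (B_T_neq0 Hc0 Hc1 (Xi_reg Xz)).
Qed.

Lemma C1on_pullback f : C1on Omega f -> C1on Xi (fun w => C w * f (T w)).
Proof.
move=> Cf; apply: (C1on_qmul oXi); first exact: (C1on_sub Xi_reg (C1on_C_T Hc1)).
exact: (C1on_comp oOmega oXi T_Omega Cf (C1on_sub Xi_reg (@C1on_moebius R a b c d))).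
Qed.

(** [C_T * (f o T)] has potential [v] by [moebius_covariance]; the exponential
    factor changes it to [v - (v - u) = u]. *)
Lemma J_hyperhol f : hyperhol theta (delta_T a b c d Xi v) Omega f ->
  hyperhol theta (fun=> u) Xi (J f).
Proof.
move=> /((hyperholE theta _ f oOmega).1)[Cf Df].
apply: (hyperholE theta (fun=> u) _ oXi).2.
have -> : J f = fun z => qexpdot (v - u) z *: (C z * f (T z)).
  by apply/funext => z; rewrite J_TE.
have Ch := C1on_pullback Cf.
split; first by apply: (C1on_qscale oXi) => //; exact: C1on_qexpdot.
move=> z Xz; rewrite (fueter_qexpdot (v - u) (Ch.1 z Xz)).
have := moebius_covariance Xz (Cf.1 _ (T_Omega Xz)); rewrite Df; last exact: T_Omega.
rewrite mulr0 scaler0 mulrBl => E.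
by rewrite addrA E sub0r scalerN -scalerAr addNr.
Qed.

Lemma J_inv_hyperhol g : hyperhol theta (fun=> u) Xi g ->
  hyperhol theta (delta_T a b c d Xi v) Omega (J_inv g).
Proof.
move=> /((hyperholE theta (fun=> u) g oXi).1)[Cg Dg].
apply: (hyperholE theta (delta_T a b c d Xi v) _ oOmega).2.
have Ck : C1on Xi (fun z => qexpdot (- (v - u)) z *: g z).
  by apply: (C1on_qscale oXi) => //; exact: C1on_qexpdot.
have Ch : C1on Xi (fun z => (C z)^-1 * (qexpdot (- (v - u)) z *: g z)).
  apply: (C1on_qmul oXi _ Ck); apply: (C1on_qinv oXi).
    by move=> w /Xi_reg rw; exact: (C_T_neq0 Hc0 Hc1 rw).
  exact: (C1on_sub Xi_reg (C1on_C_T Hc1)).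
have Cf : C1on Omega (J_inv g) := C1on_comp oXi oOmega S_Xi Ch C1on_moebius_inv.
split=> // _ /Omega_T[z Xz <-].
have := moebius_covariance Xz (Cf.1 _ (T_Omega Xz)).
have E w : Xi w -> qexpdot (- (v - u)) w *: g w = C w * J_inv g (T w).
  move=> Xw; rewrite /J_inv moebius_invK// mulrA quat_mulfV ?mul1r//.
  exact: (C_T_neq0 Hc0 Hc1 (Xi_reg Xw)).
rewrite -(fueter_eq_on oXi Xz E) (fueter_qexpdot (- (v - u)) (Cg.1 z Xz)) -E//.
have -> : fueter g z + - (v - u) * g z = - (v * g z).
  by rewrite opprB mulrBl addrA Dg// sub0r.
rewrite scalerN -scalerAr addNr => /esym/eqP.
rewrite scaler_eq0 gt_eqF ?(weight_ratio_gt0 Hc0 Hc1)//= quat_mul_eq0.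
by rewrite (negbTE (B_T_neq0 Hc0 Hc1 (Xi_reg Xz))) => /eqP.
Qed.

Lemma J_mem f : fs_mem AOmega f -> fs_mem AXi (J f).
Proof. by move=> [hf sf]; split; [exact: J_hyperhol|exact: J_sq_integrable]. Qed.

Lemma J_inv_mem g : fs_mem AXi g -> fs_mem AOmega (J_inv g).
Proof. by move=> [hf sf]; split; [exact: J_inv_hyperhol|exact: J_inv_sq_integrable]. Qed.

Lemma bergman_isometry : isometric_iso AOmega AXi J.
Proof.
split.
- exact: J_mem.
- move=> f g _ _; split=> [fg z Xz|JJ zeta /Omega_T[z Xz <-]].
    by rewrite !J_TE fg//; exact: T_Omega.
  by rewrite (J_value f Xz) (J_value g Xz) JJ.
- by move=> f g _ _ z _; rewrite J_add.
- by move=> f q _ z _; rewrite J_mulr.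
- by move=> f g [_ [mf _]] [_ [mg _]]; exact: J_isometry.
- by move=> g hg; exists (J_inv g); [exact: J_inv_mem|move=> z; exact: J_invK].
Qed.

(** With this criterion, [J_energy] shows that [J] preserves and reflects almost
    everywhere equality. *)
Lemma ae_eqE (D : set (quat R)) (wt : quat R -> R) f g : measurable D -> measurable_fun D wt ->
  (forall z, D z -> 0 < wt z) -> measurable_fun D f -> measurable_fun D g ->
  {ae qvol, forall z, D z -> f z = g z} <->
  (\int[qvol]_(z in D) (wt z * `|f z - g z| ^+ 2)%:E = 0)%E.
Proof.
move=> mD mwt wt0 mf mg.
have md : measurable_fun D (fun z => f z - g z).
  have mc : measurable_fun D (fun _ : quat R => -1 : quat R) by exact: measurable_cst.
  have := measurable_quat_add mD mf (measurable_quat_mul mD mg mc).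
  by under [X in measurable_fun _ X -> _]eq_fun do rewrite mulrN1.
have me : measurable_fun D (fun z => (wt z * `|f z - g z| ^+ 2)%:E).
  by apply/measurable_EFinP; exact: (measurable_energy mwt md).
have -> : (\int[qvol]_(z in D) (wt z * `|f z - g z| ^+ 2)%:E =
    \int[qvol]_(z in D) `|(wt z * `|f z - g z| ^+ 2)%:E|)%E.
  apply: eq_integral => z; rewrite inE => Dz.
  by rewrite gee0_abs// lee_fin mulr_ge0 ?sqr_ge0// ltW// wt0.
rewrite (ae_eq_integral_abs qvol mD me); split; apply: filterS => z h Dz.
  by rewrite h// subrr normr0 expr0n mulr0.
have := h Dz => -[] /eqP; rewrite mulf_eq0 gt_eqF ?wt0//= sqrf_eq0 normr_eq0 subr_eq0.
by move/eqP.
Qed.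

Lemma L2_isometry : isometric_iso L2Omega L2Xi J.
Proof.
split.
- exact: J_sq_integrable.
- move=> f g [mf _] [mg _].
  have h1 := ae_eqE mOmega mone (fun _ _ => ltr01) mf mg.
  have h2 := ae_eqE mXi mgamma gamma_gt0 (measurable_J mf) (measurable_J mg).
  have E : (\int[qvol]_(z in Xi) (gamma z * `|J f z - J g z| ^+ 2)%:E =
      \int[qvol]_(x in Omega) (1 * `|f x - g x| ^+ 2)%:E)%E.
    have mc : measurable_fun Omega (fun _ : quat R => -1 : quat R) by exact: measurable_cst.
    have md := measurable_quat_add mOmega mf (measurable_quat_mul mOmega mg mc).
    rewrite (_ : (fun x => f x + g x * -1) = (fun x => f x - g x)) in md; last first.
      by apply/funext => x; rewrite mulrN1.
    by rewrite -(J_energy md) J_sub.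
  split=> [/h1 fg|/h2 fg]; first by apply: h2.2; rewrite E.
  by apply: h1.2; rewrite -E.
- by move=> f g _ _; apply: aeW => z _; rewrite J_add.
- by move=> f q _; apply: aeW => z _; rewrite J_mulr.
- by move=> f g [mf _] [mg _]; exact: J_isometry.
- move=> g hg; exists (J_inv g); first exact: J_inv_sq_integrable.
  by apply: aeW => z; exact: J_invK.
Qed.

Let XiE : eval_bounded theta (fun=> u) gamma Xi :=
  eval_bounded_weighted theta u oXi gamma_continuous gamma_gt0.
Let XiC : complete_space theta (fun=> u) gamma Xi :=
  complete_weighted oXi gamma_continuous gamma_gt0.

(** Completeness and bounded evaluations on [Omega], where the potential is
    variable, are transported from [Xi] by [J]. *)
Lemma Omega_eval_bounded : eval_bounded theta (delta_T a b c d Xi v) (fun=> 1) Omega.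
Proof.
move=> _ /Omega_T[z Xz <-]; have [K K0 hK] := XiE Xz.
exists (`|(C z)^-1| * (qexpdot (- (v - u)) z * K)).
  by rewrite mulr_ge0// mulr_ge0// ltW// qexpdot_gt0.
move=> f e hf e0 fe; rewrite (J_value f Xz) qnormM -mulrA ler_wpM2l//.
rewrite normrZ (gtr0_norm (qexpdot_gt0 _ _)) -mulrA ler_wpM2l ?(ltW (qexpdot_gt0 _ _))//.
by apply: hK => //; [exact: J_mem|rewrite normsq_J//; exact: hf.2.1].
Qed.

Lemma inner_norm_J f : measurable_fun Omega f -> inner_norm AXi (J f) = inner_norm AOmega f.
Proof. by move=> mf; rewrite !inner_normE normsq_J. Qed.

Lemma Omega_complete : complete_space theta (delta_T a b c d Xi v) (fun=> 1) Omega.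
Proof.
move=> F FX cF.
have BX f g : fs_mem AOmega f -> fs_mem AOmega g -> fs_mem AOmega (fun z => f z - g z).
  exact: (bergman_memB oOmega mone one_ge0).
have [|e /cF[N hN]|G hG cv] := XiC (F := fun n => J (F n)).
- by move=> n; exact: J_mem.
- exists N => m n Nm Nn; rewrite -J_sub inner_norm_J; first exact: hN.
  exact: (BX _ _ (FX m) (FX n)).2.1.
exists (J_inv G); first exact: J_inv_mem.
rewrite (_ : (fun n => _) = (fun n => inner_norm AXi (fun z => J (F n) z - G z)))//.
apply/funext => n; rewrite -inner_norm_J; last first.
  exact: (BX _ _ (FX n) (J_inv_mem hG)).2.1.
rewrite J_sub /inner_norm; congr (Num.sqrt (qre _)); apply: eq_qintegral => z.
by rewrite inE => Xz /=; rewrite J_invK.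
Qed.

Lemma Omega_right_hilbert : right_hilbert AOmega.
Proof. exact: (bergman_right_hilbert oOmega mone one_ge0 Omega_eval_bounded Omega_complete). Qed.

Lemma Xi_right_hilbert : right_hilbert AXi.
Proof. exact: (bergman_right_hilbert oXi mgamma gamma_ge0 XiE XiC). Qed.

Lemma Omega_kernel_exists : exists K, bergman_kernel AOmega K.
Proof. exact: (bergman_kernel_exists oOmega mone one_ge0 Omega_eval_bounded Omega_complete). Qed.

Lemma Xi_kernel_exists : exists K, bergman_kernel AXi K.
Proof. exact: (bergman_kernel_exists oXi mgamma gamma_ge0 XiE XiC). Qed.

Section kernels.
Variable KOmega : quat R -> quat R -> quat R.
Hypothesis KO : bergman_kernel AOmega KOmega.

(** The right-hand side of the kernel formula. *)
Definition pullback_kernel z w : quat R := expR (dotq theta (v - u) (z + w)) *: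
  (C z * KOmega (T z) (T w) * qconj (C w)).

Lemma pullback_kernelE z w : qconj (pullback_kernel z w) =
  J (fun zeta => qconj (KOmega (T z) zeta)) w * (qexpdot (v - u) z *: qconj (C z)).
Proof.
rewrite J_TE /pullback_kernel dotqE qconjZ !qconjM qconjK.
rewrite -scalerAl -scalerAr scalerA mulrA; congr (_ *: _).
by rewrite /qexpdot -expRD addrC; congr expR; rewrite /qdot /=; ring.
Qed.

(** The isometry applied to [conj (KOmega (T z) _)] and [f]. The function [g] need
    only agree with [J f] almost everywhere, so that this covers the projection
    of square-integrable functions as well as the reproducing property. *)
Lemma pullback_kernel_integral g f z : sq_integrable gamma Xi g ->
  sq_integrable (fun=> 1) Omega f -> Xi z ->
  {ae qvol, forall w, Xi w -> J f w = g w} ->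
  qintegral Xi (fun w => gamma w *: (pullback_kernel z w * g w)) =
  J (bergman_proj AOmega KOmega f) z.
Proof.
move=> sg sf Xz Jfg; pose k zeta := qconj (KOmega (T z) zeta).
have kO : sq_integrable (fun=> 1) Omega k := (KO.1 (T z) (T_Omega Xz)).2.
have sJk := J_sq_integrable kO; have sJf := J_sq_integrable sf.
set q := qexpdot (v - u) z *: C z.
transitivity (qintegral Xi (fun w => q * (gamma w *: (qconj (J k w) * g w)))).
  apply: eq_qintegral => w _; rewrite -[pullback_kernel z w]qconjK pullback_kernelE -/k.
  rewrite qconjM qconjZ qconjK -/q.
  by rewrite -mulrA -scalerAr.
rewrite (qintegralMl mXi q (qintegrable_ip mXi mgamma gamma_ge0 sJk sg)).
have -> : qintegral Xi (fun w => gamma w *: (qconj (J k w) * g w)) =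
    inner L2Xi (J k) (J f).
  have [i0 i1 i2 i3] := qintegrable_ip mXi mgamma gamma_ge0 sJk sg.
  have [j0 j1 j2 j3] := qintegrable_ip mXi mgamma gamma_ge0 sJk sJf.
  have H (l : quat R -> R) :
      rintegrable Xi (fun w => l (gamma w *: (qconj (J k w) * g w))) ->
      rintegrable Xi (fun w => l (gamma w *: (qconj (J k w) * J f w))) ->
      \int[qvol]_(w in Xi) l (gamma w *: (qconj (J k w) * g w)) =
      \int[qvol]_(w in Xi) l (gamma w *: (qconj (J k w) * J f w)).
    move=> ig jf; rewrite /Rintegral; congr fine.
    have [mi _] := integrableP _ _ _ ig; have [mj _] := integrableP _ _ _ jf.
    apply: (@ae_eq_integral _ _ _ qvol Xi _ _ mXi mi mj).
    by apply: filterS Jfg => w h Xw /=; rewrite h.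
  apply: quat_ext; [exact: H i0 j0|exact: H i1 j1|exact: H i2 j2|exact: H i3 j3].
rewrite J_isometry; [|exact: kO.1|exact: sf.1].
rewrite J_TE scalerAl; congr (_ * _); apply: eq_qintegral => w _.
by rewrite /k qconjK.
Qed.

Lemma pullback_bergman_kernel : bergman_kernel AXi pullback_kernel.
Proof.
split=> [z Xz|g z hg Xz].
  have -> : (fun w => qconj (pullback_kernel z w)) = (fun w =>
      J (fun zeta => qconj (KOmega (T z) zeta)) w * (qexpdot (v - u) z *: qconj (C z))).
    by apply/funext => w; exact: pullback_kernelE.
  apply: (bergman_memM oXi mgamma gamma_ge0); apply: J_mem.
  exact: KO.1 (T_Omega Xz).
have hf := J_inv_mem hg.
rewrite (pullback_kernel_integral hg.2 hf.2 Xz); last by apply: aeW => w; exact: J_invK.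
rewrite -(J_invK g Xz) !J_TE; congr (_ *: (_ * _)).
exact: KO.2 hf (T_Omega Xz).
Qed.

End kernels.

Lemma bergman_kernel_transform KOmega KXi z w : bergman_kernel AOmega KOmega ->
  bergman_kernel AXi KXi -> Xi z -> Xi w -> KXi z w = pullback_kernel KOmega z w.
Proof.
move=> KO KX Xz Xw.
exact: (bergman_kernel_unique oXi mgamma gamma_ge0 XiE XiC KX (pullback_bergman_kernel KO)).
Qed.

Lemma bergman_proj_transform KOmega KXi Jinv g z : bergman_kernel AOmega KOmega ->
  bergman_kernel AXi KXi -> inverse_operator L2Omega L2Xi J Jinv ->
  sq_integrable gamma Xi g -> Xi z ->
  bergman_proj AXi KXi g z = J (bergman_proj AOmega KOmega (Jinv g)) z.
Proof.
move=> KO KX [_ JJ] sg Xz; have [sf Jfg] := JJ g sg.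
rewrite -(pullback_kernel_integral KO sg sf Xz Jfg); apply: eq_qintegral => w.
by rewrite inE => Xw /=; rewrite (bergman_kernel_transform KO KX Xz Xw).
Qed.

End transformation.

Theorem proposition3p8 (R : realType) (theta : R) (u v a b c d : quat R)
    (Omega Xi : set (quat R)) :
  0 <= theta < 2 * pi ->
  domain Omega -> domain Xi ->
  (c = 0 -> a * d <> 0) -> (c <> 0 -> b - a * c^-1 * d <> 0) ->
  (forall z, Xi z -> c * z + d <> 0) ->
  moebius a b c d @` Xi = Omega ->
  let T := moebius a b c d in
  let gamma := gamma_T theta a b c d u v in
  let AOmega := bergman_space theta (delta_T a b c d Xi v) (fun=> 1) Omega in
  let AXi := bergman_space theta (fun=> u) gamma Xi in
  let L2Omega := L2space (fun=> 1) Omega in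
  let L2Xi := L2space gamma Xi in
  let J := J_T theta a b c d u v in
  [/\ right_hilbert AOmega /\ right_hilbert AXi,
      isometric_iso AOmega AXi J,
      isometric_iso L2Omega L2Xi J,
      (exists K, bergman_kernel AOmega K) /\ (exists K, bergman_kernel AXi K) &
      forall KOmega KXi, bergman_kernel AOmega KOmega -> bergman_kernel AXi KXi ->
        (forall z w, Xi z -> Xi w ->
          KXi z w = expR (dotq theta (v - u) (z + w)) *:
            (C_T a b c d z * KOmega (T z) (T w) * qconj (C_T a b c d w)))
        /\
        (forall Jinv, inverse_operator L2Omega L2Xi J Jinv ->
          forall g z, sq_integrable gamma Xi g -> Xi z ->
            bergman_proj AXi KXi g z = J (bergman_proj AOmega KOmega (Jinv g)) z)].
Proof.
move=> _ [oOmega _ _] [oXi _ _] Hc0 Hc1 Xi_regular TXi T gamma AOmega AXi L2Omega L2Xi J.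
split.
- split; first exact: (Omega_right_hilbert theta u v oOmega oXi Hc0 Hc1 Xi_regular TXi).
  exact: (Xi_right_hilbert theta u v oXi Hc1 Xi_regular).
- exact: bergman_isometry.
- exact: L2_isometry.
- split; first exact: (Omega_kernel_exists theta u v oOmega oXi Hc0 Hc1 Xi_regular TXi).
  exact: (Xi_kernel_exists theta u v oXi Hc1 Xi_regular).
move=> KOmega KXi KO KX; split=> [z w Xz Xw|Jinv invJ g z sg Xz].
  exact: (bergman_kernel_transform oOmega oXi Hc0 Hc1 Xi_regular TXi KO KX Xz Xw).
exact: (bergman_proj_transform oOmega oXi Hc0 Hc1 Xi_regular TXi KO KX invJ sg Xz).
Qed.
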